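(* Let $\beta_1<0$ and $\beta_2>0$, and let $X_t$ be the Lipschitz solution of $$\frac{dX_t}{dt}=\begin{cases}\beta_1&\text{if }X_t<B_t,\\ \beta_2&\text{if }X_t>B_t,\end{cases}\qquad X_0=0.$$ Let $T_*=\sup\{t:X_t=B_t\}$ be the bifurcation time. Then $$\mathbb{E}\,T_*=\frac{\sigma^2}{|2\beta_1\beta_2|}.$$
   Context: $B_t$ is a Brownian motion with $B_0=0$ and variance $\mathbb{E}B_t^2=\sigma^2|t|$, $\sigma^2>0$. The Lipschitz solution of the equation is a.s. unique. *)

(* Defs.v *)
From HB Require Import structures.
From mathcomp Require Import all_boot all_order all_algebra.
From mathcomp Require Import all_classical all_reals all_analysis.

Set Implicit Arguments.
Unset Strict Implicit.
Unset Printing Implicit Defensive.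

Import Order.TTheory GRing.Theory Num.Theory.
Import numFieldNormedType.Exports.

Local Open Scope classical_set_scope.
Local Open Scope ring_scope.

(* The sets A i range over all Borel sets, including the whole line, so the
   product rule for all of I contains the one for every subfamily. *)
Definition mutually_independent (R : realType) (d : measure_display)
    (T : measurableType d) (P : probability T R) (I : finType)
    (Y : I -> T -> R) : Prop :=
  forall A : I -> set R, (forall i, measurable (A i)) ->
    (P (\bigcap_(i in [set: I]) (Y i @^-1` A i))
       = \prod_(i : I) P (Y i @^-1` A i))%E.

(* Time runs over the whole real line.  The second parameter of normal_prob is
   the standard deviation, so the increment over [s, t] has variance
   sigma ^+ 2 * (t - s), and B t has variance sigma ^+ 2 * `|t|. *)
Definition brownian_motion (R : realType) (d : measure_display)
    (T : measurableType d) (P : probability T R) (sigma : R)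
    (B : R -> {RV P >-> R}) : Prop :=
  [/\ {ae P, forall w, B 0 w = 0},
      {ae P, forall w, continuous (fun t => B t w)},
      forall s t : R, s < t -> forall A : set R, measurable A ->
        P ((fun w => B t w - B s w) @^-1` A)
          = normal_prob 0 (Num.sqrt (sigma ^+ 2 * (t - s))) A
    & forall (n : nat) (t : nat -> R), (forall i, t i < t i.+1) ->
        mutually_independent P
          (fun (i : 'I_n) w => B (t i.+1) w - B (t i) w)].

(* Pathwise notion, for a fixed path b.  Nothing is required of the derivative
   of x at the times when x t = b t. *)
Definition lipschitz_solution (R : realType) (beta1 beta2 : R)
    (b x : R -> R) : Prop :=
  [/\ lipschitz x,
      x 0 = 0,
      forall t : R, x t < b t -> is_derive t 1 x beta1
    & forall t : R, b t < x t -> is_derive t 1 x beta2].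

Definition bifurcation_time (R : realType) (b x : R -> R) : \bar R :=
  ereal_sup [set t%:E | t in [set t : R | x t = b t]].

(* Main.v *)
Require Import Defs.
From HB Require Import structures.
From mathcomp Require Import all_boot all_order all_algebra.
From mathcomp Require Import all_classical all_reals all_analysis.
From mathcomp Require Import measurable_realfun ring lra.

Set Implicit Arguments.
Unset Strict Implicit.
Unset Printing Implicit Defensive.

Import Order.TTheory GRing.Theory Num.Theory.
Import numFieldNormedType.Exports.

Local Open Scope classical_set_scope.
Local Open Scope ring_scope.

(* Write r = - beta1, l = beta2, q = sigma^2.  The gap V = B - X is pushed away from 0 at speed r or l,
   with noise B; seen from a point V = y > 0 it comes back to 0 with probability exp (- 2 r y / q).
   The expected last zero is the integral over s of the probability of a zero after time s, that is of
   E h (V s) with h the return probability, and the potential u of h, solution of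
   (q / 2) u'' + r u' = - h for y > 0 and (q / 2) u'' - l u' = - h for y < 0, glued at 0, has
   u 0 = q / (2 r l): by Dynkin's formula this is the answer.

   No stochastic calculus is used: on a grid of mesh e, V is squeezed between two Markov chains
   (up_drift and dn_drift) driven by the increments of B, which have the drift r or -l away from a band
   around 0 and for which Dynkin's formula holds up to O(e / b^2 + b), b being the width of the band.
   The scale function shows that the two chains are close in mean.  The events that V vanishes
   after time k e are bracketed by measurable events of these chains, and Fatou's lemma concludes. *)

(** No adaptedness of [X] is assumed, and its Lipschitz constant is random. So [V] is never treated
    as a Markov process: for each integer [N] the two chains, built from the increments of [B]
    alone, squeeze every solution with Lipschitz constant [N], and [N] tends to infinity only at the
    end. Inside the band the slope of [X] is known only up to [N]; this is harmless because the
    expected time spent there is O(b). Away from 0 the discretization loses nothing: the hitting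
    probability, the scale function and the potential are combinations of exponentials and affine
    factors for which a Gaussian step with drift satisfies its mean-value identity exactly, at every
    mesh. Errors come from the gluing at 0. For the lower bound the order of choices matters:
    horizon, then [N], then the band, then the mesh. The horizon is uniform in [N], so that Fatou's
    lemma can be applied to the horizon minus the approximation. *)

Section exponential_growth.
Context {R : realType}.
Implicit Types (f g : R -> R) (a c x y z : R).

(** A class stable under sums, products, shifts, gluing and the transition operators below, and
    integrable for every centred Gaussian law. One constant serves both as prefactor and as rate. *)
Definition mgrow f := measurable_fun [set: R] f /\
  exists2 c, 0 <= c & forall x, `|f x| <= c * expR (c * `|x|).

Lemma mgrow_le f g : measurable_fun [set: R] f -> mgrow g ->
  (forall x, `|f x| <= `|g x|) -> mgrow f.
Proof.
move=> mf [_ [c c0 hc]] fg; split=> //; exists c => // x.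
exact: le_trans (fg x) (hc x).
Qed.

Lemma mgrow_cst a : mgrow (fun=> a).
Proof.
split; first exact: measurable_cst.
exists `|a| => // x; rewrite ler_peMr//.
by rewrite -[leLHS]expR0 ler_expR mulr_ge0.
Qed.

Lemma mgrowD f g : mgrow f -> mgrow g -> mgrow (fun x => f x + g x).
Proof.
move=> [mf [c c0 fc]] [mg [e e0 ge]]; split; first exact: measurable_funD.
exists (c + e); first exact: addr_ge0.
move=> x; apply: le_trans (ler_normD _ _) _; rewrite mulrDl lerD//.
- apply: le_trans (fc x) _; rewrite ler_wpM2l// ler_expR ler_wpM2r// lerDl//.
- apply: le_trans (ge x) _; rewrite ler_wpM2l// ler_expR ler_wpM2r// lerDr//.
Qed.

Lemma mgrowM f g : mgrow f -> mgrow g -> mgrow (fun x => f x * g x).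
Proof.
move=> [mf [c c0 fc]] [mg [e e0 ge]]; split; first exact: measurable_funM.
exists (c * e + c + e); first by rewrite !addr_ge0// mulr_ge0.
move=> x; rewrite normrM; apply: (@le_trans _ _ ((c * e) * expR ((c + e) * `|x|))).
  by rewrite mulrDl expRD mulrACA ler_pM.
apply: ler_pM; rewrite ?mulr_ge0 ?expR_ge0//.
  by rewrite -addrA lerDl addr_ge0.
by rewrite ler_expR ler_wpM2r// -addrA lerDr mulr_ge0.
Qed.

Lemma mgrowN f : mgrow f -> mgrow (fun x => - f x).
Proof.
move=> [mf [c c0 fc]]; split; first exact: measurableT_comp.
by exists c => // x; rewrite normrN.
Qed.

Lemma mgrowB f g : mgrow f -> mgrow g -> mgrow (fun x => f x - g x).
Proof. by move=> mf mg; apply: mgrowD => //; exact: mgrowN. Qed.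

Lemma mgrowZ a f : mgrow f -> mgrow (fun x => a * f x).
Proof. by move=> mf; apply: mgrowM => //; exact: mgrow_cst. Qed.

Lemma mgrow_norm f : mgrow f -> mgrow (fun x => `|f x|).
Proof.
move=> [mf [c c0 fc]]; split; first exact: measurableT_comp.
by exists c => // x; rewrite normr_id.
Qed.

Lemma mgrow_id : mgrow (fun x => x).
Proof.
split; first exact: measurable_id.
exists 1 => // x; rewrite !mul1r; apply: le_trans (expR_ge1Dx _).
by rewrite lerDr.
Qed.

Lemma mgrow_expR a : mgrow (fun x => expR (a * x)).
Proof.
split.
  by apply: measurableT_comp => //; exact: measurable_funM.
exists (`|a| + 1); first by rewrite addr_ge0.
move=> x; rewrite ger0_norm ?expR_ge0//.
apply: (@le_trans _ _ (expR (`|a| * `|x|))).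
  by rewrite ler_expR -normrM ler_norm.
rewrite -[leLHS]mul1r ler_pM ?expR_ge0//; first by rewrite lerDr.
by rewrite ler_expR ler_wpM2r// lerDl.
Qed.

Lemma mgrow_expR_norm a : mgrow (fun x => expR (a * `|x|)).
Proof.
split.
  by apply: measurableT_comp => //; apply: measurable_funM => //.
exists (`|a| + 1); first by rewrite addr_ge0.
move=> x; rewrite ger0_norm ?expR_ge0//.
apply: (@le_trans _ _ (expR (`|a| * `|x|))).
  by rewrite ler_expR ler_wpM2r// ler_norm.
rewrite -[leLHS]mul1r ler_pM ?expR_ge0//; first by rewrite lerDr.
by rewrite ler_expR ler_wpM2r// lerDl.
Qed.

Lemma mgrowX n f : mgrow f -> mgrow (fun x => f x ^+ n).
Proof.
move=> mf; elim: n => [|n IH]; first exact: mgrow_cst.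
rewrite (_ : (fun x => _) = fun x => f x * f x ^+ n).
  exact: mgrowM.
by apply/funext => x; rewrite exprS.
Qed.

Lemma mgrow_shift z f : mgrow f -> mgrow (fun x => f (z + x)).
Proof.
move=> [mf [c c0 fc]]; split.
  by apply: measurableT_comp => //; exact: measurable_funD.
exists (c * expR (c * `|z|) + c).
  by rewrite addr_ge0// mulr_ge0// expR_ge0.
move=> x; apply: le_trans (fc _) _.
apply: (@le_trans _ _ ((c * expR (c * `|z|)) * expR (c * `|x|))).
  rewrite -mulrA ler_wpM2l// -expRD ler_expR -mulrDr ler_wpM2l//.
  exact: ler_normD.
apply: ler_pM; rewrite ?mulr_ge0 ?expR_ge0//; first by rewrite lerDl.
by rewrite ler_expR ler_wpM2r// lerDr mulr_ge0// expR_ge0.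
Qed.

Lemma mgrow_if (A : R -> bool) f g : measurable_fun [set: R] A ->
  mgrow f -> mgrow g -> mgrow (fun x => if A x then f x else g x).
Proof.
move=> mA [mf [c c0 fc]] [mg [e e0 ge]]; split; first exact: measurable_fun_ifT.
exists (c + e); first exact: addr_ge0.
move=> x; case: ifPn => _.
- apply: le_trans (fc x) _; apply: ler_pM; rewrite ?expR_ge0 ?lerDl//.
  by rewrite ler_expR ler_wpM2r// lerDl.
- apply: le_trans (ge x) _; apply: ler_pM; rewrite ?expR_ge0 ?lerDr//.
  by rewrite ler_expR ler_wpM2r// lerDr.
Qed.

End exponential_growth.

(** The Radon-Nikodym derivative of [normal_prob] equals [normal_pdf] almost everywhere, because the
    two have the same integral over every measurable set. *)
Lemma integral_normal_probE (R : realType) (m s : R) (f : R -> \bar R) : s != 0 ->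
  (forall x, 0 <= f x)%E -> measurable_fun [set: R] f ->
  (\int[normal_prob m s]_x f x =
   \int[lebesgue_measure]_x (f x * (normal_pdf m s x)%:E))%E.
Proof.
move=> s0 f0 mf.
pose g := (Radon_Nikodym_SigmaFinite.f (normal_prob m s) (@lebesgue_measure R)).
have dom := normal_prob_dominates m s.
rewrite -(Radon_Nikodym_SigmaFinite.change_of_variables dom)//.
have mg : measurable_fun [set: R] g.
  exact: measurable_int (Radon_Nikodym_SigmaFinite.f_integrable dom).
have mp : measurable_fun [set: R] (fun x => (normal_pdf m s x)%:E).
  by apply/measurable_EFinP; exact: measurable_normal_pdf.
apply: ge0_ae_eq_integral => //.
- exact: emeasurable_funM.
- exact: emeasurable_funM.
- by move=> x _; rewrite mule_ge0// Radon_Nikodym_SigmaFinite.f_ge0.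
- by move=> x _; rewrite mule_ge0// lee_fin normal_pdf_ge0.
suff : ae_eq lebesgue_measure setT g (fun x => (normal_pdf m s x)%:E).
  by apply: filterS => x /= /[apply] <-.
apply: integral_ae_eq => //.
- exact: Radon_Nikodym_SigmaFinite.f_integrable.
- by move=> E _ mE; rewrite -Radon_Nikodym_SigmaFinite.f_integral.
Qed.

(* Random variables use the measurable structure attached to [R : realType], whereas [normal_prob]
   lives on the (convertible, but differently displayed) generated one of [lebesgue_measure]. *)
Definition from_lebesgue (R : realType) : measurableTypeR R -> R := id.

Lemma measurable_from_lebesgue (R : realType) :
  measurable_fun [set: measurableTypeR R] (@from_lebesgue R).
Proof. by move=> _ A mA; rewrite setTI. Qed.

HB.instance Definition _ (R : realType) := isMeasurableFun.Build _ _ _ _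
  (@from_lebesgue R) (@measurable_from_lebesgue R).

(** * Gaussian means *)

Section gaussian_mean.
Context {R : realType}.
Implicit Types (f g : R -> R) (a c v x : R).

(** The parameter is the variance: a grid cell of length [e] carries noise of law
    [gauss (q * e)]. *)
Definition gauss v : probability R R :=
  distribution (normal_prob 0 (Num.sqrt v)) (@from_lebesgue R).

Lemma gaussE v (A : set R) : gauss v A = normal_prob 0 (Num.sqrt v) A.
Proof. by []. Qed.

Lemma integral_gauss v (f : R -> \bar R) : (forall x, 0 <= f x)%E ->
  measurable_fun [set: R] f ->
  (\int[gauss v]_x f x = \int[normal_prob 0 (Num.sqrt v)]_x f x)%E.
Proof. by move=> f0 mf; rewrite ge0_integral_distribution. Qed.

Definition gmean v f : R := \int[gauss v]_x f x.

(** Completing the square: the exponential times the centred density is a constant times the density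
    of mean [a * v]. *)
Lemma integral_gauss_expR v a : 0 < v ->
  (\int[gauss v]_x (expR (a * x))%:E = (expR (a ^+ 2 * v / 2))%:E)%E.
Proof.
move=> v0; have sv0 : Num.sqrt v != 0 by rewrite gt_eqF// sqrtr_gt0.
have me : measurable_fun [set: R] (fun x => (expR (a * x))%:E).
  by apply/measurable_EFinP; exact: (mgrow_expR a).1.
rewrite integral_gauss// integral_normal_probE//.
transitivity (\int[lebesgue_measure]_x ((expR (a ^+ 2 * v / 2))%:E *
    (normal_pdf (a * v) (Num.sqrt v) x)%:E))%E.
  apply: eq_integral => x _; rewrite -!EFinM !normal_pdfE// /normal_fun.
  congr EFin; rewrite [LHS]mulrCA [RHS]mulrCA -!expRD; congr (_ * expR _).
  rewrite sqr_sqrtr ?ltW//; field; exact: lt0r_neq0.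
rewrite ge0_integralZl//.
- by rewrite integral_normal_pdf mule1.
- by apply/measurable_EFinP; exact: measurable_normal_pdf.
- by move=> x _; rewrite lee_fin normal_pdf_ge0.
Qed.

Lemma gmean_expR v a : 0 < v -> gmean v (fun x => expR (a * x)) = expR (a ^+ 2 * v / 2).
Proof. by move=> v0; rewrite /gmean /Rintegral integral_gauss_expR. Qed.

Lemma mgrow_int v f : 0 < v -> mgrow f -> (gauss v).-integrable setT (EFin \o f).
Proof.
move=> v0 [mf [c c0 fc]].
apply: (@le_integrable _ _ _ _ _ _ _
  (EFin \o (fun x => c * expR (c * x) + c * expR (- c * x)))) => //.
- exact/measurable_EFinP.
- move=> x _ /=; rewrite lee_fin; apply: le_trans (fc x) _.
  apply: le_trans (ler_norm _).
  case: ger0P => _; first by rewrite lerDl mulr_ge0// expR_ge0.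
  by rewrite mulrN mulNr lerDr mulr_ge0// expR_ge0.
have I b : (gauss v).-integrable setT (EFin \o (fun x => expR (b * x))).
  apply/integrableP; split; first by apply/measurable_EFinP; exact: (mgrow_expR b).1.
  under eq_integral do rewrite /= ger0_norm ?expR_ge0//.
  by rewrite integral_gauss_expR// ltry.
rewrite (_ : _ \o _ = ((fun x => c%:E * (EFin \o (fun x => expR (c * x))) x) \+
  (fun x => c%:E * (EFin \o (fun x => expR (- c * x))) x))%E); last exact/funext.
by apply: integrableD => //; apply: integrableZl.
Qed.

Lemma gmean_le v f g : 0 < v -> mgrow f -> mgrow g ->
  (forall x, f x <= g x) -> gmean v f <= gmean v g.
Proof. by move=> v0 mf mg fg; apply: le_Rintegral => //; exact: mgrow_int. Qed.

Lemma gmeanD v f g : 0 < v -> mgrow f -> mgrow g ->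
  gmean v (fun x => f x + g x) = gmean v f + gmean v g.
Proof. by move=> v0 mf mg; apply: RintegralD => //; exact: mgrow_int. Qed.

Lemma gmeanB v f g : 0 < v -> mgrow f -> mgrow g ->
  gmean v (fun x => f x - g x) = gmean v f - gmean v g.
Proof. by move=> v0 mf mg; apply: RintegralB => //; exact: mgrow_int. Qed.

Lemma gmeanZ v a f : 0 < v -> mgrow f ->
  gmean v (fun x => a * f x) = a * gmean v f.
Proof. by move=> v0 mf; apply: RintegralZl => //; exact: mgrow_int. Qed.

Lemma gmean_cst v a : gmean v (fun=> a) = a.
Proof.
rewrite /gmean Rintegral_cst// (_ : fine _ = 1) ?mulr1//.
exact: (congr1 fine (probability_setT (gauss v))).
Qed.

Lemma gmean_dist v f g : 0 < v -> mgrow f -> mgrow g ->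
  `|gmean v f - gmean v g| <= gmean v (fun x => `|f x - g x|).
Proof.
move=> v0 mf mg; rewrite -gmeanB//; apply: le_normr_Rintegral => //.
by apply: mgrow_int => //; exact: mgrowB.
Qed.

(* The tangent line of [b |-> expR (b * x)] at [a] lies below it, so [gmean v (x * expR (a * x))]
   is a subgradient at [a] of the differentiable function [b |-> expR (b ^+ 2 * v / 2)]. *)
Lemma gmean_MexpR v a : 0 < v ->
  gmean v (fun x => x * expR (a * x)) = a * v * expR (a ^+ 2 * v / 2).
Proof.
move=> v0; set N := gmean v _.
have mN : mgrow (fun x => x * expR (a * x)).
  by apply: mgrowM; [exact: mgrow_id|exact: mgrow_expR].
pose F b := expR (b ^+ 2 * v / 2) - (b - a) * N.
have FF b : F a <= F b.
  rewrite /F subrr mul0r subr0 lerBrDr.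
  rewrite -!gmean_expR// -gmeanZ// -gmeanD//; last 2 first.
    exact: mgrow_expR.
    exact: mgrowZ.
  apply: gmean_le => //; last 2 first.
  - exact: mgrow_expR.
  - move=> x; have := ler_wpM2r (expR_ge0 (a * x)) (expR_ge1Dx ((b - a) * x)).
    rewrite -expRD -mulrDl subrK; apply: le_trans.
    by rewrite [leRHS]mulrDl mul1r mulrA.
  by apply: mgrowD; [exact: mgrow_expR|exact: mgrowZ].
have dF (b : R) : is_derive b 1 F (expR (b ^+ 2 * v / 2) * (b * v) - N).
  have h1 : is_derive b 1 (fun b : R => b ^+ 2 * v / 2) (b * v).
    by apply: is_derive_eq; rewrite /GRing.scale/=; field.
  have h2 : is_derive b 1 (fun b : R => (b - a) * N) N.
    by apply: is_derive_eq; rewrite /GRing.scale/=; ring.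
  by apply: is_deriveB; exact: (@is_derive1_comp _ expR).
have dFa : is_derive a 1 F 0.
  apply: (@derive1_at_min _ F (a - 1) (a + 1)) => //; first lra.
  by rewrite in_itv/=; apply/andP; split; lra.
have : 'D_1 F a = 0 by exact: derive_val.
rewrite (@derive_val _ _ _ _ _ _ _ (dF a)) => /eqP; rewrite subr_eq0 => /eqP <-.
by rewrite mulrC.
Qed.

Lemma gmean_expR_norm_le v c : 0 < v -> v <= 1 -> 0 <= c ->
  gmean v (fun x => expR (c * `|x|)) <= 2 * expR (c ^+ 2 * v / 2).
Proof.
move=> v0 v1 c0.
apply: (@le_trans _ _ (gmean v (fun x => expR (c * x) + expR (- c * x)))).
  apply: gmean_le => //; first exact: mgrow_expR_norm.
    by apply: mgrowD; exact: mgrow_expR.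
  move=> x; case: ger0P => _; first by rewrite lerDl expR_ge0.
  by rewrite mulrN mulNr lerDr expR_ge0.
rewrite gmeanD//; [|exact: mgrow_expR..].
by rewrite !gmean_expR// sqrrN mulrDl mul1r.
Qed.

Lemma expR_ge_X2 (y : R) : 0 <= y -> y ^+ 2 <= 2 * expR y.
Proof.
move=> y0; have := expR_ge1Dxn 1 y0; rewrite (_ : 2`!%:R = 2 :> R)//; lra.
Qed.

Lemma expR_ge_X4 (y : R) : 0 <= y -> y ^+ 4 <= 24 * expR y.
Proof.
move=> y0; have := expR_ge1Dxn 3 y0; rewrite (_ : 4`!%:R = 24 :> R)//; lra.
Qed.

(* Scaling to unit variance: [|x| ^+ n <= n! * sqrt v ^+ n * expR (|x| / sqrt v)]. *)
Lemma gmean_moment v c : 0 < v -> v <= 1 -> 0 <= c ->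
  gmean v (fun x => x ^+ 2 * expR (c * `|x|)) <= 48 * expR ((c + 1) ^+ 2 / 2) * v /\
  gmean v (fun x => x ^+ 4 * expR (c * `|x|)) <= 48 * expR ((c + 1) ^+ 2 / 2) * v ^+ 2.
Proof.
move=> v0 v1 c0; pose w := Num.sqrt v.
have w0 : 0 < w by rewrite sqrtr_gt0.
have w2 : w ^+ 2 = v by rewrite sqr_sqrtr ?ltW.
have w1 : w <= 1 by rewrite -sqrtr1 ler_wsqrtr.
have cw : gmean v (fun x => expR ((c + w^-1) * `|x|)) <= 2 * expR ((c + 1) ^+ 2 / 2).
  apply: le_trans (gmean_expR_norm_le _ _ _) _ => //.
    by rewrite addr_ge0// invr_ge0 ltW.
  (* The exponent is [(c * w + 1) ^+ 2 / 2], and [w <= 1] bounds it uniformly in [v]. *)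
  rewrite ler_pM2l// ler_expR ler_pM2r// -w2 -exprMn mulrDl mulVf ?gt_eqF//.
  have cw1 : c * w <= c by rewrite ler_piMr.
  have cw0 : 0 <= c * w by rewrite mulr_ge0// ltW.
  by apply: lerXn2r; rewrite ?nnegrE; lra.
have key n (K : R) : 0 <= K -> (forall y, 0 <= y -> y ^+ n <= K * expR y) ->
    ~~ odd n ->
    gmean v (fun x => x ^+ n * expR (c * `|x|)) <= 2 * K * expR ((c + 1) ^+ 2 / 2) * w ^+ n.
  move=> K0 hK on.
  apply: (@le_trans _ _ (gmean v (fun x => (K * w ^+ n) * expR ((c + w^-1) * `|x|)))).
    apply: gmean_le => //.
    - apply: mgrowM; last exact: mgrow_expR_norm.
      exact/mgrowX/mgrow_id.
    - by apply: mgrowZ; exact: mgrow_expR_norm.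
    move=> x; rewrite mulrDl [c * _ + _]addrC expRD mulrA ler_pM2r ?expR_gt0//.
    have wV0 : 0 <= w^-1 by rewrite invr_ge0 ltW.
    have := hK _ (mulr_ge0 wV0 (normr_ge0 x)).
    rewrite exprMn exprVn -normrX ger0_norm ?exprn_even_ge0// => h.
    by rewrite mulrAC -ler_pdivrMr ?exprn_gt0// mulrC.
  rewrite gmeanZ//; last exact: mgrow_expR_norm.
  apply: (@le_trans _ _ (K * w ^+ n * (2 * expR ((c + 1) ^+ 2 / 2)))).
    by rewrite ler_wpM2l// mulr_ge0// exprn_ge0// ltW.
  by rewrite le_eqVlt; apply/orP; left; apply/eqP; ring.
split.
- apply: le_trans (key 2 2 _ expR_ge_X2 _) _ => //; rewrite w2 ler_pM2r//.
  by rewrite ler_pM2r ?expR_gt0//; lra.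
- apply: le_trans (key 4 24 _ expR_ge_X4 _) _ => //.
  rewrite (_ : w ^+ 4 = v ^+ 2); last by rewrite -w2 -exprM.
  by rewrite ler_pM2r ?exprn_gt0// ler_pM2r ?expR_gt0//; lra.
Qed.

(** Integrating [x * expR x - x <= x ^+ 2 * expR |x|] with [gmean_MexpR] gives at least
    [v * expR (v / 2)]. The weight is the one of the fourth-moment bound, with which this is
    compared in [gmean_huber]. *)
Lemma gmean_X2expR_ge v : 0 < v -> v <= gmean v (fun x => x ^+ 2 * expR `|x|).
Proof.
move=> v0; have me a : mgrow (fun x : R => x * expR (a * x)).
  by apply: mgrowM; [exact: mgrow_id|exact: mgrow_expR].
apply: (@le_trans _ _ (gmean v (fun x => x * expR (1 * x) - x * expR (0 * x)))).
  rewrite gmeanB// !gmean_MexpR// !mul0r subr0 !mul1r expr1n mul1r.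
  by rewrite ler_peMr ?ltW// -expR0 ltr_expR divr_gt0.
apply: gmean_le => //; first exact: mgrowB.
  apply: mgrowM; first exact/mgrowX/mgrow_id.
  have := mgrow_expR_norm (1 : R); rewrite (_ : (fun _ => _) = fun x => expR `|x|)//.
  by apply/funext => x; rewrite mul1r.
move=> x; rewrite mul0r mul1r expR0 mulr1.
case: (ger0P x) => x0.
- have : expR x - 1 <= x * expR x.
    have := expR_ge1Dx (- x).
    rewrite -(ler_pM2r (expR_gt0 x)) -expRD addNr expR0; lra.
  by move=> /(ler_wpM2l x0); lra.
- have h1 := expR_ge1Dx x.
  have h2 : 1 <= expR (- x) by rewrite -expR0 ler_expR; lra.
  have h3 : x ^+ 2 <= x ^+ 2 * expR (- x) by rewrite ler_peMr// sqr_ge0.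
  by apply: le_trans h3; rewrite expr2; nra.
Qed.

End gaussian_mean.

(** * Random walks driven by Gaussian noise *)

Section joint_law.
Context {d : measure_display} {T : measurableType d} {R : realType}.
Variables (P : probability T R) (Q : probability R R).

(** Uniqueness of product measures: rectangles determine the law of the pair restricted to [D]. In
    [walk_indep], [D] is an event of the later noise and [p] its probability. *)
Lemma joint_law (U Y : T -> R) (D : set T) (p : {nonneg R}) :
  measurable_fun [set: T] U -> measurable_fun [set: T] Y -> measurable D ->
  (forall A B, measurable A -> measurable B ->
    P (U @^-1` A `&` Y @^-1` B `&` D) = P (U @^-1` A) * Q B * p%:num%:E)%E ->
  forall X : set (R * R), measurable X ->
    (P ((fun w => (U w, Y w)) @^-1` X `&` D)
     = p%:num%:E * \int[P]_w Q (xsection X (U w)))%E.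
Proof.
move=> mU mY mD PD X mX.
pose U' : {mfun T >-> R} := HB.pack U (isMeasurableFun.Build _ _ _ _ U mU).
pose phi w := (U w, Y w).
have mphi : measurable_fun [set: T] phi by exact: measurable_fun_pair.
pose phi' : {mfun T >-> (R * R)%type} :=
  HB.pack phi (isMeasurableFun.Build _ _ _ _ phi mphi).
pose m' := pushforward (mrestr P mD) phi'.
transitivity ((mscale p (distribution P U') \x Q)%E X).
  apply/esym; apply: (@product_measure_unique _ _ _ _ _ _ _ m') => //.
  move=> A B mA mB; rewrite /m' /pushforward /mrestr/= /mscale/=.
  by rewrite /distribution /pushforward/= -muleA [RHS]muleC -(PD A B mA mB).
rewrite /= /product_measure1/= ge0_integral_mscale//; last first.
  exact: measurable_fun_xsection.
congr (_ * _)%E; rewrite ge0_integral_distribution//.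
exact: measurable_fun_xsection.
Qed.

End joint_law.

Definition iid_gauss (d : measure_display) (T : measurableType d) (R : realType)
    (P : probability T R) (v : R) (xi : nat -> T -> R) : Prop :=
  [/\ forall i, measurable_fun [set: T] (xi i),
      forall i A, measurable A -> P (xi i @^-1` A) = gauss v A
    & forall n, mutually_independent P (fun (i : 'I_n) => xi i)].

(* [a k] is the absorbing set at time [k], [g k] the drift map and [xi] the noise. *)
Fixpoint walk (R : realType) (T : Type) (a : nat -> R -> bool) (g : nat -> R -> R)
    (xi : nat -> T -> R) (k : nat) (w : T) : R :=
  if k is k'.+1 then
    let z := walk a g xi k' w in if a k' z then z else g k' z + xi k' w
  else 0.

Section walk.
Context {d : measure_display} {T : measurableType d} {R : realType}.
Variables (P : probability T R) (v : R) (xi : nat -> T -> R).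
Hypothesis v0 : 0 < v.
Hypothesis xiP : iid_gauss P v xi.
Variables (a : nat -> R -> bool) (g : nat -> R -> R).
Hypothesis ma : forall k, measurable_fun [set: R] (a k).
Hypothesis mg : forall k, measurable_fun [set: R] (g k).

Notation S := (walk a g xi).

Let mxi i : measurable_fun [set: T] (xi i).
Proof. by case: xiP. Qed.

Lemma measurable_walk k : measurable_fun [set: T] (S k).
Proof.
elim: k => [|k IH] /=; first exact: measurable_cst.
apply: measurable_fun_ifT => //; first exact: measurableT_comp (ma k) IH.
by apply: measurable_funD => //; exact: measurableT_comp (mg k) IH.
Qed.

Let future n k (C : nat -> set R) : set T :=
  [set w | forall i, (k <= i < n)%N -> C i (xi i w)].

Let mfuture n k C : (forall i, measurable (C i)) -> measurable (future n k C).
Proof.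
move=> mC.
rewrite (_ : future n k C = \bigcap_(i in [set i | (k <= i < n)%N]) (xi i @^-1` C i)).
  apply: bigcap_measurableType => i _.
  by rewrite -[X in measurable X]setTI; exact: mxi.
by apply/seteqP; split => w wC i /=; exact: wC.
Qed.

Let step k z (x : R) := if a k z then z else g k z + x.

Let mstep k : measurable_fun [set: R * R] (fun zx => step k zx.1 zx.2).
Proof.
apply: measurable_fun_ifT => //; first exact: measurableT_comp (ma k) _.
by apply: measurable_funD => //; exact: measurableT_comp (mg k) _.
Qed.

(** The induction needs independence from the whole future noise: a step consumes [xi k], since
    [S k.+1] is a function of [S k] and [xi k], and keeps the rest as the set [D] of [joint_law]. *)
Lemma walk_indep k n (A : set R) (C : nat -> set R) : measurable A ->
  (forall i, measurable (C i)) ->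
  (P (S k @^-1` A `&` future n k C) =
   P (S k @^-1` A) * \prod_(k <= i < n) gauss v (C i))%E.
Proof.
elim: k n A C => [|k IH] n A C mA mC.
  have [_ xilaw xiind] := xiP.
  have -> : future n 0 C = \bigcap_(i in [set: 'I_n]) (xi i @^-1` C i).
    apply/seteqP; split=> [w wC i _|w wC i /= ni].
      exact: wC (ltn_ord i).
    exact: (wC (Ordinal ni)).
  have [A0|A0] := pselect (A 0).
    rewrite (_ : S 0 @^-1` A = setT) ?setTI ?probability_setT ?mul1e; last first.
      by apply/seteqP; split.
    rewrite xiind// big_mkord; apply: eq_bigr => i _; exact: xilaw.
  rewrite (_ : S 0 @^-1` A = set0) ?set0I ?measure0 ?mul0e//.
  by apply/seteqP; split.
have IHp (p : {nonneg R}) m : (k < m)%N ->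
    p%:num%:E = (\prod_(k.+1 <= i < m) gauss v (C i))%E ->
    forall X, measurable X ->
   (P ((fun w => (S k w, xi k w)) @^-1` X `&` future m k.+1 C)
     = p%:num%:E * \int[P]_w gauss v (xsection X (S k w)))%E.
  move=> km pE; apply: joint_law => //.
  - exact: measurable_walk.
  - exact: mfuture.
  move=> A' B mA' mB.
  (* The constraint on [xi k] joins the future constraints, so the induction hypothesis applies from
     time [k]. *)
  pose C' i := if i == k then B else C i.
  have mC' i : measurable (C' i) by rewrite /C'; case: ifP.
  rewrite (_ : _ `&` _ = S k @^-1` A' `&` future m k C'); last first.
    rewrite -setIA; congr setI; apply/seteqP; split => [w [wB wC] i /andP[ki im]|w wC].
      rewrite /C'; case: eqP => [->//|/eqP ik]; apply: wC.
      by rewrite im andbT ltn_neqAle eq_sym ik.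
    split; first by have := wC k; rewrite /C' eqxx leqnn km; exact.
    move=> i /andP[ki im]; have := wC i; rewrite /C' gtn_eqF// im ltnW//; exact.
  rewrite IH// big_ltn// -muleA pE {1}/C' eqxx; congr (_ * (_ * _))%E.
  by apply: eq_big_nat => i /andP[ki _]; rewrite /C' gtn_eqF.
have [nk|kn] := leqP n k.+1.
  rewrite big_geq// mule1 (_ : future _ _ _ = setT) ?setIT//.
  apply/seteqP; split => // w _ i /andP[ki /leq_trans/(_ nk)].
  by rewrite ltnNge ki.
have [p pE] : exists p : {nonneg R}, p%:num%:E = (\prod_(k.+1 <= i < n) gauss v (C i))%E.
  elim/big_rec: _ => [|i _ _ [p <-]]; first by exists 1%:nng.
  have fi : (0 <= fine (gauss v (C i)))%R by exact: fine_ge0.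
  have p0 : 0 <= p%:num by [].
  exists (NngNum (mulr_ge0 fi p0)) => /=.
  rewrite EFinM fineK// ge0_fin_numE//.
  by apply: le_lt_trans (probability_le1 (gauss v) (mC i)) _; rewrite ltry.
pose X := (fun zx => step k zx.1 zx.2) @^-1` A.
have mX : measurable X by rewrite -[X]setTI; exact: mstep.
rewrite -pE [LHS](IHp p n (ltnW kn) pE X mX) muleC; congr (_ * _)%E.
(* The same formula with an empty future identifies the remaining integral with the probability that
   [S k.+1] lies in [A]. *)
have p1 : (1%:nng : {nonneg R})%:num%:E = (\prod_(k.+1 <= i < k.+1) gauss v (C i))%E.
  by rewrite big_geq.
have := IHp _ _ (ltnSn k) p1 X mX.
rewrite mul1e => <-; rewrite [X in _ `&` X](_ : _ = setT) ?setIT//.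
apply/seteqP; split => // w _ i /andP[ki]; rewrite ltnNge.
by rewrite ki.
Qed.

(* [S k] is a function of the noise before time [k], hence independent of [xi k]. *)
Lemma integral_walk k (f : R -> \bar R) : (forall x, 0 <= f x)%E ->
  measurable_fun [set: R] f ->
  (\int[P]_w f (S k.+1 w) =
   \int[P]_w \int[gauss v]_x f (if a k (S k w) then S k w else g k (S k w) + x)%R)%E.
Proof.
move=> f0 mf.
have mS : measurable_fun [set: T] (S k) := measurable_walk k.
pose S' : {mfun T >-> R} := HB.pack (S k) (isMeasurableFun.Build _ _ _ _ (S k) mS).
pose phi w := (S k w, xi k w).
have mphi : measurable_fun [set: T] phi by exact: measurable_fun_pair.
pose phi' : {mfun T >-> (R * R)%type} :=
  HB.pack phi (isMeasurableFun.Build _ _ _ _ phi mphi).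
pose F (zx : R * R) := f (step k zx.1 zx.2).
have mF : measurable_fun [set: R * R] F by exact: measurableT_comp mf (mstep k).
transitivity (\int[distribution P phi']_z F z)%E.
  by rewrite ge0_integral_distribution// => z; exact: f0.
transitivity (\int[(distribution P S' \x gauss v)%E]_z F z)%E.
  apply: eq_measure_integral => X mX _; apply/esym.
  apply: (@product_measure_unique _ _ _ _ _ _ _ (distribution P phi')) => //.
  move=> A B mA mB.
  have := @walk_indep k k.+1 A (fun=> B) mA (fun=> mB).
  rewrite big_nat1 => <-; congr (P _); apply/seteqP.
  split => [w [wA wB]|w [wA wB]]; split => //=.
    by move=> i /andP[ki ik]; rewrite (_ : i = k)//; apply/eqP; rewrite eqn_leq -ltnS ik ki.
  by apply: wB; rewrite leqnn ltnSn.
rewrite fubini_tonelli1//; last by move=> z; exact: f0.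
rewrite ge0_integral_distribution//.
- by apply: measurable_fun_fubini_tonelli_F => // z; exact: f0.
- by move=> y; apply: integral_ge0 => x _; exact: f0.
Qed.

Lemma measurable_walk_mean k (f : R -> \bar R) : (forall x, 0 <= f x)%E ->
  measurable_fun [set: R] f ->
  measurable_fun [set: R]
   (fun z => \int[gauss v]_x f (if a k z then z else g k z + x)%R)%E.
Proof.
move=> f0 mf.
pose F (zx : R * R) := f (step k zx.1 zx.2).
have mF : measurable_fun [set: R * R] F by exact: measurableT_comp mf (mstep k).
by apply: (@measurable_fun_fubini_tonelli_F _ _ _ _ _ _ F) => // z; exact: f0.
Qed.

End walk.

Lemma gmean_EFin (R : realType) (v : R) (f : R -> R) : 0 < v -> mgrow f ->
  (\int[gauss v]_x (f x)%:E = (gmean v f)%:E)%E.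
Proof.
move=> v0 mf; rewrite /gmean /Rintegral fineK//.
by apply: integrable_fin_num => //; exact: mgrow_int.
Qed.

Section walk_mean.
Context {d : measure_display} {T : measurableType d} {R : realType}.
Variables (P : probability T R) (v : R) (xi : nat -> T -> R).
Hypothesis v0 : 0 < v.
Hypothesis xiP : iid_gauss P v xi.
Variables (a : nat -> R -> bool) (g : nat -> R -> R) (ell : R).
Hypothesis ma : forall k, measurable_fun [set: R] (a k).
Hypothesis mg : forall k, measurable_fun [set: R] (g k).
Hypothesis gle : forall k z, `|g k z| <= `|z| + ell.
Implicit Types f h : R -> R.

Notation S := (walk a g xi).

(** Transition operator: the mean of [f (S k.+1)] given that [S k] is [z]. *)
Definition walk_op k f (z : R) : R :=
  if a k z then f z else gmean v (fun x => f (g k z + x)).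

Let mgrow_after k z f : mgrow f ->
  mgrow (fun x => f (if a k z then z else g k z + x)).
Proof.
by move=> mf; case: (a k z); [exact: mgrow_cst|exact: mgrow_shift].
Qed.

Let walk_opE k f z : walk_op k f z = gmean v (fun x => f (if a k z then z else g k z + x)).
Proof. by rewrite /walk_op; case: (a k z) => //; rewrite gmean_cst. Qed.

Let ge0_walk_op k f : mgrow f -> (forall x, 0 <= f x) -> mgrow (walk_op k f).
Proof.
move=> mf f0.
have mwop : measurable_fun [set: R] (walk_op k f).
  apply/measurable_EFinP.
  rewrite (_ : EFin \o _ = fun z =>
      (\int[gauss v]_x (f (if a k z then z else g k z + x)%R)%:E)%E).
    apply: (measurable_walk_mean v ma mg k (f := EFin \o f)) => //.
    by apply/measurable_EFinP; exact: mf.1.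
  by apply/funext => z /=; rewrite walk_opE gmean_EFin//; exact: mgrow_after.
have [_ [c c0 fc]] := mf.
(* The displacement costs a factor [expR (c * ell)] and the noise a factor [M]; the rate in [z]
   stays [c]. *)
pose M := gmean v (fun x => expR (c * `|x|)).
have M0 : 0 <= M.
  rewrite -[leLHS](gmean_cst v); apply: gmean_le => //; first exact: mgrow_cst.
  exact: mgrow_expR_norm.
have cM : 0 <= c * expR (c * ell) * M by rewrite !mulr_ge0// expR_ge0.
apply: (@mgrow_le _ _ (fun z => (c + c * expR (c * ell) * M) * expR (c * `|z|))) => //.
  by apply: mgrowZ; exact: mgrow_expR_norm.
move=> z; rewrite [leRHS]ger0_norm; last first.
  by rewrite mulr_ge0 ?expR_ge0// addr_ge0.
rewrite mulrDl /walk_op; case: ifP => _.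
  by apply: le_trans (fc z) _; rewrite lerDl mulr_ge0// expR_ge0.
apply: (@le_trans _ _ (c * expR (c * ell) * M * expR (c * `|z|))); last first.
  by rewrite lerDr mulr_ge0// expR_ge0.
rewrite ger0_norm; last first.
  rewrite -[leLHS](gmean_cst v); apply: gmean_le => //; first exact: mgrow_cst.
  exact: mgrow_shift.
rewrite mulrAC -[leRHS]gmeanZ//; last exact: mgrow_expR_norm.
apply: gmean_le => //; first exact: mgrow_shift.
  by apply: mgrowZ; exact: mgrow_expR_norm.
move=> x; apply: le_trans (ler_norm _) _; apply: le_trans (fc _) _.
rewrite -!mulrA -!expRD ler_wpM2l// ler_expR -!mulrDr ler_wpM2l//.
by apply: le_trans (ler_normD _ _) _; have := gle k z; lra.
Qed.

Definition wmean f k : R := \int[P]_w f (S k w).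

(** The mean of [|f|] at time [k.+1] is the mean at time [k] of the transition operator applied to
    [|f|], again of exponential growth; hence the induction generalizes [f]. *)
Lemma integrable_walk k f : mgrow f -> P.-integrable [set: T] (EFin \o (f \o S k)).
Proof.
elim: k f => [|k IH] f mf.
  rewrite (_ : _ \o _ = cst (f 0)%:E); last by apply/funext.
  exact: finite_measure_integrable_cst.
have mnf := mgrow_norm mf.
apply/integrableP; split.
  by apply/measurable_EFinP; exact: (measurableT_comp mf.1 (measurable_walk xiP ma mg k.+1)).
rewrite [ltLHS](_ : _ = \int[P]_w (`|f (S k.+1 w)|)%:E)%E; last exact: eq_integral.
rewrite (integral_walk xiP ma mg k (f := fun z => (`|f z|)%:E)); last 2 first.
- by move=> x; rewrite lee_fin.
- by apply/measurable_EFinP; exact: mnf.1.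
have := IH _ (ge0_walk_op k mnf (fun x => normr_ge0 _)).
move=> /integrableP[_]; rewrite [X in (X < _)%E -> _](_ : _ =
  \int[P]_w \int[gauss v]_x
     (`|f (if a k (S k w) then S k w else g k (S k w) + x)%R|)%:E)%E//.
apply: eq_integral => w _; rewrite (gmean_EFin v0 (mgrow_after k (S k w) mnf)).
rewrite /= walk_opE ger0_norm//.
rewrite -[leLHS](gmean_cst v); apply: gmean_le => //; first exact: mgrow_cst.
exact: (mgrow_after k (S k w) mnf).
Qed.

Lemma wmean_le f h k : mgrow f -> mgrow h -> (forall z, f z <= h z) ->
  wmean f k <= wmean h k.
Proof. by move=> mf mh fh; apply: le_Rintegral => //; exact: integrable_walk. Qed.

Lemma wmeanD f h k : mgrow f -> mgrow h ->
  wmean (fun z => f z + h z) k = wmean f k + wmean h k.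
Proof. by move=> mf mh; apply: RintegralD => //; exact: integrable_walk. Qed.

Lemma wmeanB f h k : mgrow f -> mgrow h ->
  wmean (fun z => f z - h z) k = wmean f k - wmean h k.
Proof. by move=> mf mh; apply: RintegralB => //; exact: integrable_walk. Qed.

Lemma wmeanZ c f k : mgrow f -> wmean (fun z => c * f z) k = c * wmean f k.
Proof. by move=> mf; apply: RintegralZl => //; exact: integrable_walk. Qed.

Lemma wmean_cst c k : wmean (fun=> c) k = c.
Proof.
rewrite /wmean Rintegral_cst// (_ : fine _ = 1) ?mulr1//.
exact: (congr1 fine (probability_setT P)).
Qed.

Lemma wmean0 f : wmean f 0 = f 0.
Proof. by rewrite -[RHS](wmean_cst _ 0). Qed.

Lemma wmean_EFin f k : mgrow f -> (\int[P]_w (f (S k w))%:E = (wmean f k)%:E)%E.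
Proof.
move=> mf; rewrite /wmean /Rintegral fineK//.
by apply: integrable_fin_num => //; exact: integrable_walk.
Qed.

Let ge0_wmeanS k f : mgrow f -> (forall x, 0 <= f x) ->
  wmean f k.+1 = wmean (walk_op k f) k.
Proof.
move=> mf f0; apply: EFin_inj; rewrite -!wmean_EFin//; last exact: ge0_walk_op.
rewrite (integral_walk xiP ma mg k (f := fun z => (f z)%:E)); last 2 first.
- by move=> x; rewrite lee_fin.
- by apply/measurable_EFinP; exact: mf.1.
apply: eq_integral => w _; rewrite (gmean_EFin v0 (mgrow_after k (S k w) mf)).
by rewrite walk_opE.
Qed.

(** Tonelli settles the nonnegative case; a signed [f] is written [(f + E) - E] with [E] an
    exponential majorant. *)
Lemma wmeanS k f : mgrow f ->
  mgrow (walk_op k f) /\ wmean f k.+1 = wmean (walk_op k f) k.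
Proof.
move=> mf; have [_ [c c0 fc]] := mf.
pose E (x : R) := c * expR (c * `|x|).
have mE : mgrow E by apply: mgrowZ; exact: mgrow_expR_norm.
have E0 x : 0 <= E x by rewrite mulr_ge0// expR_ge0.
have mfE : mgrow (fun x => f x + E x) by exact: mgrowD.
have fE0 x : 0 <= f x + E x.
  by rewrite -lerBlDr sub0r; have := fc x; rewrite ler_norml => /andP[].
have opE : walk_op k f = fun z => walk_op k (fun x => f x + E x) z - walk_op k E z.
  apply/funext => z; rewrite !walk_opE gmeanD//; [|exact: mgrow_after..].
  by rewrite addrK.
have mop1 := ge0_walk_op k mfE fE0.
have mop2 := ge0_walk_op k mE E0.
split; first by rewrite opE; exact: mgrowB.
by rewrite opE wmeanB// -!ge0_wmeanS// wmeanD// addrK.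
Qed.

Lemma wmeanS_le k f h : mgrow f -> mgrow h -> (forall z, walk_op k f z <= h z) ->
  wmean f k.+1 <= wmean h k.
Proof. by move=> mf mh fh; have [? ->] := wmeanS k mf; exact: wmean_le. Qed.

Lemma wmeanS_ge k f h : mgrow f -> mgrow h -> (forall z, h z <= walk_op k f z) ->
  wmean h k <= wmean f k.+1.
Proof. by move=> mf mh fh; have [? ->] := wmeanS k mf; exact: wmean_le. Qed.

End walk_mean.

Section gauss_symmetry.
Context {R : realType}.
Implicit Types (v x : R).

Lemma gaussN v (A : set R) : 0 < v -> measurable A ->
  gauss v (-%R @^-1` A) = gauss v A.
Proof.
move=> v0 mA; rewrite !gaussE /normal_prob.
have mp : measurable_fun [set: R] (fun x => (normal_pdf 0 (Num.sqrt v) x)%:E).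
  by apply/measurable_EFinP; exact: measurable_normal_pdf.
have sv0 : Num.sqrt v != 0 by rewrite gt_eqF// sqrtr_gt0.
transitivity (\int[lebesgue_measure]_(x in -%R @^-1` A)
    ((fun x => (normal_pdf 0 (Num.sqrt v) x)%:E) \o -%R) x)%E.
  apply: eq_integral => x _ /=; rewrite !normal_pdfE// /normal_fun !subr0.
  by rewrite sqrrN.
rewrite -(@ge0_integral_pushforward _ _ _ (measurableTypeR R))//; first last.
- by move=> x _; rewrite lee_fin normal_pdf_ge0.
- exact: measurable_funS mp.
- apply: eq_measure_integral => B mB _; exact: lebesgue_measureN.
Qed.

Lemma gmeanN v (f : R -> R) : 0 < v -> mgrow f ->
  gmean v (fun x => f (- x)) = gmean v f.
Proof.
move=> v0 mf.
have mN : measurable_fun [set: R] (-%R : R -> R) by exact: oppr_measurable.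
pose N : {mfun R >-> R} := HB.pack (-%R : R -> R) (isMeasurableFun.Build _ _ _ _ (-%R : R -> R) mN).
rewrite /gmean /Rintegral; congr fine.
transitivity (\int[distribution (gauss v) N]_x (f x)%:E)%E; last first.
  by apply: eq_measure_integral => A mA _; exact: gaussN.
rewrite integral_distribution//; first by apply/measurable_EFinP; exact: mf.1.
have [_ [c c0 fc]] := mf.
apply: (mgrow_int v0 (f := fun x => f (- x))); split.
  exact: measurableT_comp mf.1 mN.
by exists c => // x; have := fc (- x); rewrite normrN.
Qed.

End gauss_symmetry.

(** * One-step errors of a glued function, seen from the right half-line *)

Section half_line.
Context {R : realType}.
Variables (q r : R) (f fr hr : R -> R).
Hypotheses (q0 : 0 < q) (r0 : 0 < r).
Hypotheses (mf : mgrow f) (mfr : mgrow fr).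
Hypothesis fE : forall y, 0 <= y -> f y = fr y.
Variable K : R.
Hypothesis K0 : 0 <= K.
Hypothesis ffr : forall y, y <= 0 -> `|f y - fr y| <= K * (y ^+ 2 * expR (K * `|y|)).
Hypothesis fr_lip : forall w y y', `|y| <= w -> `|y'| <= w ->
  `|fr y - fr y'| <= K * expR (K * w) * `|y - y'|.
Hypothesis fr_exact : forall z e, 0 < e ->
  gmean (q * e) (fun x => fr (z + r * e + x)) = fr z - e * hr z.

Let C : R := 48 * expR ((K + 1) ^+ 2 / 2).

Let C0 : 0 < C. Proof. by rewrite mulr_gt0// expR_gt0. Qed.

(** By [fr_exact] the error comes only from landing below 0. From [z >= eta] this takes a jump
    [|x| >= eta], and there [x ^+ 2 <= x ^+ 4 / eta ^+ 2]: the second-order contact of [f] with [fr]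
    becomes a fourth moment, of order [e ^+ 2]. *)
Lemma half_line_far z e eta : 0 < e -> q * e <= 1 -> 0 < eta -> eta <= z ->
  `|gmean (q * e) (fun x => f (z + r * e + x)) - (fr z - e * hr z)|
    <= K * C * q ^+ 2 * (e ^+ 2 / eta ^+ 2).
Proof.
move=> e0 qe1 eta0 etaz; have v0 : 0 < q * e by rewrite mulr_gt0.
rewrite -fr_exact//.
apply: le_trans (gmean_dist v0 (mgrow_shift _ mf) (mgrow_shift _ mfr)) _.
apply: (@le_trans _ _
   (gmean (q * e) (fun x => (K / eta ^+ 2) * (x ^+ 4 * expR (K * `|x|))))).
  apply: gmean_le => //.
  - by apply: mgrow_norm; apply: mgrowB; exact: mgrow_shift.
  - apply: mgrowZ; apply: mgrowM; last exact: mgrow_expR_norm.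
    exact/mgrowX/mgrow_id.
  move=> x; have [y0|y0] := leP 0 (z + r * e + x).
    rewrite fE// subrr normr0; apply: mulr_ge0.
      by rewrite divr_ge0// sqr_ge0.
    by rewrite mulr_ge0 ?expR_ge0// exprn_even_ge0.
  apply: le_trans (ffr (ltW y0)) _; rewrite -[leRHS]mulrA ler_wpM2l//.
  set y := _ + x in y0 *.
  have re0 : 0 < r * e by rewrite mulr_gt0.
  have yx : `|y| <= `|x| by rewrite /y in y0 *; rewrite !ltr0_norm//; lra.
  have ex : eta <= `|x| by rewrite /y in y0 *; rewrite ltr0_norm//; lra.
  have e2 : 0 < eta ^+ 2 by rewrite exprn_gt0.
  have h1 : y ^+ 2 <= x ^+ 2.
    by rewrite -(real_normK (num_real y)) -(real_normK (num_real x)) lerXn2r ?nnegrE.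
  have h2 : eta ^+ 2 <= x ^+ 2.
    by rewrite -(real_normK (num_real x)) lerXn2r ?nnegrE// ltW.
  have h3 : expR (K * `|y|) <= expR (K * `|x|) by rewrite ler_expR ler_wpM2l.
  rewrite mulrA ler_pM ?sqr_ge0 ?expR_ge0//.
  rewrite mulrC ler_pdivlMr// (_ : x ^+ 4 = x ^+ 2 * x ^+ 2); last by ring.
  by rewrite ler_pM ?sqr_ge0.
rewrite gmeanZ//; last first.
  by apply: mgrowM; [exact/mgrowX/mgrow_id|exact: mgrow_expR_norm].
have [_ h] := gmean_moment v0 qe1 K0.
apply: le_trans (ler_wpM2l _ h) _; first by rewrite divr_ge0// sqr_ge0.
by rewrite le_eqVlt -/C; apply/orP; left; apply/eqP; ring.
Qed.

(** Replacing [dd] by [r * e] costs a Lipschitz term of order [e]; landing below 0 costs a squared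
    distance, at most [2 * ell ^+ 2 * e + 2 * x ^+ 2], whose mean is of order [e]. Only steps from
    the band pay this, and [chain_occupation] bounds their expected number. *)
Lemma half_line_near (ell : R) : 0 <= ell ->
  exists2 M, 0 <= M & forall z e dd, 0 < e -> e <= 1 -> q * e <= 1 ->
    0 <= z -> z <= 1 -> `|dd| <= ell * e ->
  `|gmean (q * e) (fun x => f (z + dd + x)) - (fr z - e * hr z)| <= M * e.
Proof.
move=> ell0.
pose w := 1 + ell + r.
pose A := 2 * K * ell ^+ 2 * expR (K * ell) + K * expR (K * w) * (ell + r).
pose A' := 2 * K * expR (K * ell).
have A0 : 0 <= A.
  rewrite /A; apply: addr_ge0; rewrite !mulr_ge0 ?expR_ge0 ?sqr_ge0//.
  by rewrite addr_ge0// ltW.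
have A'0 : 0 <= A' by rewrite !mulr_ge0 ?expR_ge0.
exists (A * (2 * expR (K ^+ 2 / 2)) + A' * (C * q)).
  by rewrite addr_ge0 ?mulr_ge0 ?expR_ge0// ltW.
move=> z e dd e0 e1 qe1 z0 z1 dde; have v0 : 0 < q * e by rewrite mulr_gt0.
rewrite -fr_exact//.
apply: le_trans (gmean_dist v0 (mgrow_shift _ mf) (mgrow_shift _ mfr)) _.
have me := mgrow_expR_norm K.
have me2 : mgrow (fun x => x ^+ 2 * expR (K * `|x|)).
  by apply: mgrowM => //; exact/mgrowX/mgrow_id.
apply: (@le_trans _ _ (gmean (q * e)
    (fun x => A * e * expR (K * `|x|) + A' * (x ^+ 2 * expR (K * `|x|))))).
  apply: gmean_le => //.
  - by apply: mgrow_norm; apply: mgrowB; exact: mgrow_shift.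
  - by apply: mgrowD; exact: mgrowZ.
  move=> x; set y := z + dd + x; set y' := z + r * e + x.
  have ell_e : ell * e <= ell by rewrite ler_piMr.
  have r_e : r * e <= r by rewrite ler_piMr// ltW.
  have re0 : 0 < r * e by rewrite mulr_gt0.
  have hx := ler_norm x; have hxN := lerNnormlW (lexx `|x|).
  have hd := ler_norm dd; have hdN := lerNnormlW (lexx `|dd|).
  have wy : `|y| <= w + `|x| by rewrite /y /w ler_norml; apply/andP; split; lra.
  have wy' : `|y'| <= w + `|x| by rewrite /y' /w ler_norml; apply/andP; split; lra.
  have part2 : `|fr y - fr y'| <= K * expR (K * w) * (ell + r) * e * expR (K * `|x|).
    apply: le_trans (fr_lip wy wy') _.
    rewrite mulrDr expRD -!mulrA ler_wpM2l// ler_wpM2l ?expR_ge0//.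
    rewrite mulrC !mulrA ler_wpM2r ?expR_ge0//.
    rewrite ler_norml /y /y'; apply/andP; split; lra.
  have part1 : `|f y - fr y| <= 2 * K * ell ^+ 2 * expR (K * ell) * e * expR (K * `|x|)
      + A' * (x ^+ 2 * expR (K * `|x|)).
    have [y0|y0] := leP 0 y.
      rewrite fE// subrr normr0; apply: addr_ge0.
        by rewrite !mulr_ge0 ?expR_ge0 ?sqr_ge0 ?(ltW e0).
      by apply: mulr_ge0 => //; rewrite mulr_ge0 ?expR_ge0 ?sqr_ge0.
    apply: le_trans (ffr (ltW y0)) _.
    have yx : `|y| <= ell * e + `|x|.
      by rewrite ltr0_norm// /y; rewrite /y in y0; lra.
    have h1 : y ^+ 2 <= 2 * ell ^+ 2 * e + 2 * x ^+ 2.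
      apply: (@le_trans _ _ ((ell * e + `|x|) ^+ 2)).
        rewrite -(real_normK (num_real y)) lerXn2r ?nnegrE// addr_ge0// mulr_ge0//.
        exact: ltW.
      have h : (ell * e) ^+ 2 <= ell ^+ 2 * e.
        by rewrite exprMn ler_wpM2l ?sqr_ge0// expr2 ler_piMr// ltW.
      have : 0 <= (ell * e - `|x|) ^+ 2 by exact: sqr_ge0.
      by rewrite sqrrB sqrrD real_normK ?num_real//; lra.
    have h3 : expR (K * `|y|) <= expR (K * ell) * expR (K * `|x|).
      by rewrite -expRD ler_expR -mulrDr ler_wpM2l//; lra.
    apply: (@le_trans _ _ (K * ((2 * ell ^+ 2 * e + 2 * x ^+ 2) *
         (expR (K * ell) * expR (K * `|x|))))).
      by rewrite ler_wpM2l// ler_pM ?sqr_ge0 ?expR_ge0.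
    by rewrite /A' le_eqVlt; apply/orP; left; apply/eqP; ring.
  apply: (@le_trans _ _ (`|f y - fr y| + `|fr y - fr y'|)).
    by have := ler_normD (f y - fr y) (fr y - fr y'); rewrite addrA subrK.
  by rewrite /A; lra.
rewrite gmeanD ?gmeanZ//; [|exact: mgrowZ..].
have [h _] := gmean_moment v0 qe1 K0.
have h' := gmean_expR_norm_le v0 qe1 K0.
apply: (@le_trans _ _ (A * e * (2 * expR (K ^+ 2 / 2)) + A' * (C * (q * e)))).
  apply: lerD; last by rewrite ler_wpM2l.
  rewrite ler_wpM2l ?mulr_ge0 ?(ltW e0)//; apply: le_trans h' _.
  rewrite ler_pM2l// ler_expR ler_pM2r// ler_piMr// ?sqr_ge0//.
by rewrite le_eqVlt; apply/orP; left; apply/eqP; ring.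
Qed.

End half_line.

(** * Scale function, hitting probability and potential *)

Section expR_bounds.
Context {R : realType}.
Implicit Types (a b w x : R).

Lemma expR_lip w a b : a <= w -> b <= w ->
  `|expR a - expR b| <= expR w * `|a - b|.
Proof.
wlog ba : a b / b <= a => [H aw bw|].
  have [ba|/ltW ab] := leP b a; first exact: H.
  by rewrite distrC [`|a - b|]distrC; exact: H.
move=> aw bw; rewrite !ger0_norm ?subr_ge0// ?ler_expR//.
have h1 : expR a - expR b <= expR a * (a - b).
  have -> : expR b = expR a * expR (b - a) by rewrite -expRD addrC subrK.
  have := ler_wpM2l (expR_ge0 a) (expR_ge1Dx (b - a)); lra.
by apply: le_trans h1 _; rewrite ler_wpM2r ?subr_ge0// ler_expR.
Qed.

Lemma expR_taylor1 x : `|expR x - 1| <= `|x| * expR `|x|.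
Proof.
have := @expR_lip `|x| x 0 (ler_norm x) (normr_ge0 x).
by rewrite expR0 subr0 mulrC.
Qed.

Lemma expR_taylor2 x : `|expR x - 1 - x| <= x ^+ 2 * expR `|x|.
Proof.
have h1 := expR_ge1Dx x.
have h2 := ler_wpM2l (expR_ge0 x) (expR_ge1Dx (- x)).
rewrite -expRD subrr expR0 in h2.
rewrite ger0_norm; last lra.
have [x0|x0] := ger0P x.
- have : x * (expR x - 1) <= x * (x * expR x) by rewrite ler_wpM2l//; lra.
  by rewrite expr2 -mulrA; nra.
- have h3 : 1 <= expR (- x) by rewrite -expR0 ler_expR; lra.
  have h4 : x ^+ 2 <= x ^+ 2 * expR (- x) by rewrite ler_peMr// sqr_ge0.
  by apply: le_trans h4; rewrite expr2; nra.
Qed.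

Lemma ler_id_expR x : x <= expR x.
Proof. by have := expR_ge1Dx x; lra. Qed.

End expR_bounds.

Section glue.
Context {R : realType}.
Implicit Types (f g : R -> R).

(** The left branch is stored as a function of the distance to 0, so that reflecting the line swaps
    the branches ([glueN]). *)
Definition glue f g (y : R) : R := if 0 <= y then f y else g (- y).

Lemma glueN f g y : f 0 = g 0 -> glue f g (- y) = glue g f y.
Proof.
move=> fg0; rewrite /glue oppr_ge0 opprK; case: ltgtP => // ->.
by rewrite oppr0.
Qed.

Lemma mgrow_opp f : mgrow f -> mgrow (fun y => f (- y)).
Proof.
move=> [mf [c c0 fc]]; split.
  by apply: measurableT_comp mf _; exact: oppr_measurable.
by exists c => // x; have := fc (- x); rewrite normrN.
Qed.

Lemma mgrow_glue f g : mgrow f -> mgrow g -> mgrow (glue f g).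
Proof.
move=> mf mg; apply: mgrow_if => //; last exact: mgrow_opp.
by apply: measurable_fun_ler.
Qed.

(* Diffusion with variance rate [q] and drift [r] away from the origin on the right half-line:
   [scale1] is its scale function, [hit1 y] the probability of ever reaching [0] from [y], and
   [pot1] solves [q / 2 * u'' + r * u' = - hit1]. *)
Definition kap (q r : R) : R := 2 * r / q.
Definition hit1 q r y : R := expR (- kap q r * y).
Definition scale1 q r y : R := (1 - hit1 q r y) / kap q r.
Definition pot1 q r (A y : R) : R := (A + y / r) * hit1 q r y.

(** The sign makes the function increasing, with slope 1 at 0 on both sides. *)
Definition scale q r l := glue (scale1 q r) (fun y => - scale1 q l y).
Definition hitp q r l := glue (hit1 q r) (hit1 q l).
(** The value [A] at 0 for which the two branches of [pot] have equal slopes there: [1 / r - A * kap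
    q r = A * kap q l - 1 / l]. *)
Definition pot0 q r l : R := q / (2 * r * l).
Definition pot q r l := glue (pot1 q r (pot0 q r l)) (pot1 q l (pot0 q r l)).

End glue.

Section half_line_functions.
Context {R : realType}.
Variables (q r : R).
Hypotheses (q0 : 0 < q) (r0 : 0 < r).

Lemma kap_gt0 : 0 < kap q r.
Proof. by rewrite /kap divr_gt0// mulr_gt0. Qed.

Lemma mgrow_hit1 : mgrow (hit1 q r).
Proof. exact: mgrow_expR. Qed.

Lemma mgrow_scale1 : mgrow (scale1 q r).
Proof.
rewrite (_ : scale1 q r = fun y => (kap q r)^-1 * (1 - hit1 q r y)).
  by apply: mgrowZ; apply: mgrowB; [exact: mgrow_cst|exact: mgrow_hit1].
by apply/funext => y; rewrite /scale1 mulrC.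
Qed.

Lemma mgrow_pot1 A : mgrow (pot1 q r A).
Proof.
apply: mgrowM; last exact: mgrow_hit1.
apply: mgrowD; first exact: mgrow_cst.
rewrite (_ : (fun x => x / r) = fun y => r^-1 * y).
  by apply: mgrowZ; exact: mgrow_id.
by apply/funext => y; rewrite mulrC.
Qed.

(** [- kap q r] is the nonzero root [a] of [a * r + a ^+ 2 * q / 2 = 0]; so [hit1] is an exact
    martingale of the drifted Gaussian walk, whatever the mesh. *)
Lemma kap_tilt e : expR (- kap q r * (r * e)) * expR ((- kap q r) ^+ 2 * (q * e) / 2) = 1.
Proof.
rewrite -expRD -[RHS]expR0; congr expR; rewrite /kap; field.
exact: lt0r_neq0.
Qed.

Lemma gmean_hit1 z e : 0 < e ->
  gmean (q * e) (fun x => hit1 q r (z + r * e + x)) = hit1 q r z.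
Proof.
move=> e0; have v0 : 0 < q * e by rewrite mulr_gt0.
rewrite (_ : (fun x => _) = fun x =>
    (hit1 q r z * expR (- kap q r * (r * e))) * expR (- kap q r * x)); last first.
  by apply/funext => x; rewrite /hit1 -!expRD -!mulrDr.
rewrite (gmeanZ _ v0 (mgrow_expR _)) (gmean_expR _ v0).
by rewrite -[LHS]mulrA -[RHS]mulr1; congr (_ * _); exact: kap_tilt.
Qed.

Lemma gmean_scale1 z e : 0 < e ->
  gmean (q * e) (fun x => scale1 q r (z + r * e + x)) = scale1 q r z.
Proof.
move=> e0; have v0 : 0 < q * e by rewrite mulr_gt0.
rewrite (_ : (fun x => _) = fun x =>
    (kap q r)^-1 * (1 - hit1 q r (z + r * e + x))); last first.
  by apply/funext => x; rewrite /scale1 mulrC.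
have mh := mgrow_shift (z + r * e) mgrow_hit1.
rewrite gmeanZ//; last by apply: mgrowB => //; exact: mgrow_cst.
by rewrite gmeanB ?gmean_cst ?gmean_hit1//; [rewrite mulrC|exact: mgrow_cst].
Qed.

(** Weighting by the exponential shifts the mean of the noise by
    [- kap q r * (q * e) = - 2 * r * e], so the affine factor sees the net drift [- r * e]; divided
    by [r], this is the loss [e]. *)
Lemma gmean_pot1 A z e : 0 < e ->
  gmean (q * e) (fun x => pot1 q r A (z + r * e + x)) = pot1 q r A z - e * hit1 q r z.
Proof.
move=> e0; have v0 : 0 < q * e by rewrite mulr_gt0.
set k := kap q r; set E := expR (- k * (r * e)).
rewrite (_ : (fun x => _) = fun x =>
    ((A + (z + r * e) / r) * (hit1 q r z * E)) * expR (- k * x) +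
    (r^-1 * (hit1 q r z * E)) * (x * expR (- k * x))); last first.
  apply/funext => x; rewrite /pot1 (_ : hit1 q r (z + r * e + x) =
    hit1 q r z * E * expR (- k * x)); last by rewrite /hit1 -!expRD -!mulrDr.
  by rewrite mulrDl; ring.
have m1 := mgrow_expR (- k).
have m2 : mgrow (fun x => x * expR (- k * x)) by apply: mgrowM => //; exact: mgrow_id.
rewrite gmeanD ?gmeanZ//; [|exact: mgrowZ..].
rewrite gmean_expR// gmean_MexpR//.
have := kap_tilt e; rewrite -/k -/E; set F := expR (_ / 2) => EF.
have kq : k * q = 2 * r by rewrite /k /kap divfK ?lt0r_neq0.
transitivity (hit1 q r z * (E * F) * (A + (z + r * e) / r + r^-1 * (- (k * q) * e))).
  by ring.
rewrite EF kq mulr1 /pot1; field; exact: lt0r_neq0.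
Qed.

Lemma hit1_lip w y y' : `|y| <= w -> `|y'| <= w ->
  `|hit1 q r y - hit1 q r y'| <= kap q r * expR (kap q r * w) * `|y - y'|.
Proof.
move=> yw yw'; have k0 := kap_gt0.
have H z : `|z| <= w -> - kap q r * z <= kap q r * w.
  rewrite mulNr -mulrN ler_pM2l// => zw.
  by apply: le_trans zw; rewrite -normrN ler_norm.
apply: le_trans (expR_lip (H y yw) (H y' yw')) _.
by rewrite -mulrBr normrM normrN (gtr0_norm k0) mulrA [_ * kap q r]mulrC.
Qed.

Lemma scale1_lip w y y' : `|y| <= w -> `|y'| <= w ->
  `|scale1 q r y - scale1 q r y'| <= expR (kap q r * w) * `|y - y'|.
Proof.
move=> yw yw'; have k0 := kap_gt0.
rewrite (_ : _ - _ = (hit1 q r y' - hit1 q r y) / kap q r); last first.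
  by rewrite /scale1; ring.
rewrite normrM normfV (gtr0_norm k0) ler_pdivrMr//.
apply: le_trans (hit1_lip yw' yw) _; rewrite distrC.
by rewrite le_eqVlt; apply/orP; left; apply/eqP; ring.
Qed.

(** The affine factor is absorbed into the exponential by [w <= expR w], whence the rate [k + 1]
    contained in [K]. *)
Lemma pot1_lip A : 0 <= A -> exists2 K, 0 <= K &
  forall w y y', `|y| <= w -> `|y'| <= w ->
  `|pot1 q r A y - pot1 q r A y'| <= K * expR (K * w) * `|y - y'|.
Proof.
move=> A0; have k0 := kap_gt0; set k := kap q r in k0 *.
have rV0 : 0 < r^-1 by rewrite invr_gt0.
have kA := mulr_ge0 (ltW k0) (addr_ge0 A0 (ltW rV0)).
exists (r^-1 + k * (A + r^-1) + k + 1); first lra.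
set K := r^-1 + _ + _ + _ => w y y' yw yw'.
have w0 : 0 <= w by exact: le_trans yw.
apply: (@le_trans _ _ (`|y - y'| / r * expR (k * w)
   + (A + w / r) * (k * expR (k * w) * `|y - y'|))).
  rewrite /pot1 (_ : _ - _ = (y - y') / r * hit1 q r y
     + (A + y' / r) * (hit1 q r y - hit1 q r y')); last by ring.
  apply: le_trans (ler_normD _ _) _; apply: lerD.
    rewrite !normrM normfV (gtr0_norm r0) ler_wpM2l//.
      by rewrite mulr_ge0// ltW.
    rewrite ger0_norm ?expR_ge0// ler_expR mulNr -mulrN ler_pM2l//.
    by apply: le_trans yw; rewrite -normrN ler_norm.
  rewrite normrM ler_pM//; last exact: hit1_lip.
  apply: le_trans (ler_normD _ _) _; rewrite (ger0_norm A0) lerD2l.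
  by rewrite normrM normfV (gtr0_norm r0) ler_wpM2r// ltW.
have Ew : A + w / r <= (A + r^-1) * expR w.
  have := ler_id_expR w; have : 1 <= expR w by rewrite -expR0 ler_expR.
  move=> h1 h2; rewrite mulrDl lerD//; first by rewrite ler_peMr.
  by rewrite mulrC ler_pM2l.
have E1 : expR (k * w) <= expR (K * w).
  by rewrite ler_expR ler_wpM2r// /K; lra.
have E2 : expR w * expR (k * w) <= expR (K * w).
  rewrite -expRD ler_expR -{1}[w]mul1r -mulrDl ler_wpM2r// /K; lra.
clearbody k.
apply: (@le_trans _ _ ((r^-1 * expR (K * w) + k * (A + r^-1) * expR (K * w)) * `|y - y'|)).
  rewrite [leRHS]mulrDl; apply: lerD.
    rewrite [`|y - y'| / r]mulrC [leRHS]mulrAC ler_wpM2l//.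
    by rewrite mulr_ge0// ltW.
  rewrite !mulrA ler_wpM2r//.
  apply: (@le_trans _ _ ((A + r^-1) * expR w * k * expR (k * w))).
    by apply: ler_wpM2r; [exact: expR_ge0|apply: ler_wpM2r => //; exact: ltW].
  rewrite [leLHS](_ : _ = k * (A + r^-1) * (expR w * expR (k * w))); last by ring.
  by rewrite ler_wpM2l// mulr_ge0 ?addr_ge0// ltW.
rewrite ler_wpM2r// -mulrDl ler_wpM2r ?expR_ge0// /K; lra.
Qed.

End half_line_functions.

Section glue_step.
Context {R : realType}.

(** Common interface of the two comparison chains: the step is left free inside the band, where the
    slope of the path is unknown. *)
Definition drift_ok (r l ell e b : R) (g : R -> R) : Prop := forall z,
  [/\ `|g z - z| <= ell * e, b <= z -> g z = z + r * e
    & z <= - b -> g z = z - l * e].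

Definition half_sol (q r K : R) (fr hr : R -> R) : Prop :=
  [/\ mgrow fr,
      forall w y y', `|y| <= w -> `|y'| <= w ->
        `|fr y - fr y'| <= K * expR (K * w) * `|y - y'|
    & forall z e, 0 < e ->
        gmean (q * e) (fun x => fr (z + r * e + x)) = fr z - e * hr z].

(** Second-order contact at 0: the values and the slopes of the branches agree there. *)
Definition C1_glue (K : R) (fr fl : R -> R) : Prop := forall y, y <= 0 ->
  `|fl (- y) - fr y| <= K * (y ^+ 2 * expR (K * `|y|)).

Lemma half_sol_le q r K K' fr hr : 0 <= K -> K <= K' ->
  half_sol q r K fr hr -> half_sol q r K' fr hr.
Proof.
move=> K0 KK' [mfr lip ex]; split => // w y y' yw yw'.
apply: le_trans (lip _ _ _ yw yw') _; apply: ler_wpM2r => //.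
apply: ler_pM; rewrite ?expR_ge0// ler_expR; apply: ler_wpM2r => //.
exact: le_trans yw.
Qed.

Lemma C1_glue_le K K' fr fl : 0 <= K -> K <= K' -> C1_glue K fr fl -> C1_glue K' fr fl.
Proof.
move=> K0 KK' H y y0; apply: le_trans (H y y0) _.
apply: ler_pM => //; first by rewrite mulr_ge0 ?sqr_ge0 ?expR_ge0.
by apply: ler_wpM2l; rewrite ?sqr_ge0// ler_expR ler_wpM2r.
Qed.

Lemma C1_glueN K fr fl : C1_glue K fr fl -> fr 0 = fl 0.
Proof.
move=> /(_ 0 (lexx 0)); rewrite oppr0 expr0n mul0r mulr0 normr_le0 subr_eq0.
by move=> /eqP.
Qed.

(** The left half-line is brought to the right one by reflection, which preserves the law of the
    noise, swaps the branches and replaces [r] by [l]. Summed over [t / e] steps, the far error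
    [e ^+ 2 / b ^+ 2] amounts to [t * e / b ^+ 2]. *)
Lemma glue_step q r l K fr fl hr hl ell : 0 < q -> 0 < r -> 0 < l ->
  0 <= K -> 0 <= ell ->
  half_sol q r K fr hr -> half_sol q l K fl hl ->
  C1_glue K fr fl -> C1_glue K fl fr ->
  exists2 M : R, 0 <= M & forall e b g z, 0 < e -> e <= 1 -> q * e <= 1 ->
    0 < b -> b <= 1 -> drift_ok r l ell e b g ->
    `|gmean (q * e) (fun x => glue fr fl (g z + x))
       - (glue fr fl z - e * glue hr hl z)|
    <= M * (e ^+ 2 / b ^+ 2 + e * (`|z| < b)%R%:R).
Proof.
move=> q0 r0 l0 K0 ell0 [mfr lipr exr] [mfl lipl exl] Crl Clr.
have fr0 := C1_glueN Crl.
have mf := mgrow_glue mfr mfl; have mf' := mgrow_glue mfl mfr.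
have fE f1 f2 y : 0 <= y -> glue f1 f2 y = f1 y :> R.
  by move=> y0; rewrite /glue y0.
have fK f1 f2 : C1_glue K f1 f2 -> forall y, y <= 0 ->
    `|glue f1 f2 y - f1 y| <= K * (y ^+ 2 * expR (K * `|y|)).
  move=> C12 y y0; rewrite /glue; case: ifPn => [y0'|_]; last exact: C12.
  rewrite subrr normr0; apply: mulr_ge0 => //.
  by rewrite mulr_ge0 ?sqr_ge0 ?expR_ge0.
have farr := half_line_far q0 r0 mf mfr (fE fr fl) K0 (fK _ _ Crl) exr.
have farl := half_line_far q0 l0 mf' mfl (fE fl fr) K0 (fK _ _ Clr) exl.
have [Mr Mr0 nearr] := half_line_near q0 r0 mf mfr (fE fr fl) K0 (fK _ _ Crl) lipr exr ell0.
have [Ml Ml0 nearl] := half_line_near q0 l0 mf' mfl (fE fl fr) K0 (fK _ _ Clr) lipl exl ell0.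
set Q := K * _ * q ^+ 2 in farr farl.
have Q0 : 0 <= Q.
  by apply: mulr_ge0; rewrite ?sqr_ge0//; apply: mulr_ge0; rewrite ?mulr_ge0 ?expR_ge0.
exists (Q + Mr + Ml); first by do 2?[apply: addr_ge0 => //].
move=> e b g z e0 e1 qe1 b0 b1 gok.
have v0 : 0 < q * e by rewrite mulr_gt0.
have eb0 : 0 <= e ^+ 2 / b ^+ 2 by rewrite divr_ge0 ?sqr_ge0.
have [gz gr gl] := gok z.
have conclude L : `|L| <= Q * (e ^+ 2 / b ^+ 2) \/ (`|z| < b /\ `|L| <= (Mr + Ml) * e) ->
    `|L| <= (Q + Mr + Ml) * (e ^+ 2 / b ^+ 2 + e * (`|z| < b)%R%:R).
  case=> [|[-> h]].
    move=> h; apply: le_trans h _; apply: ler_pM => //; rewrite -?addrA lerDl.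
      by rewrite addr_ge0.
    by rewrite mulr_ge0// ltW.
  rewrite mulr1; apply: le_trans h _; apply: ler_pM; rewrite ?addr_ge0// ?(ltW e0)//.
    by rewrite -addrA lerDr.
  by rewrite lerDr.
apply: conclude; have [z0|z0] := leP 0 z.
  rewrite !fE//; have [bz|zb] := leP b z.
    by left; rewrite gr//; exact: farr.
  right; rewrite ger0_norm//; split => //.
  rewrite -[g z](subrKC z); apply: le_trans (nearr z e _ _ _ _ _ _ gz) _ => //; last first.
    by rewrite ler_wpM2r ?(ltW e0)// lerDl.
  exact: le_trans (ltW zb) b1.
have Nz0 : 0 <= - z by rewrite oppr_ge0 ltW.
have -> : gmean (q * e) (fun x => glue fr fl (g z + x)) =
    gmean (q * e) (fun x => glue fl fr (- g z + x)).
  rewrite -(gmeanN v0 (mgrow_shift _ mf)); congr gmean; apply/funext => x.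
  by rewrite -[g z - x]opprK glueN// opprB addrC.
have -> : glue fr fl z - e * glue hr hl z = fl (- z) - e * hl (- z).
  by rewrite /glue leNgt z0.
have [bz|zb] := leP b (- z).
  left; rewrite gl; last by rewrite lerNr.
  by rewrite (_ : - (z - l * e) = - z + l * e); [exact: farl|ring].
right; rewrite ltr0_norm//; split => //.
have dz : `|- (g z - z)| <= ell * e by rewrite normrN.
rewrite (_ : - g z = - z + - (g z - z)); last by ring.
apply: le_trans (nearl (- z) e _ _ _ _ _ _ dz) _ => //; last first.
  by rewrite ler_wpM2r ?(ltW e0)// lerDr.
exact: le_trans (ltW zb) b1.
Qed.

End glue_step.

Section concrete_step.
Context {R : realType}.
Variables (q r l : R).
Hypotheses (q0 : 0 < q) (r0 : 0 < r) (l0 : 0 < l).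

Lemma half_sol_scale1 (r' : R) : 0 < r' ->
  half_sol q r' (kap q r' + 1) (scale1 q r') (fun=> 0).
Proof.
move=> r'0; have k0 := kap_gt0 q0 r'0; split; first exact: mgrow_scale1.
  move=> w y y' yw yw'; apply: le_trans (scale1_lip q0 r'0 yw yw') _.
  apply: ler_wpM2r => //; rewrite -[leLHS]mul1r; apply: ler_pM; rewrite ?expR_ge0//.
    by rewrite lerDr ltW.
  by rewrite ler_expR ler_wpM2r ?lerDl//; exact: le_trans yw.
by move=> z e e0; rewrite gmean_scale1// mulr0 subr0.
Qed.

Lemma half_solN (r' K : R) fr hr : half_sol q r' K fr hr ->
  0 < r' -> half_sol q r' K (fun y => - fr y) (fun y => - hr y).
Proof.
move=> [mfr lip ex] r'0; split; first exact: mgrowN.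
  by move=> w y y' yw yw'; rewrite -opprD normrN; exact: lip.
move=> z e e0.
rewrite (_ : (fun x => _) = fun x => -1 * fr (z + r' * e + x)).
  by rewrite gmeanZ ?ex//; [ring|exact: mulr_gt0|exact: mgrow_shift].
by apply/funext => x; rewrite mulN1r.
Qed.

(** Both branches have slope 1 at 0, so only second-order Taylor remainders survive. *)
Lemma C1_glue_scale : C1_glue (kap q r + kap q l) (scale1 q r) (fun y => - scale1 q l y).
Proof.
move=> y y0; have kr0 := kap_gt0 q0 r0; have kl0 := kap_gt0 q0 l0.
rewrite /scale1 /hit1.
have h1 := expR_taylor2 (kap q l * y); have h2 := expR_taylor2 (- kap q r * y).
set kr := kap q r in kr0 h2 *; set kl := kap q l in kl0 h1 *.
rewrite (_ : _ - _ = (expR (kl * y) - 1 - kl * y) / kl +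
   (expR (- kr * y) - 1 - - kr * y) / kr); last first.
  by rewrite mulrNN; field; rewrite !lt0r_neq0.
apply: le_trans (ler_normD _ _) _; rewrite !normrM !normfV (gtr0_norm kl0) (gtr0_norm kr0).
have y2 : 0 <= y ^+ 2 by exact: sqr_ge0.
have e1 : expR (kl * `|y|) <= expR ((kr + kl) * `|y|).
  by rewrite ler_expR ler_wpM2r// lerDr ltW.
have e2 : expR (kr * `|y|) <= expR ((kr + kl) * `|y|).
  by rewrite ler_expR ler_wpM2r// lerDl ltW.
rewrite [X in _ <= X]mulrDl [X in _ <= X]addrC; apply: lerD; last first.
- rewrite ler_pdivrMr//; apply: le_trans h2 _.
  rewrite [`|- kr * y|]normrM normrN (gtr0_norm kr0)
    (_ : (- kr * y) ^+ 2 = kr * kr * y ^+ 2); last by ring.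
  have := ler_wpM2l (mulr_ge0 (mulr_ge0 (ltW kr0) (ltW kr0)) y2) e2.
  by move=> h; apply: le_trans h _; rewrite le_eqVlt; apply/orP; left; apply/eqP; ring.
- rewrite ler_pdivrMr//; apply: le_trans h1 _.
  rewrite [`|kl * y|]normrM (gtr0_norm kl0) (_ : (kl * y) ^+ 2 = kl * kl * y ^+ 2); last by ring.
  have := ler_wpM2l (mulr_ge0 (mulr_ge0 (ltW kl0) (ltW kl0)) y2) e1.
  by move=> h; apply: le_trans h _; rewrite le_eqVlt; apply/orP; left; apply/eqP; ring.
Qed.

Lemma pot0_gt0 : 0 < pot0 q r l.
Proof. by rewrite /pot0 divr_gt0// !mulr_gt0. Qed.

Lemma C1_glue_pot : let A := pot0 q r l in
  exists2 K : R, 0 <= K & C1_glue K (pot1 q r A) (pot1 q l A).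
Proof.
move=> A; have A0 : 0 < A by exact: pot0_gt0.
have kr0 := kap_gt0 q0 r0; have kl0 := kap_gt0 q0 l0.
have AE : A * (kap q l + kap q r) = r^-1 + l^-1.
  by rewrite /A /pot0 /kap; field; rewrite !lt0r_neq0.
rewrite /C1_glue /pot1 /hit1.
set kr := kap q r in kr0 AE *; set kl := kap q l in kl0 AE *.
clearbody kr kl A.
have rV0 : 0 < r^-1 by rewrite invr_gt0.
have lV0 : 0 < l^-1 by rewrite invr_gt0.
pose K0 := A * kl ^+ 2 + A * kr ^+ 2 + kl / l + kr / r.
have K00 : 0 <= K0.
  have p1 := mulr_gt0 A0 (exprn_gt0 2 kl0); have p2 := mulr_gt0 A0 (exprn_gt0 2 kr0).
  by have p3 := mulr_gt0 kl0 lV0; have p4 := mulr_gt0 kr0 rV0; rewrite /K0; lra.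
exists (K0 + kl + kr); first lra.
move=> y y0.
have h1 := expR_taylor2 (kl * y); have h2 := expR_taylor2 (- kr * y).
have h3 := expR_taylor1 (kl * y); have h4 := expR_taylor1 (- kr * y).
set W := expR ((K0 + kl + kr) * `|y|).
have e1 : expR `|kl * y| <= W.
  by rewrite ler_expR normrM (gtr0_norm kl0) ler_wpM2r//; lra.
have e2 : expR `|- kr * y| <= W.
  by rewrite ler_expR normrM normrN (gtr0_norm kr0) ler_wpM2r//; lra.
have y2 : 0 <= y ^+ 2 by exact: sqr_ge0.
have W0 : 0 <= W by exact: expR_ge0.
rewrite mulrNN (_ : _ - _ = A * (expR (kl * y) - 1 - kl * y)
  - A * (expR (- kr * y) - 1 - - kr * y)
  - y / l * (expR (kl * y) - 1) - y / r * (expR (- kr * y) - 1)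
  + (A * (kl + kr) - r^-1 - l^-1) * y); last by ring.
(* The choice of [pot0] cancels the linear term; this is what fixes the value of the expectation. *)
rewrite AE [X in _ + X * y](_ : _ = 0) ?mul0r ?addr0; last by ring.
have t1 : `|A * (expR (kl * y) - 1 - kl * y)| <= A * kl ^+ 2 * (y ^+ 2 * W).
  rewrite normrM (gtr0_norm A0) -mulrA ler_pM2l//; apply: le_trans h1 _.
  by rewrite exprMn -mulrA; apply: ler_wpM2l; [exact: sqr_ge0|exact: ler_wpM2l].
have t2 : `|A * (expR (- kr * y) - 1 - - kr * y)| <= A * kr ^+ 2 * (y ^+ 2 * W).
  rewrite normrM (gtr0_norm A0) -mulrA ler_pM2l//; apply: le_trans h2 _.
  by rewrite exprMn sqrrN -mulrA; apply: ler_wpM2l; [exact: sqr_ge0|exact: ler_wpM2l].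
have yy : `|y| * `|y| = y ^+ 2 by rewrite -expr2 real_normK// num_real.
have t3 : `|y / l * (expR (kl * y) - 1)| <= kl / l * (y ^+ 2 * W).
  rewrite !normrM normfV (gtr0_norm l0).
  have := ler_wpM2l (normr_ge0 y) (le_trans h3 (ler_wpM2l (normr_ge0 _) e1)).
  rewrite normrM (gtr0_norm kl0) => /(ler_wpM2l (ltW lV0)).
  by rewrite -yy; lra.
have t4 : `|y / r * (expR (- kr * y) - 1)| <= kr / r * (y ^+ 2 * W).
  rewrite !normrM normfV (gtr0_norm r0).
  have := ler_wpM2l (normr_ge0 y) (le_trans h4 (ler_wpM2l (normr_ge0 _) e2)).
  rewrite normrM normrN (gtr0_norm kr0) => /(ler_wpM2l (ltW rV0)).
  by rewrite -yy; lra.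
apply: (@le_trans _ _ (K0 * (y ^+ 2 * W))); last first.
  by apply: ler_wpM2r; [exact: mulr_ge0|rewrite -addrA lerDl addr_ge0// ltW].
rewrite /K0.
apply: le_trans (ler_normB _ _) _; rewrite mulrDl; apply: lerD => //.
apply: le_trans (ler_normB _ _) _; rewrite mulrDl; apply: lerD => //.
by apply: le_trans (ler_normB _ _) _; rewrite mulrDl; apply: lerD.
Qed.

End concrete_step.

(** * Dynkin and occupation estimates for the discrete chain *)

Section huber.
Context {R : realType}.
Implicit Types (b c y z : R).

(* Huber's function: the largest convex function with second derivative [1] on [-b, b] and slope at
   most [b]. *)
Definition huber b z : R := if `|z| <= b then z ^+ 2 / 2 else b * `|z| - b ^+ 2 / 2.

(** [huber b] is the Legendre transform of [c ^+ 2 / 2] on [[-b, b]]; the maximizing [c] then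
    provides a subgradient. *)
Lemma huber_ge b c z : `|c| <= b -> c * z - c ^+ 2 / 2 <= huber b z.
Proof.
rewrite ler_norml => /andP[c1 c2]; rewrite /huber; case: ifPn => [_|].
  by have := sqr_ge0 (z - c); nra.
rewrite -ltNge; case: ger0P => z0 zb.
  have : 0 <= (b - c) * (z - b) by rewrite mulr_ge0; lra.
  by have := sqr_ge0 (b - c); nra.
have : 0 <= (b + c) * (- z - b) by rewrite mulr_ge0; lra.
by have := sqr_ge0 (b + c); nra.
Qed.

Lemma huber_subgradient b z : 0 <= b ->
  exists2 c, `|c| <= b & forall y, huber b z + c * (y - z) <= huber b y.
Proof.
move=> b0.
suff [c cb cz] : exists2 c, `|c| <= b & huber b z = c * z - c ^+ 2 / 2.
  by exists c => // y; rewrite cz; have := huber_ge y cb; lra.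
rewrite /huber; case: ifPn => [zb|]; first by exists z => //; lra.
rewrite -ltNge; case: ger0P => z0 zb; first by exists b => //; rewrite ger0_norm.
by exists (- b); [rewrite normrN ger0_norm|rewrite sqrrN; lra].
Qed.

Lemma huber_ge0 b z : 0 <= b -> 0 <= huber b z.
Proof.
move=> b0; have := @huber_ge b 0 z; rewrite normr0 mul0r expr0n mul0r subr0.
exact.
Qed.

Lemma huber_le b z : 0 <= b -> huber b z <= b * `|z|.
Proof.
move=> b0; rewrite /huber; case: ifPn => [zb|_]; last first.
  by rewrite lerBlDr lerDl divr_ge0// sqr_ge0.
rewrite -(real_normK (num_real z)); have := normr_ge0 z; nra.
Qed.

Lemma mgrow_huber b : mgrow (huber b).
Proof.
apply: mgrow_if.
- by apply: measurable_fun_ler => //; exact: measurableT_comp.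
- rewrite (_ : (fun x => _) = fun x : R => 2^-1 * x ^+ 2).
    exact/mgrowZ/mgrowX/mgrow_id.
  by apply/funext => x; rewrite mulrC.
- apply: mgrowB; last exact: mgrow_cst.
  exact/mgrowZ/mgrow_norm/mgrow_id.
Qed.

Let m24 : mgrow (fun x : R => x ^+ 2 * expR `|x|) /\ mgrow (fun x : R => x ^+ 4 * expR `|x|).
Proof.
have me := mgrow_expR_norm (1 : R).
rewrite (_ : (fun _ => _) = fun x : R => expR `|x|) in me; last first.
  by apply/funext => x; rewrite mul1r.
by split; apply: mgrowM => //; exact/mgrowX/mgrow_id.
Qed.

Lemma gmean_id v : 0 < v -> gmean v (fun x : R => x) = 0.
Proof.
move=> v0; have := gmean_MexpR 0 v0.
rewrite !mul0r => <-; congr gmean; apply/funext => x.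
by rewrite mul0r expR0 mulr1.
Qed.

(** Convexity alone gives the first two terms. The gain in the band comes from the second derivative
    1 of [huber (2 * b)] on [[- 2 * b, 2 * b]], an interval that a jump [|x| <= b] from [|z| < b]
    does not leave. *)
Lemma gmean_huber v b z dd : 0 < v -> v <= 1 -> 0 < b -> b <= 1 ->
  v * (48 * expR (2 ^+ 2 / 2)) <= b ^+ 2 / 2 ->
  huber (2 * b) z - 2 * b * `|dd| + v / (4 * expR 1) * (`|z| < b)%R%:R
    <= gmean v (fun x => huber (2 * b) (z + dd + x)).
Proof.
move=> v0 v1 b0 b1 vb; set H := huber (2 * b).
have bb : 0 <= 2 * b by lra.
have [c cb cz] := huber_subgradient z bb; rewrite -/H in cz.
have [m2 m4] := m24.
have mH : mgrow H by exact: mgrow_huber.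
have mid : mgrow (fun x : R => x) by exact: mgrow_id.
have lipH y y' : H y - 2 * b * `|y' - y| <= H y'.
  have [c' c'b c'y] := huber_subgradient y bb.
  apply: le_trans (c'y y'); rewrite lerD2l.
  have : `|c' * (y' - y)| <= 2 * b * `|y' - y| by rewrite normrM ler_wpM2r.
  by rewrite ler_norml => /andP[].
have lipd x : H (z + x) - 2 * b * `|dd| <= H (z + dd + x).
  have := lipH (z + x) (z + dd + x).
  by rewrite (_ : z + dd + x - (z + x) = dd)//; ring.
case: (ltP `|z| b) => zb /=; last first.
  rewrite mulr0 addr0.
  apply: (@le_trans _ _ (gmean v (fun x => H z - 2 * b * `|dd| + c * x))).
    rewrite gmeanD ?gmeanZ ?gmean_id ?gmean_cst ?mulr0 ?addr0//.
      exact: mgrow_cst.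
    exact: mgrowZ.
  apply: gmean_le => //.
  - by apply: mgrowD; [exact: mgrow_cst|exact: mgrowZ].
  - exact: mgrow_shift.
  by move=> x; have := lipd x; have := cz (z + x); rewrite (addrC z) addrK; lra.
(* For [|x| <= b <= 1] one has [p * expR |x| <= 1 / 2], so the weighted square is below the
   quadratic gain; for [|x| > b] the fourth-order term outweighs it. The hypothesis on [v] against
   [b ^+ 2] leaves half of [p * v], that is [v / (4 * expR 1)]. *)
pose p := (2 * expR 1)^-1 : R.
have p0 : 0 < p by rewrite invr_gt0 mulr_gt0// expR_gt0.
rewrite mulr1.
apply: (@le_trans _ _ (gmean v (fun x => H z - 2 * b * `|dd| + z * x +
     (p * (x ^+ 2 * expR `|x|) - p / b ^+ 2 * (x ^+ 4 * expR `|x|))))).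
  have mc : mgrow (fun x : R => H z - 2 * b * `|dd| + z * x).
    by apply: mgrowD; [exact: mgrow_cst|exact: mgrowZ].
  rewrite (gmeanD v0 mc); last by apply: mgrowB; exact: mgrowZ.
  rewrite gmeanD ?gmeanZ ?gmean_id ?gmean_cst ?mulr0 ?addr0//; last 2 first.
  - exact: mgrow_cst.
  - exact: mgrowZ.
  rewrite lerD2l gmeanB ?gmeanZ//; [|exact: mgrowZ..].
  have g2 := gmean_X2expR_ge v0.
  have [_] := gmean_moment v0 v1 (ler01 : 0 <= (1 : R)).
  rewrite (_ : (fun x => _) = fun x : R => x ^+ 4 * expR `|x|); last first.
    by apply/funext => x; rewrite mul1r.
  rewrite (_ : 1 + 1 = 2 :> R)// => g4.
  have b20 : 0 < b ^+ 2 by rewrite exprn_gt0.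
  have g4' : gmean v (fun x : R => x ^+ 4 * expR `|x|) / b ^+ 2 <= v / 2.
    rewrite ler_pdivrMr//; apply: le_trans g4 _.
    by have := ler_wpM2l (ltW v0) vb; lra.
  rewrite (_ : v / (4 * expR 1) = p * (v / 2)); last first.
    by rewrite /p; field; rewrite gt_eqF// expR_gt0.
  rewrite (_ : p / b ^+ 2 * _ = p * (gmean v (fun x : R => x ^+ 4 * expR `|x|) / b ^+ 2)); last by ring.
  by rewrite -mulrBr ler_pM2l//; lra.
apply: gmean_le => //.
- apply: mgrowD; last by apply: mgrowB; exact: mgrowZ.
  by apply: mgrowD; [exact: mgrow_cst|exact: mgrowZ].
- exact: mgrow_shift.
move=> x; apply: le_trans (lipd x).
have [xb|bx] := leP `|x| b.
  have Hzx : H (z + x) = (z + x) ^+ 2 / 2.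
    rewrite /H /huber ifT//; apply: le_trans (ler_normD _ _) _; lra.
  have Hz : H z = z ^+ 2 / 2 by rewrite /H /huber ifT//; lra.
  have t1 : p * (x ^+ 2 * expR `|x|) <= x ^+ 2 / 2.
    rewrite mulrC -mulrA ler_wpM2l ?sqr_ge0// /p invfM mulrCA ler_piMr ?invr_ge0//.
    by rewrite ler_pdivrMr ?expR_gt0// mul1r ler_expR; lra.
  have t2 : 0 <= p / b ^+ 2 * (x ^+ 4 * expR `|x|).
    apply: mulr_ge0; first by rewrite divr_ge0 ?sqr_ge0// ltW.
    by rewrite mulr_ge0 ?expR_ge0// exprn_even_ge0.
  by rewrite Hzx Hz sqrrD; lra.
have czx := lipH (z + x) z.
have zgrad : H z + z * x <= H (z + x).
  have := @huber_ge (2 * b) z (z + x) _; rewrite -/H.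
  have Hz : H z = z ^+ 2 / 2 by rewrite /H /huber ifT//; lra.
  rewrite Hz => /(_ _) h; apply: le_trans (h _); first by nra.
  by lra.
suff : p * (x ^+ 2 * expR `|x|) <= p / b ^+ 2 * (x ^+ 4 * expR `|x|) by lra.
rewrite -mulrA ler_pM2l//.
have b20 : 0 < b ^+ 2 by rewrite exprn_gt0.
rewrite [leRHS]mulrC ler_pdivlMr// (_ : x ^+ 4 = x ^+ 2 * x ^+ 2); last by ring.
have h : b ^+ 2 <= x ^+ 2.
  rewrite -(real_normK (num_real x)).
  by apply: lerXn2r; rewrite ?nnegrE//; exact: ltW.
by have := ler_wpM2l (mulr_ge0 (sqr_ge0 x) (expR_ge0 `|x|)) h; lra.
Qed.

End huber.

Section chain_estimates.
Context {d : measure_display} {T : measurableType d} {R : realType}.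
Variables (P : probability T R) (q r l ell e b : R) (g : R -> R) (xi : nat -> T -> R).
Hypotheses (q0 : 0 < q) (e0 : 0 < e) (e1 : e <= 1).
Hypotheses (qe1 : q * e <= 1) (b0 : 0 < b) (b1 : b <= 1).
Hypothesis gok : drift_ok r l ell e b g.
Hypothesis mg : measurable_fun [set: R] g.
Hypothesis xiP : iid_gauss P (q * e) xi.

Notation E := (wmean P xi (fun _ _ => false) (fun=> g)).

Let v0 : 0 < q * e. Proof. exact: mulr_gt0. Qed.

Let ma (k : nat) : measurable_fun [set: R] (fun _ : R => false).
Proof. exact: measurable_cst. Qed.

Let mgk (k : nat) : measurable_fun [set: R] g := mg.

Let gle (k : nat) z : `|g z| <= `|z| + ell * e.
Proof.
have [gz _ _] := gok z; rewrite -[g z](subrK z).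
by apply: le_trans (ler_normD _ _) _; rewrite addrC lerD2l.
Qed.

Let E_le := wmean_le v0 xiP ma mgk gle.
Let ED := wmeanD v0 xiP ma mgk gle.
Let EB := wmeanB v0 xiP ma mgk gle.
Let EZ := wmeanZ v0 xiP ma mgk gle.
Let ES_le := wmeanS_le v0 xiP ma mgk gle.
Let ES_ge := wmeanS_ge v0 xiP ma mgk gle.

(** A Lyapunov function dominating [|z|]: one step multiplies the mean of each exponential by at
    most [D]. *)
Lemma chain_expR_norm k :
  E (fun z => expR (1 * z) + expR (-1 * z)) k <= 2 * expR ((ell + q / 2) * (k%:R * e)).
Proof.
elim: k => [|k IH].
  by rewrite wmean0 !mulr0 mul0r mulr0 !expR0; lra.
pose D := expR ((ell + q / 2) * e).
have m1 := mgrow_expR (1 : R); have m2 := mgrow_expR (-1 : R).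
apply: (@le_trans _ _ (D * E (fun z => expR (1 * z) + expR (-1 * z)) k)).
  rewrite -EZ; last exact: mgrowD.
  apply: ES_le; [exact: mgrowD|by apply: mgrowZ; exact: mgrowD|].
  move=> z; rewrite /walk_op.
  have [gz _ _] := gok z; move: gz; rewrite ler_norml => /andP[gz1 gz2].
  rewrite (gmeanD v0 (mgrow_shift (g z) m1) (mgrow_shift (g z) m2)).
  have H c : c ^+ 2 = 1 -> c * g z <= c * z + ell * e ->
      gmean (q * e) (fun x => expR (c * (g z + x))) <= D * expR (c * z).
    move=> c2 cg; rewrite (_ : (fun x => _) = fun x => expR (c * g z) * expR (c * x)).
      rewrite gmeanZ// ?gmean_expR//; last exact: mgrow_expR.
      by rewrite c2 mul1r -!expRD ler_expR; lra.
    by apply/funext => x; rewrite mulrDr expRD.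
  by rewrite mulrDr lerD//; apply: H; rewrite ?sqrrN ?expr1n//; lra.
apply: le_trans (ler_wpM2l (expR_ge0 _) IH) _.
rewrite mulrCA ler_pM2l// -expRD ler_expR -natr1; lra.
Qed.

Let band (z : R) : R := (`|z| < b)%R%:R.

Let mband : mgrow band.
Proof.
have mA : measurable_fun [set: R] (fun z : R => `|z| < b).
  by apply: measurable_fun_ltr => //; exact: measurableT_comp.
have := mgrow_if mA (mgrow_cst (1 : R)) (mgrow_cst 0).
by congr mgrow; apply/funext => z; rewrite /band; case: ifP.
Qed.

(** A discrete local-time bound. Each expected visit to the band raises the mean of [huber (2 * b)]
    by [c0 * e], up to the drift loss, while this mean is at most [2 * b] times that of [|z|]: the
    time in the band is O(b). *)
Lemma chain_occupation n :
  q * e * (48 * expR (2 ^+ 2 / 2)) <= b ^+ 2 / 2 ->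
  q / (4 * expR 1) * (e * \sum_(i < n) E band i)
    <= 2 * b * (2 * expR ((ell + q / 2) * (n%:R * e))) + 2 * b * ell * (n%:R * e).
Proof.
move=> qeb; set H := huber (2 * b).
have mH : mgrow H by exact: mgrow_huber.
have bb : 0 <= 2 * b by have := b0; lra.
set c0 := q / (4 * expR 1).
have step i : E H i - 2 * b * (ell * e) + c0 * e * E band i <= E H i.+1.
  have mc := mgrow_cst (2 * b * (ell * e)).
  rewrite -(wmean_cst P xi (fun _ _ => false) (fun=> g) (2 * b * (ell * e)) i).
  rewrite -EB// -EZ// -ED//; [|exact: mgrowB|exact: mgrowZ].
  apply: ES_ge => //; first by apply: mgrowD; [exact: mgrowB|exact: mgrowZ].
  move=> z; rewrite /walk_op.
  have := @gmean_huber _ _ b z (g z - z) v0 qe1 b0 b1 qeb.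
  rewrite subrKC; apply: le_trans; rewrite -/H /c0 /band.
  have [gz _ _] := gok z.
  have : 2 * b * `|g z - z| <= 2 * b * (ell * e) by rewrite ler_wpM2l.
  by lra.
have tel : c0 * (e * \sum_(i < n) E band i) <= E H n + 2 * b * ell * (n%:R * e).
  elim: n => [|n IH].
    by rewrite big_ord0 !mulr0 mul0r mulr0 addr0 wmean0 huber_ge0.
  by rewrite big_ord_recr/= -natr1; have := step n; lra.
apply: le_trans tel _; rewrite lerD2r.
apply: le_trans (_ : 2 * b * E (fun z => expR (1 * z) + expR (-1 * z)) n <= _); last first.
  by rewrite ler_wpM2l//; exact: chain_expR_norm.
have m1 := mgrow_expR (1 : R); have m2 := mgrow_expR (-1 : R).
rewrite -EZ; last exact: mgrowD.
apply: E_le => //; first by apply: mgrowZ; exact: mgrowD.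
move=> z; apply: le_trans (huber_le z bb) _; rewrite ler_wpM2l//.
rewrite mul1r mulN1r; case: ger0P => _.
  by apply: le_trans (ler_id_expR z) _; rewrite lerDl expR_ge0.
by apply: le_trans (ler_id_expR (- z)) _; rewrite lerDr expR_ge0.
Qed.

Lemma chain_dynkin (f h : R -> R) (M : R) k : mgrow f -> mgrow h ->
  (forall z, `|gmean (q * e) (fun x => f (g z + x)) - (f z - e * h z)|
     <= M * (e ^+ 2 / b ^+ 2 + e * (`|z| < b)%R%:R)) ->
  `|E f k - f 0 + e * \sum_(i < k) E h i|
    <= M * (k%:R * e * (e / b ^+ 2) + e * \sum_(i < k) E band i).
Proof.
move=> mf mh H; elim: k => [|k IH].
  rewrite !big_ord0 wmean0 subrr !mulr0 !mul0r addr0 normr0.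
  by rewrite mulr0.
rewrite !big_ord_recr/=.
have mB : mgrow (fun z => M * (e ^+ 2 / b ^+ 2 + e * band z)).
  by apply: mgrowZ; apply: mgrowD; [exact: mgrow_cst|exact: mgrowZ].
have EBnd : E (fun z => M * (e ^+ 2 / b ^+ 2 + e * band z)) k =
    M * (e ^+ 2 / b ^+ 2 + e * E band k).
  rewrite EZ; last by apply: mgrowD; [exact: mgrow_cst|exact: mgrowZ].
  by rewrite ED; [rewrite wmean_cst EZ|exact: mgrow_cst|exact: mgrowZ].
have mfh : mgrow (fun z => f z - e * h z) by apply: mgrowB => //; exact: mgrowZ.
have Efh : E (fun z => f z - e * h z) k = E f k - e * E h k.
  by rewrite EB ?EZ//; exact: mgrowZ.
have up : E f k.+1 <= E f k - e * E h k + M * (e ^+ 2 / b ^+ 2 + e * E band k).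
  rewrite -Efh -EBnd -ED//; apply: ES_le => //; first exact: mgrowD.
  by move=> z; have := H z; rewrite ler_norml /walk_op /band => /andP[]; lra.
have lo : E f k - e * E h k - M * (e ^+ 2 / b ^+ 2 + e * E band k) <= E f k.+1.
  rewrite -Efh -EBnd -EB//; apply: ES_ge => //; first exact: mgrowB.
  by move=> z; have := H z; rewrite ler_norml /walk_op /band => /andP[]; lra.
move: IH; rewrite !ler_norml -natr1 => /andP[IH1 IH2].
by apply/andP; split; lra.
Qed.

End chain_estimates.

(** [scale] is nearly a martingale and [pot] nearly solves the potential equation; the far steps
    contribute [e / b ^+ 2] and the O(b) occupation of the band contributes [b]. [C] is chosen
    before the mesh, the band, the chain and the probability space. *)
Lemma chain_estimates (R : realType) (q r l ell t : R) :
  0 < q -> 0 < r -> 0 < l -> 0 <= ell -> 0 <= t ->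
  exists2 C : R, 0 <= C &
  forall (d : measure_display) (T : measurableType d) (P : probability T R)
    (e b : R) (g : R -> R) (xi : nat -> T -> R) (k : nat),
  0 < e -> e <= 1 -> q * e <= 1 -> 0 < b -> b <= 1 ->
  q * e * (48 * expR (2 ^+ 2 / 2)) <= b ^+ 2 / 2 ->
  drift_ok r l ell e b g -> measurable_fun [set: R] g -> iid_gauss P (q * e) xi ->
  k%:R * e <= t ->
  let E := wmean P xi (fun _ _ => false) (fun=> g) in
  `|E (scale q r l) k| <= C * (e / b ^+ 2 + b) /\
  `|E (pot q r l) k - pot0 q r l + e * \sum_(i < k) E (hitp q r l) i|
     <= C * (e / b ^+ 2 + b).
Proof.
move=> q0 r0 l0 ell0 t0.
pose occ := 4 * expR 1 / q * (4 * expR ((ell + q / 2) * t) + 2 * ell * t).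
have occ0 : 0 <= occ.
  apply: mulr_ge0; first by rewrite divr_ge0 ?mulr_ge0 ?expR_ge0// ltW.
  by rewrite addr_ge0 ?mulr_ge0 ?expR_ge0.
have A0 := pot0_gt0 q0 r0 l0.
have [Kp1 Kp10 lip1] := pot1_lip q0 r0 (ltW A0).
have [Kp2 Kp20 lip2] := pot1_lip q0 l0 (ltW A0).
have [Kg1 Kg10 gl1] := C1_glue_pot q0 r0 l0.
have [Kg2 Kg20 gl2] := C1_glue_pot q0 l0 r0.
have AC : pot0 q l r = pot0 q r l by rewrite /pot0 mulrAC.
rewrite AC in gl2.
pose Kp := Kp1 + Kp2 + Kg1 + Kg2.
have Kp0 : 0 <= Kp by rewrite !addr_ge0.
have hp (r' K' : R) : 0 < r' -> 0 <= K' -> K' <= Kp ->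
    (forall w y y' : R, `|y| <= w -> `|y'| <= w ->
      `|pot1 q r' (pot0 q r l) y - pot1 q r' (pot0 q r l) y'| <=
      K' * expR (K' * w) * `|y - y'|) ->
    half_sol q r' Kp (pot1 q r' (pot0 q r l)) (hit1 q r').
  move=> r'0 K'0 K'Kp lip; apply: (half_sol_le K'0 K'Kp); split => //.
  - exact: mgrow_pot1.
  - by move=> z e e0; exact: gmean_pot1.
have [Mp Mp0 stepp] : exists2 M : R, 0 <= M & forall e b g z, 0 < e -> e <= 1 -> q * e <= 1 ->
    0 < b -> b <= 1 -> drift_ok r l ell e b g ->
    `|gmean (q * e) (fun x => pot q r l (g z + x)) - (pot q r l z - e * hitp q r l z)|
    <= M * (e ^+ 2 / b ^+ 2 + e * (`|z| < b)%R%:R).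
  apply: (glue_step q0 r0 l0 Kp0 ell0).
  - by apply: (hp r Kp1) => //; rewrite /Kp; lra.
  - by apply: (hp l Kp2) => //; rewrite /Kp; lra.
  - by apply: C1_glue_le gl1 => //; rewrite /Kp; lra.
  - by apply: C1_glue_le gl2 => //; rewrite /Kp; lra.
have kr0 := kap_gt0 q0 r0; have kl0 := kap_gt0 q0 l0.
pose Ks := kap q r + kap q l + 1.
have Ks0 : 0 <= Ks by rewrite /Ks; lra.
have [Ms Ms0 steps] : exists2 M : R, 0 <= M & forall e b g z, 0 < e -> e <= 1 -> q * e <= 1 ->
    0 < b -> b <= 1 -> drift_ok r l ell e b g ->
    `|gmean (q * e) (fun x => scale q r l (g z + x)) -
       (scale q r l z - e * glue (fun=> 0) (fun=> - 0) z)|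
    <= M * (e ^+ 2 / b ^+ 2 + e * (`|z| < b)%R%:R).
  apply: (glue_step q0 r0 l0 Ks0 ell0).
  - by apply: half_sol_le (half_sol_scale1 q0 r0); rewrite /Ks; lra.
  - apply: half_sol_le (half_solN q0 (half_sol_scale1 q0 l0) l0); rewrite /Ks; lra.
  - by apply: C1_glue_le (C1_glue_scale q0 r0 l0); rewrite /Ks; lra.
  - have := C1_glue_scale q0 l0 r0; move=> H y y0.
    rewrite (_ : _ - _ = - (- scale1 q r (- y) - scale1 q l y)); last by ring.
    by rewrite normrN; apply: (C1_glue_le _ _ H) => //; rewrite /Ks; lra.
exists ((Mp + Ms) * (t + occ)); first by rewrite mulr_ge0 ?addr_ge0.
move=> d T P e b g xi k e0 e1 qe1 b0 b1 qeb gok mg xiP ket E.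
have mscale : mgrow (scale q r l).
  by apply: mgrow_glue; [exact: mgrow_scale1|apply: mgrowN; exact: mgrow_scale1].
have mpot : mgrow (pot q r l) by apply: mgrow_glue; exact: mgrow_pot1.
have mhit : mgrow (hitp q r l) by apply: mgrow_glue; exact: mgrow_hit1.
have Occ : e * \sum_(i < k) E (fun z => (`|z| < b)%R%:R) i <= occ * b.
  have := chain_occupation q0 e0 qe1 b0 b1 gok mg xiP k qeb.
  set S := e * _ => h.
  have c0 : 0 < 4 * expR 1 / q by rewrite divr_gt0// mulr_gt0// expR_gt0.
  have -> : S = 4 * expR 1 / q * (q / (4 * expR 1) * S).
    by field; rewrite !lt0r_neq0// expR_gt0.
  rewrite /occ -[leRHS]mulrA ler_pM2l//; apply: le_trans h _.
  set X := expR (_ * t).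
  have hX : expR ((ell + q / 2) * (k%:R * e)) <= X.
    by rewrite ler_expR ler_wpM2l// addr_ge0// divr_ge0// ltW.
  have h1 := ler_wpM2l (ltW b0) hX.
  have h2 := ler_wpM2l (mulr_ge0 (ltW b0) ell0) ket.
  by lra.
have eb0 : 0 <= e / b ^+ 2 by rewrite divr_ge0 ?sqr_ge0// ltW.
have ket0 : 0 <= k%:R * e by rewrite mulr_ge0// ltW.
have fin M X : 0 <= M -> M <= Mp + Ms ->
    `|X| <= M * (k%:R * e * (e / b ^+ 2) + e * \sum_(i < k) E (fun z => (`|z| < b)%R%:R) i) ->
    `|X| <= (Mp + Ms) * (t + occ) * (e / b ^+ 2 + b).
  move=> M0 MM h; apply: le_trans h _; rewrite -[leRHS]mulrA.
  have h1 : k%:R * e * (e / b ^+ 2) + e * \sum_(i < k) E (fun z => (`|z| < b)%R%:R) i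
     <= (t + occ) * (e / b ^+ 2 + b).
    have := ler_wpM2r eb0 ket; have := mulr_ge0 t0 (ltW b0); have := mulr_ge0 occ0 eb0.
    by move=> h1 h2 h3; rewrite mulrDl !mulrDr; lra.
  have h2 : 0 <= (t + occ) * (e / b ^+ 2 + b).
    by rewrite mulr_ge0// addr_ge0// ltW.
  exact: le_trans (ler_wpM2l M0 h1) (ler_wpM2r h2 MM).
split.
- have := chain_dynkin q0 e0 gok mg xiP k mscale _ (fun z => steps e b g z e0 e1 qe1 b0 b1 gok).
  have -> : glue (fun=> 0) (fun=> - 0) = (fun=> 0) :> (R -> R).
    by apply/funext => z; rewrite /glue oppr0; case: ifP.
  move=> /(_ (mgrow_cst 0)); rewrite (_ : scale q r l 0 = 0); last first.
    by rewrite /scale /glue lexx /scale1 /hit1 mulr0 expR0 subrr mul0r.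
  rewrite subr0 big1 ?mulr0 ?addr0; last by move=> i _; rewrite wmean_cst.
  by apply: fin => //; rewrite lerDr.
- have := chain_dynkin q0 e0 gok mg xiP k mpot mhit (fun z => stepp e b g z e0 e1 qe1 b0 b1 gok).
  rewrite (_ : pot q r l 0 = pot0 q r l); last first.
    by rewrite /pot /glue lexx /pot1 /hit1 mulr0 expR0 mul0r addr0 mulr1.
  by apply: fin => //; rewrite lerDl.
Qed.

(** Probability that the diffusion with drift [r] started at [z] stays positive for ever. *)
Definition posp (R : realType) (q r z : R) : R := if 0 <= z then 1 - hit1 q r z else 0.

(** * Absorbed walks *)

Section posp.
Context {R : realType}.
Variables (q r : R).
Hypotheses (q0 : 0 < q) (r0 : 0 < r).

Let k0 : 0 < kap q r. Proof. exact: kap_gt0. Qed.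

Lemma hit1_le1 (z : R) : 0 <= z -> hit1 q r z <= 1.
Proof. by move=> z0; rewrite /hit1 expR_le1 mulNr oppr_le0 mulr_ge0// ltW. Qed.

Lemma hit1_ge0 (z : R) : 0 <= hit1 q r z. Proof. exact: expR_ge0. Qed.

Lemma hit1_0 : hit1 q r 0 = 1. Proof. by rewrite /hit1 mulr0 expR0. Qed.

Lemma hit1_subl (z w : R) : 0 <= z -> 0 <= w -> hit1 q r z - hit1 q r (z + w) <= kap q r * w.
Proof.
move=> z0 w0; rewrite (_ : hit1 q r (z + w) = hit1 q r z * hit1 q r w); last first.
  by rewrite /hit1 mulrDr expRD.
have h1 := hit1_le1 z0; have h2 := hit1_ge0 z.
have h3 : 1 - kap q r * w <= hit1 q r w.
  by rewrite /hit1; have := expR_ge1Dx (- kap q r * w); lra.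
have h4 : hit1 q r w <= 1 by exact: hit1_le1.
have := mulr_ge0 (ltW k0) w0; nra.
Qed.

Lemma mgrow_posp : mgrow (posp q r).
Proof.
apply: mgrow_if; first exact: measurable_fun_ler.
  by apply: mgrowB; [exact: mgrow_cst|exact: mgrow_hit1].
exact: mgrow_cst.
Qed.

End posp.

Section absorbed_walk.
Context {d : measure_display} {T : measurableType d} {R : realType}.
Variables (P : probability T R) (q r ell e : R) (g : R -> R) (xi : nat -> T -> R).
Hypotheses (q0 : 0 < q) (r0 : 0 < r) (e0 : 0 < e).
Hypothesis gle0 : forall z, `|g z| <= `|z| + ell.
Hypothesis mg : measurable_fun [set: R] g.
Hypothesis xiP : iid_gauss P (q * e) xi.

Let v0 : 0 < q * e. Proof. exact: mulr_gt0. Qed.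

(** Absorption after time [k] makes the final position remember whether [A] was met, so an event on
    a whole stretch of path becomes an event on one position. *)
Definition abs_set (A : R -> bool) (k i : nat) (z : R) : bool := (k <= i)%N && A z.
Definition abs_drift (k i : nat) (z : R) : R := if (i < k)%N then g z else z + r * e.
Definition abs_walk (A : R -> bool) (k : nat) := walk (abs_set A k) (abs_drift k) xi.

Lemma abs_walk_before A k i w : (i <= k)%N ->
  abs_walk A k i w = walk (fun _ _ => false) (fun=> g) xi i w.
Proof.
rewrite /abs_walk; elim: i => //= i IH ik.
by rewrite IH ?(ltnW ik)// /abs_set leqNgt ik /abs_drift ik.
Qed.

Lemma abs_walk_after A k j w : ~~ A (abs_walk A k (k + j) w) ->
  abs_walk A k (k + j) w = walk (fun _ _ => false) (fun=> g) xi k w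
     + \sum_(k <= i < k + j) (r * e + xi i w)
  /\ forall i, (i <= j)%N -> ~~ A (abs_walk A k (k + i) w).
Proof.
elim: j => [|j IH] nA.
  rewrite addn0 in nA *; rewrite big_geq// addr0 abs_walk_before//; split => // i.
  by rewrite leqn0 => /eqP ->; rewrite addn0.
move: nA; rewrite addnS /abs_walk /= -/(abs_walk A k) /abs_set leq_addr andTb.
case: ifPn => [-> //|nA nA']; have [Sj Aj] := IH nA.
split.
  rewrite big_nat_recr/= ?leq_addr// addrA -Sj /abs_drift ltnNge leq_addr/=.
  by rewrite addrA.
move=> i; rewrite leq_eqVlt => /orP[/eqP ->|ij]; last exact: Aj.
by rewrite addnS /abs_walk /= -/(abs_walk A k) /abs_set leq_addr andTb (negbTE nA).
Qed.

Lemma abs_walk_stay A k j w :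
  (forall i, (i <= j)%N -> ~~ A (walk (fun _ _ => false) (fun=> g) xi k w
     + \sum_(k <= m < k + i) (r * e + xi m w))) ->
  ~~ A (abs_walk A k (k + j) w).
Proof.
move=> H.
suff -> : abs_walk A k (k + j) w = walk (fun _ _ => false) (fun=> g) xi k w
     + \sum_(k <= i < k + j) (r * e + xi i w) by exact: H.
elim: j H => [|j IH] H.
  by rewrite addn0 big_geq// addr0 abs_walk_before.
have Sj : abs_walk A k (k + j) w = walk (fun _ _ => false) (fun=> g) xi k w
     + \sum_(k <= i < k + j) (r * e + xi i w).
  by apply: IH => i ij; apply: H; exact: leqW.
rewrite addnS /abs_walk /= -/(abs_walk A k) /abs_set leq_addr andTb Sj.
rewrite (negbTE (H j (leqnSn j))) big_nat_recr/= ?leq_addr// /abs_drift ltnNge leq_addr/=.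
by rewrite -!addrA.
Qed.

Variable A : R -> bool.
Hypothesis mA : measurable_fun [set: R] A.
Variable k : nat.

Notation EA := (wmean P xi (abs_set A k) (abs_drift k)).

Let ma i : measurable_fun [set: R] (abs_set A k i).
Proof.
rewrite /abs_set; case: (k <= i)%N => //=; exact: measurable_cst.
Qed.

Let mgd i : measurable_fun [set: R] (abs_drift k i).
Proof.
rewrite /abs_drift; case: (i < k)%N => //.
by apply: measurable_funD.
Qed.

Let gle i z : `|abs_drift k i z| <= `|z| + (`|ell| + r * e).
Proof.
have re0 : 0 <= r * e by rewrite mulr_ge0// ltW.
rewrite /abs_drift; case: (i < k)%N.
  by apply: le_trans (gle0 z) _; rewrite lerD2l; have := ler_norm ell; lra.
by apply: le_trans (ler_normD _ _) _; rewrite (ger0_norm re0) lerD2l lerDr.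
Qed.

Lemma abs_wmean_before f : EA f k = wmean P xi (fun _ _ => false) (fun=> g) f k.
Proof.
by congr fine; apply: eq_integral => w _; rewrite [walk _ _ _ _ _]abs_walk_before.
Qed.

Definition abs_le := wmean_le v0 xiP ma mgd gle.
Definition absD := wmeanD v0 xiP ma mgd gle.
Definition absB := wmeanB v0 xiP ma mgd gle.
Definition absS_le := wmeanS_le v0 xiP ma mgd gle.
Definition absS_ge := wmeanS_ge v0 xiP ma mgd gle.
Definition abs_EFin := wmean_EFin v0 xiP ma mgd gle.

Lemma abs_op f i z : (k <= i)%N -> walk_op (q * e) (abs_set A k) (abs_drift k) i f z =
  if A z then f z else gmean (q * e) (fun x => f (z + r * e + x)).
Proof.
by move=> ki; rewrite /walk_op /abs_set /abs_drift ki/= ltnNge ki.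
Qed.

End absorbed_walk.

Lemma mgrow_ind (R : realType) (A : R -> bool) : measurable_fun [set: R] A ->
  mgrow (fun z => (A z)%:R : R).
Proof.
move=> mA; have := mgrow_if mA (mgrow_cst (1 : R)) (mgrow_cst 0).
by congr mgrow; apply/funext => z; case: (A z).
Qed.

Section absorption_probability.
Context {d : measure_display} {T : measurableType d} {R : realType}.
Variables (P : probability T R) (q r ell e : R) (g : R -> R) (xi : nat -> T -> R).
Hypotheses (q0 : 0 < q) (r0 : 0 < r) (e0 : 0 < e).
Hypothesis gle0 : forall z, `|g z| <= `|z| + ell.
Hypothesis mg : measurable_fun [set: R] g.
Hypothesis xiP : iid_gauss P (q * e) xi.
Variable k : nat.

Notation E := (wmean P xi (fun _ _ => false) (fun=> g)).
Notation EA A := (wmean P xi (abs_set A k) (abs_drift r e g k)).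

Let v0 : 0 < q * e. Proof. exact: mulr_gt0. Qed.

Let kq0 : 0 < kap q r. Proof. exact: kap_gt0. Qed.

Lemma stay_above th j : 0 <= th ->
  E (posp q r) k - kap q r * th
    <= EA (fun z => z <= th) (fun z => (th < z)%R%:R) (k + j).
Proof.
move=> th0; pose A z := z <= th.
have mA : measurable_fun [set: R] A by exact: measurable_fun_ler.
pose f z := if z <= th then 0 else 1 - hit1 q r (- th + z).
have mh : mgrow (fun z => 1 - hit1 q r (- th + z)).
  apply: mgrowB; first exact: mgrow_cst.
  by apply: (mgrow_shift (- th)); exact: mgrow_hit1.
have mf : mgrow f by apply: mgrow_if => //; exact: mgrow_cst.
have fh z : 1 - hit1 q r (- th + z) <= f z.
  rewrite /f; case: ifPn => // zth; rewrite subr_le0 /hit1 -expR0 ler_expR.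
  by rewrite mulNr -mulrN; apply: mulr_ge0; [exact: ltW|lra].
have step i : EA A f (k + i) <= EA A f (k + i).+1.
  apply: (absS_ge q0 r0 e0 gle0 mg xiP mA) => // z.
  rewrite abs_op ?leq_addr//; case: ifPn => // Az.
  have -> : f z = gmean (q * e) (fun x => 1 - hit1 q r ((- th + z) + r * e + x)).
    rewrite gmeanB ?gmean_cst ?gmean_hit1//; last 2 first.
    - exact: mgrow_cst.
    - by apply: mgrow_shift; exact: mgrow_hit1.
    by rewrite /f ifN.
  apply: gmean_le => //.
  - apply: mgrowB; first exact: mgrow_cst.
    by apply: mgrow_shift; exact: mgrow_hit1.
  - exact: mgrow_shift.
  by move=> x; rewrite -!addrA; exact: fh.
have mono : EA A f k <= EA A f (k + j).
  elim: j => [|j IH]; first by rewrite addn0.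
  by apply: le_trans IH _; rewrite addnS.
have mlt : measurable_fun [set: R] (fun z => th < z) by exact: measurable_fun_ltr.
apply: le_trans (le_trans mono _); last first.
  apply: (abs_le q0 r0 e0 gle0 mg xiP mA) => //; first exact: mgrow_ind.
  move=> z; rewrite /f; case: leP => //= _.
  by rewrite mulr1n lerBlDr lerDl hit1_ge0.
rewrite -(wmean_cst P xi (abs_set A k) (abs_drift r e g k) (kap q r * th) k).
rewrite -(abs_wmean_before P r e g xi A k).
rewrite -(absB q0 r0 e0 gle0 mg xiP mA k k (mgrow_posp q r) (mgrow_cst (kap q r * th))).
apply: (abs_le q0 r0 e0 gle0 mg xiP mA) => //.
  by apply: mgrowB; [exact: mgrow_posp|exact: mgrow_cst].
move=> {mono step} z; rewrite /posp /f; have k0 := kq0.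
case: (leP z th) => zth; case: ifPn => z0.
- have := hit1_subl q0 r0 (lexx 0) z0; rewrite hit1_0 add0r.
  by have := ler_wpM2l (ltW k0) zth; lra.
- by rewrite sub0r oppr_le0 mulr_ge0// ltW.
- have zth0 : 0 <= - th + z by lra.
  by have := hit1_subl q0 r0 zth0 th0; rewrite addrAC addNr add0r; lra.
- by rewrite -ltNge in z0; lra.
Qed.

(** A supermartingale argument run backwards, [j] being the number of steps left. With the barrier
    at [- eta], [1 - hit1] stays nonnegative at overshoots of at most [eta]; [err] pays for larger
    ones through a fourth moment; [hh], contracted at each step, pays for the finite horizon. *)
Lemma stay_nonneg eta m : q * e <= 1 -> 0 < eta ->
  EA (fun z => z < 0) (fun z => (0 <= z)%R%:R) (k + m)
    <= E (posp q r) k + kap q r * eta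
       + m%:R * (48 * expR ((kap q r + 1) ^+ 2 / 2) * (q * e) ^+ 2 / eta ^+ 4)
       + expR (- (kap q r * r / 4) * (m%:R * e)).
Proof.
move=> qe1 eta0; pose A (z : R) := z < 0.
have mA : measurable_fun [set: R] A by exact: measurable_fun_ltr.
set err := _ / eta ^+ 4.
(* [hh] has half the critical exponent. With [k = kap q r], its mean is multiplied by [expR (- k * r
   * e / 2 + k ^+ 2 * q * e / 8)], which is [rho] because [k * q = 2 * r]. *)
pose rho := expR (- (kap q r * r / 4) * e).
pose hh z := expR (- (kap q r / 2) * z).
pose top (j : nat) z := 1 - hit1 q r (eta + z) + j%:R * err + rho ^+ j * hh z.
pose f j z := if z < 0 then 0 else top j z.
have err0 : 0 <= err.
  rewrite /err divr_ge0 ?exprn_even_ge0//.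
  by apply: mulr_ge0; rewrite ?sqr_ge0//; apply: mulr_ge0 => //; exact: expR_ge0.
have rho0 j : 0 <= rho ^+ j by rewrite exprn_ge0// expR_ge0.
have mhh : mgrow hh by exact: mgrow_expR.
have mhe : mgrow (fun z => hit1 q r (eta + z)) by apply: mgrow_shift; exact: mgrow_hit1.
have mtop j : mgrow (top j).
  apply: mgrowD; last exact: mgrowZ.
  apply: mgrowD; last exact: mgrow_cst.
  by apply: mgrowB => //; exact: mgrow_cst.
have mf j : mgrow (f j) by apply: mgrow_if => //; exact: mgrow_cst.
pose over (x : R) := (eta ^+ 4)^-1 * (x ^+ 4 * expR (kap q r * `|x|)).
have mover : mgrow over.
  apply: mgrowZ; apply: mgrowM; last exact: mgrow_expR_norm.
  exact/mgrowX/mgrow_id.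
have over0 x : 0 <= over x.
  rewrite mulr_ge0 ?invr_ge0 ?exprn_even_ge0//.
  by rewrite mulr_ge0 ?expR_ge0 ?exprn_even_ge0.
have k0 := kq0.
have ftop j z x : 0 <= z -> f j (z + r * e + x) <= top j (z + r * e + x) + over x.
  move=> z0; rewrite /f; case: ifPn => [y0|_]; last by rewrite lerDl.
  have [ye|ye] := leP 0 (eta + (z + r * e + x)).
    have h1 := hit1_le1 q0 r0 ye.
    have h2 : 0 <= j%:R * err by rewrite mulr_ge0.
    have h3 : 0 <= rho ^+ j * hh (z + r * e + x) by rewrite mulr_ge0// expR_ge0.
    by have := over0 x; rewrite /top; lra.
  have re0 : 0 < r * e by rewrite mulr_gt0.
  have xe : eta <= `|x| by rewrite ltr0_norm; lra.
  have h1 : hit1 q r (eta + (z + r * e + x)) <= over x.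
    apply: (@le_trans _ _ (expR (kap q r * `|x|))).
      rewrite ler_expR mulNr -mulrN ler_pM2l//.
      by rewrite ltr0_norm; lra.
    rewrite /over mulrA ler_peMl ?expR_ge0//.
    rewrite mulrC ler_pdivlMr ?exprn_gt0// mul1r -[x ^+ 4]ger0_norm ?exprn_even_ge0//.
    by rewrite normrX lerXn2r ?nnegrE// ltW.
  have h2 : 0 <= j%:R * err by rewrite mulr_ge0.
  have h3 : 0 <= rho ^+ j * hh (z + r * e + x) by rewrite mulr_ge0// expR_ge0.
  by rewrite /top; lra.
have gover : gmean (q * e) over <= err.
  rewrite /over gmeanZ//; last first.
    by apply: mgrowM; [exact/mgrowX/mgrow_id|exact: mgrow_expR_norm].
  rewrite mulrC ler_pM2r ?invr_gt0 ?exprn_gt0//.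
  by have [_] := gmean_moment v0 qe1 (ltW k0).
have ghh z : gmean (q * e) (fun x => hh (z + r * e + x)) = rho * hh z.
  rewrite (_ : (fun x => _) = fun x =>
      (hh z * expR (- (kap q r / 2) * (r * e))) * expR (- (kap q r / 2) * x)).
    rewrite gmeanZ; [|exact: v0|exact: mgrow_expR].
    rewrite gmean_expR; last exact: v0.
    rewrite -mulrA mulrC; congr (_ * _).
    by rewrite -expRD; congr expR; rewrite /kap; field; exact: lt0r_neq0.
  by apply/funext => x; rewrite /hh -!expRD -!mulrDr.
have step j i : EA A (f j) (k + i).+1 <= EA A (f j.+1) (k + i).
  apply: (absS_le q0 r0 e0 gle0 mg xiP mA) => // z.
  rewrite abs_op ?leq_addr//; case: ifPn => [Az|]; first by rewrite /f [z < 0]Az.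
  rewrite /A -leNgt => z0.
  apply: (@le_trans _ _ (gmean (q * e) (fun x => top j (z + r * e + x) + over x))).
    apply: gmean_le => //; first exact: mgrow_shift.
    - by apply: mgrowD => //; exact: mgrow_shift.
    - by move=> x; exact: ftop.
  rewrite gmeanD//; last exact: mgrow_shift.
  have -> : gmean (q * e) (fun x => top j (z + r * e + x)) =
      1 - hit1 q r (eta + z) + j%:R * err + rho ^+ j * (rho * hh z).
    have m1 : mgrow (fun x => hit1 q r ((eta + z) + r * e + x)).
      by apply: mgrow_shift; exact: mgrow_hit1.
    rewrite (_ : (fun x => _) = fun x => (1 + j%:R * err - hit1 q r ((eta + z) + r * e + x))
        + rho ^+ j * hh (z + r * e + x)); last first.
      by apply/funext => x; rewrite /top -!addrA; congr (_ + _); rewrite addrCA !addrA.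
    rewrite gmeanD ?gmeanZ ?ghh//; last 3 first.
    - exact: mgrow_shift.
    - by apply: mgrowB => //; exact: mgrow_cst.
    - by apply: mgrowZ; exact: mgrow_shift.
    rewrite gmeanB ?gmean_cst ?gmean_hit1//; last exact: mgrow_cst.
    by ring.
  rewrite /f ltNge z0/= /top exprSr -natr1.
  by have := gover; lra.
have mono j : EA A (f 0) (k + j) <= EA A (f j) k.
  suff H i : EA A (f i) (k + j) <= EA A (f (i + j)%N) k by exact: H 0%N.
  elim: j i => [|j IH] i; first by rewrite !addn0.
  by rewrite addnS; apply: le_trans (step i j) _; rewrite addnS -addSn; exact: IH.
have mge : measurable_fun [set: R] (fun z : R => 0 <= z) by exact: measurable_fun_ler.
apply: le_trans (le_trans (mono m) _).
  apply: (abs_le q0 r0 e0 gle0 mg xiP mA) => //; first exact: mgrow_ind.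
  move=> z; rewrite /f; case: (ltP z 0) => //= z0.
  (* With no step left, [hh z] dominates [hit1 q r (eta + z)], so the total is at least 1. *)
  rewrite /top mul0r addr0 expr0 mul1r -addrA lerDl addrC subr_ge0.
  rewrite /hit1 /hh ler_expR; have := mulr_ge0 (ltW k0) z0; have := mulr_ge0 (ltW k0) (ltW eta0).
  lra.
rewrite -(abs_wmean_before P r e g xi A k).
set c := kap q r * eta; set K1 := m%:R * err; set K2 := expR (_ * _).
rewrite -!addrA -[X in _ <= _ + X](wmean_cst P xi (abs_set A k) (abs_drift r e g k) _ k).
rewrite -(absD q0 r0 e0 gle0 mg xiP mA)//; [|exact: mgrow_posp|exact: mgrow_cst].
apply: (abs_le q0 r0 e0 gle0 mg xiP mA) => //.
  by apply: mgrowD; [exact: mgrow_posp|exact: mgrow_cst].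
move=> z; rewrite /f /posp.
have c0 : 0 <= c by rewrite mulr_ge0// ltW.
have K10 : 0 <= K1 by rewrite mulr_ge0.
have K20 : 0 <= K2 by exact: expR_ge0.
case: (ltP z 0) => z0; first by rewrite !addr_ge0.
have h1 := hit1_subl q0 r0 z0 (ltW eta0); rewrite -/c in h1.
rewrite /top [eta + z]addrC -/K1.
have -> : rho ^+ m = K2.
  by rewrite /rho /K2 -expRM_natl; congr expR; ring.
have h2 : K2 * hh z <= K2.
  rewrite ler_piMr// /hh expR_le1 mulNr oppr_le0 mulr_ge0// divr_ge0//.
  exact: ltW.
by lra.
Qed.

End absorption_probability.

(** * Pathwise comparison *)

Section comparison_drift.
Context {R : realType}.
Variables (r l ell e b : R).
Hypotheses (r0 : 0 < r) (l0 : 0 < l) (rell : r <= ell) (lell : l <= ell).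
Hypotheses (e0 : 0 < e) (b0 : 0 < b) (eb : ell * e <= b).

(* In the band [-b, b] the path may be close to the Brownian path, where only the Lipschitz bound
   [ell] controls its slope; the cut-off [Num.min z b] makes the map monotone. *)
Definition up_drift (z : R) : R :=
  if z < - b then z - l * e else Num.max (z + r * e) (Num.min z b + ell * e).

Let re_le : r * e <= ell * e. Proof. by rewrite ler_pM2r. Qed.
Let le_le : l * e <= ell * e. Proof. by rewrite ler_pM2r. Qed.
Let re0 : 0 < r * e. Proof. exact: mulr_gt0. Qed.
Let le0 : 0 < l * e. Proof. exact: mulr_gt0. Qed.

Let up_driftP z :
  [\/ z < - b /\ up_drift z = z - l * e,
      [/\ - b <= z, z <= b & up_drift z = z + ell * e],
      [/\ b < z, z + r * e <= b + ell * e & up_drift z = b + ell * e]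
    | [/\ b < z, b + ell * e <= z + r * e & up_drift z = z + r * e]].
Proof.
rewrite /up_drift; case: (ltP z (- b)) => zb; first by constructor 1.
case: (leP z b) => bz.
  by constructor 2; split => //; rewrite max_r// lerD2l.
case: (leP (z + r * e) (b + ell * e)) => h; first by constructor 3.
by constructor 4; split => //; exact: ltW.
Qed.

Lemma up_drift_mono z z' : z <= z' -> up_drift z <= up_drift z'.
Proof.
have := re_le; have := le_le; have := re0; have := le0; have := b0.
by case: (up_driftP z) => -[] => [? ->|? ? ->|? ? ->|? ? ->];
  case: (up_driftP z') => -[] => [? ->|? ? ->|? ? ->|? ? ->]; lra.
Qed.

Lemma up_drift_ok : drift_ok r l ell e (2 * b) up_drift.
Proof.
have := re_le; have := le_le; have := re0; have := le0; have := b0; have := eb.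
move=> h1 h2 h3 h4 h5 h6 z.
case: (up_driftP z) => -[] => [? ->|? ? ->|? ? ->|? ? ->]; split; try lra;
  by rewrite ler_norml; apply/andP; split; lra.
Qed.

Lemma measurable_up_drift : measurable_fun [set: R] up_drift.
Proof.
apply: measurable_fun_ifT; first exact: measurable_fun_ltr.
  exact: measurable_funB.
apply: measurable_maxr; first exact: measurable_funD.
by apply: measurable_funD => //; exact: measurable_minr.
Qed.

End comparison_drift.

(** Changing the signs of path and noise exchanges [r] and [l] and turns upper bounds into lower
    ones; the lower chain is the reflected upper chain. *)
Definition dn_drift (R : realType) (r l ell e b z : R) : R :=
  - up_drift l r ell e b (- z).

Section path.
Context {R : realType}.

Lemma derive_const_increment (x : R -> R) (k a c : R) : a <= c -> continuous x ->
  (forall s, a < s < c -> is_derive s 1 x k) -> x c - x a = k * (c - a).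
Proof.
rewrite le_eqVlt => /predU1P[->|ac] cx dx; first by rewrite !subrr mulr0.
have dx' s : s \in `]a, c[%R -> is_derive s 1 x ((fun=> k) s).
  by rewrite in_itv/=; exact: dx.
by have [s _ ->] := MVT ac dx' (continuous_subspaceT cx).
Qed.

Lemma lipschitz_le_continuous (x : R -> R) (ell : R) : 
  (forall s t, `|x s - x t| <= ell * `|s - t|) -> continuous x.
Proof.
move=> lip t; apply/cvgrPdist_le => eps eps0.
have K0 : 0 < `|ell| + 1 by rewrite ltr_wpDl.
near=> s.
apply: le_trans (lip _ _) _.
apply: (@le_trans _ _ ((`|ell| + 1) * `|t - s|)).
  by rewrite ler_wpM2r//; have := ler_norm ell; lra.
rewrite -ler_pdivlMl//; near: s.
by apply: cvgr_dist_le; [exact: cvg_id|rewrite mulr_gt0// invr_gt0].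
Unshelve. all: by end_near. Qed.

Lemma constant_sign (v : R -> R) (a c : R) : a < c -> continuous v ->
  (forall s, a < s <= c -> v s != 0) ->
  (forall s, a < s <= c -> 0 < v s) \/ (forall s, a < s <= c -> v s < 0).
Proof.
move=> ac cv nz.
have cross s : a < s <= c -> ~ (Num.min (v s) (v c) <= 0 <= Num.max (v s) (v c)).
  move=> /andP[as_ sc] h.
  have [u] := IVT sc (continuous_subspaceT cv) h.
  rewrite in_itv/= => /andP[su uc] /eqP; apply/negP; apply: nz.
  by rewrite uc (lt_le_trans as_ su).
have vc : v c != 0 by apply: nz; rewrite ac lexx.
have [v0|v0|/eqP] := ltgtP (v c) 0; last by rewrite (negbTE vc).
- right=> s sac; rewrite ltNge; apply/negP => vs; apply: (cross s sac).
  by rewrite ge_min le_max vs (ltW v0) orbT.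
- left=> s sac; rewrite ltNge; apply/negP => vs; apply: (cross s sac).
  by rewrite ge_min le_max vs (ltW v0) orbT.
Qed.

(** The equation on one path with [r = - beta1], [l = beta2] and an explicit Lipschitz constant:
    [b - x] has drift [r] while positive and [- l] while negative. *)
Definition path_ok (r l ell : R) (b x : R -> R) : Prop :=
  [/\ continuous b, b 0 = 0, x 0 = 0,
      forall s t, `|x s - x t| <= ell * `|s - t|
    & (forall t, x t < b t -> is_derive t 1 x (- r)) /\
      (forall t, b t < x t -> is_derive t 1 x l)].

Lemma path_okN r l ell b x : path_ok r l ell b x ->
  path_ok l r ell (fun t => - b t) (fun t => - x t).
Proof.
move=> [cb b0 x0 lip [d1 d2]]; split.
- by move=> t; apply: cvgN; exact: cb.
- by rewrite b0 oppr0.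
- by rewrite x0 oppr0.
- by move=> s t; rewrite -opprD normrN; exact: lip.
split=> t; rewrite ltrN2 => h.
  exact: (is_deriveN (d2 t h)).
by have := is_deriveN (d1 t h); rewrite opprK.
Qed.

Definition small_osc (b : R -> R) (e eta : R) (n : nat) : Prop :=
  forall i s, (i < n)%N -> i%:R * e <= s <= i.+1%:R * e ->
    `|b s - b (i%:R * e)| <= eta.

Lemma small_oscN b e eta n : small_osc b e eta n -> small_osc (fun t => - b t) e eta n.
Proof. by move=> H i s ni sie; rewrite -opprD normrN; exact: H. Qed.

Variables (r l ell e eta : R) (b x : R -> R) (n : nat).
Hypotheses (r0 : 0 < r) (l0 : 0 < l) (rell : r <= ell) (lell : l <= ell).
Hypotheses (e0 : 0 < e) (eta0 : 0 < eta) (e_eta : ell * e <= eta / 4).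
Hypothesis ok : path_ok r l ell b x.
Hypothesis osc : small_osc b e (eta / 4) n.

Let V t := b t - x t.
Let xi i := b (i.+1%:R * e) - b (i%:R * e).

Let cx : continuous x.
Proof. by have [_ _ _ lip _] := ok; exact: lipschitz_le_continuous lip. Qed.

Let cV : continuous V.
Proof. by have [cb _ _ _ _] := ok; move=> t; apply: cvgB; [exact: cb|exact: cx]. Qed.

Let cell_le i : i%:R * e <= i.+1%:R * e.
Proof. by rewrite ler_pM2r// ler_nat. Qed.

Let cell_len i : i.+1%:R * e - i%:R * e = e.
Proof. by rewrite -natr1; ring. Qed.

Lemma cell_any i : `|V (i.+1%:R * e) - V (i%:R * e) - xi i| <= ell * e.
Proof.
have [_ _ _ lip _] := ok; have := lip (i.+1%:R * e) (i%:R * e).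
rewrite cell_len (gtr0_norm e0).
rewrite (_ : V _ - _ - _ = - (x (i.+1%:R * e) - x (i%:R * e))) ?normrN//.
by rewrite /V /xi; ring.
Qed.

Lemma cell_positive i :
  (forall s, i%:R * e < s < i.+1%:R * e -> 0 < V s) ->
  V (i.+1%:R * e) = V (i%:R * e) + (r * e + xi i).
Proof.
move=> Vpos; have [_ _ _ _ [d1 _]] := ok.
have := derive_const_increment (cell_le i) cx (k := - r) _.
rewrite cell_len => /(_ _)/eqP; rewrite subr_eq => H.
rewrite /V /xi; have /eqP -> : x (i.+1%:R * e) == - r * e + x (i%:R * e).
  by apply: H => s /Vpos; rewrite subr_gt0; exact: d1.
by ring.
Qed.

(** Within a cell the noise and the path each move by at most [eta / 4], so the gap keeps half of
    [eta]. *)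
Lemma cell_right i s : (i < n)%N -> eta <= V (i%:R * e) ->
  i%:R * e <= s <= i.+1%:R * e -> 0 < V s.
Proof.
move=> ni Vi si; have [_ _ _ lip _] := ok.
have := osc ni si; have := lip (i%:R * e) s.
have : `|i%:R * e - s| <= e.
  case/andP: si => s1 s2; rewrite ler_norml; have := cell_len i; have := e0.
  by move=> h1 h2; apply/andP; split; lra.
move=> h1 h2; have ell0 : 0 <= ell by apply: le_trans rell; exact: ltW.
have h3 := le_trans h2 (ler_wpM2l ell0 h1).
rewrite ler_norml => /andP[h4 h5]; move: h3; rewrite ler_norml => /andP[h6 h7].
by rewrite /V in Vi *; have := e_eta; have := eta0; lra.
Qed.

Lemma cell_right_step i : (i < n)%N -> eta <= V (i%:R * e) ->
  V (i.+1%:R * e) = V (i%:R * e) + (r * e + xi i).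
Proof.
move=> ni Vi; apply: cell_positive => s /andP[s1 s2].
by apply: cell_right ni Vi _; rewrite !ltW.
Qed.

(** A grid value above [eta] makes the next cell free of zeros; there the gap moves exactly by drift
    plus noise, hence keeps its initial lead over the walk started from [z]. *)
Lemma stay_positive (z : R) k m : (k + m <= n)%N -> z <= V (k%:R * e) ->
  (forall j, (j <= m)%N -> eta < z + \sum_(k <= i < k + j) (r * e + xi i)) ->
  forall s, k%:R * e <= s <= (k + m)%:R * e -> 0 < V s.
Proof.
move=> kmn zV H.
suff : (forall s, k%:R * e <= s <= (k + m)%:R * e -> 0 < V s) /\
    z + \sum_(k <= i < k + m) (r * e + xi i) <= V ((k + m)%:R * e) by case.
elim: m kmn H => [|m IH] kmn H.
  rewrite addn0 big_geq// addr0; split=> // s; rewrite -eq_le => /eqP <-.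
  apply: lt_le_trans zV; have := H 0%N (leqnn _).
  by rewrite addn0 big_geq// addr0; apply: lt_trans; exact: eta0.
rewrite addnS in kmn *.
have [j jm|IH1 IH2] := IH (ltnW kmn); first exact/H/leqW.
have Vkm : eta <= V ((k + m)%:R * e) by apply: le_trans IH2; apply/ltW/H/leqnSn.
split.
  move=> s /andP[s1 s2]; have [skm|/ltW skm] := leP s ((k + m)%:R * e).
    by apply: IH1; rewrite s1.
  by apply: cell_right Vkm _ => //; rewrite skm.
rewrite big_nat_recr/= ?leq_addr// addrA cell_right_step//.
by rewrite lerD2r.
Qed.

Lemma no_zero_positive (z : R) k m : (0 < m)%N -> V (k%:R * e) <= z ->
  (forall s, k%:R * e < s <= (k + m)%:R * e -> 0 < V s) ->
  forall j, (j <= m)%N -> 0 <= z + \sum_(k <= i < k + j) (r * e + xi i).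
Proof.
move=> m0 zV Vpos.
(* The interval is open on the left: the sign at [k * e] comes from the intermediate value
   theorem. *)
have Vk0 : 0 <= V (k%:R * e).
  rewrite leNgt; apply/negP => Vk.
  have kc : k%:R * e < (k + m)%:R * e.
    by rewrite ltr_pM2r// ltr_nat -[X in (X < _)%N]addn0 ltn_add2l.
  have Vc : 0 < V ((k + m)%:R * e) by apply: Vpos; rewrite kc lexx.
  have V0 : Num.min (V (k%:R * e)) (V ((k + m)%:R * e)) <= 0
      <= Num.max (V (k%:R * e)) (V ((k + m)%:R * e)).
    by rewrite ge_min le_max (ltW Vk) (ltW Vc) orbT.
  have [u] := IVT (ltW kc) (continuous_subspaceT cV) V0.
  rewrite in_itv/= le_eqVlt => /andP[/orP[/eqP <-|ku] uc] Vu.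
    by rewrite Vu ltxx in Vk.
  by have := Vpos u; rewrite ku uc Vu ltxx => /(_ isT).
suff H j : (j <= m)%N -> V ((k + j)%:R * e) = V (k%:R * e) + \sum_(k <= i < k + j) (r * e + xi i).
  move=> j jm; apply: (@le_trans _ _ (V ((k + j)%:R * e))).
    case: j jm => [|j] jm; first by rewrite addn0.
    apply/ltW/Vpos; rewrite ltr_pM2r// ler_pM2r// ltr_nat ler_nat leq_add2l jm andbT.
    by rewrite addnS ltnS leq_addr.
  by rewrite H// lerD2r.
elim: j => [|j IH] jm; first by rewrite addn0 big_geq// addr0.
rewrite addnS big_nat_recr/= ?leq_addr// addrA -IH ?(ltnW jm)//.
apply: cell_positive => s /andP[s1 s2]; apply: Vpos; apply/andP; split.
  by apply: le_lt_trans s1; rewrite ler_pM2r// ler_nat leq_addr.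
apply: le_trans (ltW s2) _; rewrite ler_pM2r// ler_nat.
by rewrite -addnS leq_add2l.
Qed.

End path.

Section comparison.
Context {R : realType}.
Variables (r l ell e eta : R) (b x : R -> R) (n : nat).
Hypotheses (r0 : 0 < r) (l0 : 0 < l) (rell : r <= ell) (lell : l <= ell).
Hypotheses (e0 : 0 < e) (eta0 : 0 < eta) (e_eta : ell * e <= eta / 4).
Hypothesis ok : path_ok r l ell b x.
Hypothesis osc : small_osc b e (eta / 4) n.

(** As [up_drift] is monotone, one step from the gap itself suffices: beyond [eta] on either side
    the drift over the cell is exact, and in between the Lipschitz bound [ell * e] is the second
    term of the maximum. *)
Lemma path_le_up (z : nat -> R) : z 0%N = 0 ->
  (forall i, z i.+1 = up_drift r l ell e eta (z i) +
     (b (i.+1%:R * e) - b (i%:R * e))) ->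
  forall i, (i <= n)%N -> b (i%:R * e) - x (i%:R * e) <= z i.
Proof.
move=> z0 zS; elim=> [|i IH] ni.
  by have [_ b0 x0 _ _] := ok; rewrite mul0r b0 x0 subrr z0.
have {IH} Vz := IH (ltnW ni); rewrite zS; set V := _ - _ in Vz; set V' := _ - x _.
apply: le_trans (_ : up_drift r l ell e eta V + (b (i.+1%:R * e) - b (i%:R * e)) <= _); last first.
  by rewrite lerD2r; exact: up_drift_mono.
rewrite /up_drift; case: ltP => Ve.
  have := cell_right_step l0 lell e0 eta0 e_eta (path_okN ok) (small_oscN osc) (i := i) ni.
  have h : eta <= - b (i%:R * e) - - x (i%:R * e) by rewrite /V in Ve; lra.
  by move=> /(_ h); rewrite /V /V'; lra.
have [eV|Ve'] := leP eta V.
  have := cell_right_step r0 rell e0 eta0 e_eta ok osc ni eV.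
  rewrite -/V' -/V => ->; rewrite addrA lerD2r le_max; apply/orP; left.
  exact: lexx.
have := cell_any e0 ok i; rewrite -/V -/V' ler_norml => /andP[_ h].
rewrite -lerBlDr le_max; apply/orP; right.
by lra.
Qed.

End comparison.

(** * Events that bracket the zeros *)

Section potential_bounds.
Context {R : realType}.
Variables (q r l : R).
Hypotheses (q0 : 0 < q) (r0 : 0 < r) (l0 : 0 < l).

Lemma hitpE z : hitp q r l z = 1 - posp q r z - posp q l (- z).
Proof.
rewrite /hitp /glue /posp oppr_ge0; case: (ltgtP z 0) => z0 /=; try lra.
by rewrite z0 oppr0 !hit1_0; lra.
Qed.

Lemma hitp_ge0 z : 0 <= hitp q r l z.
Proof. by rewrite /hitp /glue; case: ifP => _; exact: hit1_ge0. Qed.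

Lemma mgrow_hitp : mgrow (hitp q r l).
Proof. by apply: mgrow_glue; exact: mgrow_hit1. Qed.

Lemma mgrow_pot : mgrow (pot q r l).
Proof. by apply: mgrow_glue; exact: mgrow_pot1. Qed.

Lemma mgrow_scale : mgrow (scale q r l).
Proof. by apply: mgrow_glue; [exact: mgrow_scale1|apply: mgrowN; exact: mgrow_scale1]. Qed.

(** [posp q r] is a multiple of [scale] plus a decreasing function. The chains are ordered and
    [scale] has mean near 0 on both, so the means of [posp q r] on them differ by little in the
    direction that matters ([gap_posr]). *)
Lemma posp_scale z : posp q r z =
  kap q r * scale q r l z + kap q r / kap q l * posp q l (- z).
Proof.
have kr0 := kap_gt0 q0 r0; have kl0 := kap_gt0 q0 l0.
rewrite /scale /glue /posp /scale1 oppr_ge0; case: (ltgtP z 0) => z0 /=.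
- by field; rewrite !lt0r_neq0.
- by rewrite mulr0 addr0; field; rewrite lt0r_neq0.
- by rewrite z0 oppr0 !hit1_0 !subrr mul0r !mulr0 addr0.
Qed.

Lemma posp_scaleN z : posp q l (- z) =
  - kap q l * scale q r l z + kap q l / kap q r * posp q r z.
Proof.
have kr0 := kap_gt0 q0 r0; have kl0 := kap_gt0 q0 l0.
rewrite /scale /glue /posp /scale1 oppr_ge0; case: (ltgtP z 0) => z0 /=.
- by rewrite mulr0 addr0; field; rewrite lt0r_neq0.
- by field; rewrite !lt0r_neq0.
- by rewrite z0 oppr0 !hit1_0 !subrr mul0r !mulr0 addr0.
Qed.

Lemma posp_mono z z' : z <= z' -> posp q r z <= posp q r z'.
Proof.
move=> zz'; rewrite /posp; case: ifPn => z0.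
  by rewrite (le_trans z0 zz') lerD2l lerN2 ler_expR !mulNr lerN2 ler_wpM2l// ltW// kap_gt0.
by case: ifPn => // z'0; rewrite subr_ge0 hit1_le1.
Qed.

Let pot1_ge0 r' y : 0 < r' -> 0 <= y -> 0 <= pot1 q r' (pot0 q r l) y.
Proof.
move=> r'0 y0; apply: mulr_ge0; last exact: hit1_ge0.
apply: addr_ge0; first exact/ltW/pot0_gt0.
by apply: divr_ge0 => //; exact: ltW.
Qed.

Lemma pot_ge0 z : 0 <= pot q r l z.
Proof.
rewrite /pot /glue; case: ifPn => [z0|]; first exact: pot1_ge0.
by rewrite -ltNge => z0; apply: pot1_ge0 => //; rewrite oppr_ge0 ltW.
Qed.

(** The ratio of [pot1] to [hit1] grows linearly, hence the [eps]. One factor [S], the square root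
    of [hit1], absorbs the affine term into [D]; then [D * S <= eps + D ^+ 2 / (4 * eps) * S ^+
    2]. *)
Let pot1_le r' eps : 0 < r' -> 0 < eps -> exists2 M : R, 0 <= M &
  forall y, 0 <= y -> pot1 q r' (pot0 q r l) y <= eps + M * hit1 q r' y.
Proof.
move=> r'0 eps0; have A0 := pot0_gt0 q0 r0 l0.
have k0 := kap_gt0 q0 r'0; set k := kap q r' in k0 *.
pose D := pot0 q r l + 2 / (k * r').
have D0 : 0 <= D.
  apply: addr_ge0; first exact: ltW.
  by apply: divr_ge0 => //; apply: mulr_ge0; exact: ltW.
exists (D ^+ 2 / (4 * eps)).
  by rewrite divr_ge0 ?sqr_ge0// mulr_ge0// ltW.
move=> y y0; set S := expR (- (k / 2) * y).
have S0 : 0 < S by exact: expR_gt0.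
have hS : hit1 q r' y = S ^+ 2.
  by rewrite /hit1 -/k expr2 -expRD; congr expR; field.
rewrite /pot1 hS expr2 mulrA.
have S1 : S <= 1 by rewrite expR_le1 mulNr oppr_le0 mulr_ge0// divr_ge0// ltW.
have yS : (pot0 q r l + y / r') * S <= D.
  rewrite mulrDl; apply: lerD; first by rewrite ler_piMr// ltW.
  have e1 : expR (k / 2 * y) * S = 1.
    by rewrite /S -expRD (_ : _ + _ = 0) ?expR0//; ring.
  have := ler_wpM2r (ltW S0) (ler_id_expR (k / 2 * y)); rewrite e1.
  move=> h; rewrite (_ : y / r' * S = 2 / (k * r') * (k / 2 * y * S)); last first.
    by field; rewrite !lt0r_neq0.
  by rewrite ler_piMr// divr_ge0// mulr_ge0// ltW.
apply: le_trans (ler_wpM2r (ltW S0) yS) _.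
have : 0 <= (2 * eps - D * S) ^+ 2 / (4 * eps).
  by rewrite divr_ge0 ?sqr_ge0// mulr_ge0// ltW.
rewrite (_ : _ / _ = eps - D * S + D ^+ 2 / (4 * eps) * (S * S)); first lra.
by field; exact: lt0r_neq0.
Qed.

Lemma pot_le_hitp eps : 0 < eps -> exists2 M : R, 0 <= M &
  forall z, pot q r l z <= eps + M * hitp q r l z.
Proof.
move=> eps0.
have [M1 M10 H1] := pot1_le r0 eps0; have [M2 M20 H2] := pot1_le l0 eps0.
exists (M1 + M2); first exact: addr_ge0.
move=> z; rewrite /pot /hitp /glue; case: ifPn => [z0|].
  apply: le_trans (H1 z z0) _; rewrite lerD2l ler_wpM2r ?hit1_ge0//.
  by rewrite lerDl.
rewrite -ltNge => z0; have Nz0 : 0 <= - z by rewrite oppr_ge0 ltW.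
apply: le_trans (H2 _ Nz0) _; rewrite lerD2l ler_wpM2r ?hit1_ge0//.
by rewrite lerDr.
Qed.

End potential_bounds.

Lemma drift_okN (R : realType) (r l ell e b : R) g : drift_ok r l ell e b g ->
  drift_ok l r ell e b (fun z => - g (- z)).
Proof.
move=> gok z; have [h1 h2 h3] := gok (- z); split.
- by rewrite (_ : _ - z = - (g (- z) - - z)) ?normrN//; ring.
- by move=> bz; rewrite h3 ?lerN2//; ring.
- by move=> zb; rewrite h2; [ring|rewrite lerNr].
Qed.

Lemma up_dn_le (R : realType) (r l ell e b z : R) : 0 < r -> 0 < l -> r <= ell -> l <= ell ->
  0 < e -> 0 < b -> dn_drift r l ell e b z <= up_drift r l ell e b z.
Proof.
move=> r0 l0 rl ll e0 b0.
have re0 : 0 < r * e by rewrite mulr_gt0.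
have le0 : 0 < l * e by rewrite mulr_gt0.
have rle : r * e <= ell * e by rewrite ler_pM2r.
have lle : l * e <= ell * e by rewrite ler_pM2r.
have m1 : z + r * e <= Num.max (z + r * e) (Num.min z b + ell * e).
  by rewrite le_max lexx.
have m2 : - z + l * e <= Num.max (- z + l * e) (Num.min (- z) b + ell * e).
  by rewrite le_max lexx.
rewrite /dn_drift /up_drift.
by case: (ltP z (- b)) => ?; case: (ltP (- z) (- b)) => ?; lra.
Qed.

Section walk_comparison.
Context {d : measure_display} {T : measurableType d} {R : realType}.
Variables (P : probability T R).

Lemma walk_mono (g g' : R -> R) (xi : nat -> T -> R) k w :
  (forall z z', z <= z' -> g z <= g' z') ->
  walk (fun _ _ => false) (fun=> g) xi k w <= walk (fun _ _ => false) (fun=> g') xi k w.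
Proof. by move=> gg'; elim: k => //= k IH; rewrite lerD2r gg'. Qed.

Lemma walkN (g : R -> R) (xi : nat -> T -> R) k w :
  walk (fun _ _ => false) (fun=> fun z => - g (- z)) (fun i w => - xi i w) k w =
  - walk (fun _ _ => false) (fun=> g) xi k w.
Proof. by elim: k => [|k /= ->]; rewrite /= ?oppr0// opprK opprD. Qed.

Lemma wmeanN (g : R -> R) (xi : nat -> T -> R) f k :
  wmean P (fun i w => - xi i w) (fun _ _ => false) (fun=> fun z => - g (- z)) f k =
  wmean P xi (fun _ _ => false) (fun=> g) (fun z => f (- z)) k.
Proof. by congr fine; apply: eq_integral => w _; rewrite walkN. Qed.

Lemma iid_gaussN v (xi : nat -> T -> R) : 0 < v -> iid_gauss P v xi ->
  iid_gauss P v (fun i w => - xi i w).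
Proof.
move=> v0 [mxi lxi ixi].
have mN (A : set R) : measurable A -> measurable (-%R @^-1` A).
  by move=> mA; rewrite -[X in measurable X]setTI; apply: (@oppr_measurable R setT).
split.
- by move=> i; exact: measurableT_comp.
- move=> i A mA.
  by rewrite -(gaussN v0 mA) -(lxi i _ (mN A mA)).
- move=> n A mA.
  exact: (ixi n (fun i => -%R @^-1` A i) (fun i => mN _ (mA i))).
Qed.

End walk_comparison.

(** [eta] is the threshold of the events and [2 * eta] the parameter [b] of the estimates; [e] is
    small against [eta ^+ 2] for the occupation bound and against [eta / ell] for the pathwise
    comparison. *)
Definition fine_mesh (R : realType) (q ell e eta : R) : Prop :=
  [/\ 0 < e /\ e <= 1, q * e <= 1, 0 < eta /\ 2 * eta <= 1,
      q * e * (48 * expR (2 ^+ 2 / 2)) <= (2 * eta) ^+ 2 / 2 & ell * e <= eta / 4].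

Section events.
Context {d : measure_display} {T : measurableType d} {R : realType}.
Variables (P : probability T R).

(* With [b - x] started at time [k] from the lower (resp. upper) comparison chain and drifting to
   the right: it has not come down to [eta] (resp. below [0]) by time [k + m]. *)
Definition above_event (r l ell e eta : R) (xi : nat -> T -> R) (k m : nat) : set T :=
  [set w | eta < abs_walk r e (dn_drift r l ell e eta) xi (fun z => z <= eta) k (k + m) w].

Definition nonneg_event (r l ell e eta : R) (xi : nat -> T -> R) (k m : nat) : set T :=
  [set w | 0 <= abs_walk r e (up_drift r l ell e eta) xi (fun z => z < 0) k (k + m) w].

Section one_side.
Variables (q r l ell e eta : R) (xi : nat -> T -> R).
Hypotheses (q0 : 0 < q) (r0 : 0 < r) (l0 : 0 < l) (rell : r <= ell) (lell : l <= ell).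
Hypothesis mesh : fine_mesh q ell e eta.
Hypothesis xiP : iid_gauss P (q * e) xi.

Let e0 : 0 < e. Proof. by case: mesh => -[]. Qed.
Let eta0 : 0 < eta. Proof. by case: mesh => _ _ []. Qed.
Let e_eta : ell * e <= eta.
Proof. by case: mesh => _ _ [+ _] _ => h1 h2; lra. Qed.

Lemma up_ok : drift_ok r l ell e (2 * eta) (up_drift r l ell e eta).
Proof. exact: up_drift_ok. Qed.

Lemma dn_ok : drift_ok r l ell e (2 * eta) (dn_drift r l ell e eta).
Proof. by apply: drift_okN; exact: up_drift_ok. Qed.

Lemma measurable_dn : measurable_fun [set: R] (dn_drift r l ell e eta).
Proof.
apply: measurableT_comp; first exact: oppr_measurable.
by apply: measurableT_comp; [exact: measurable_up_drift|exact: oppr_measurable].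
Qed.

Lemma drift_ok_le g b : drift_ok r l ell e b g -> forall z, `|g z| <= `|z| + ell * e.
Proof.
move=> gok z; have [gz _ _] := gok z; rewrite -[g z](subrK z).
by apply: le_trans (ler_normD _ _) _; rewrite addrC lerD2l.
Qed.

Notation Eup := (wmean P xi (fun _ _ => false) (fun=> up_drift r l ell e eta)).
Notation Edn := (wmean P xi (fun _ _ => false) (fun=> dn_drift r l ell e eta)).

Let measurable_abs g A k j : measurable_fun [set: R] g -> measurable_fun [set: R] A ->
  measurable_fun [set: T] (abs_walk r e g xi A k j).
Proof.
move=> mg mA; apply: (measurable_walk xiP) => i.
  by rewrite /abs_set; case: (k <= i)%N => //=; exact: measurable_cst.
by rewrite /abs_drift; case: (i < k)%N => //; exact: measurable_funD.
Qed.

Lemma measurable_above k m : measurable (above_event r l ell e eta xi k m).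
Proof.
have mA : measurable_fun [set: R] (fun z : R => z <= eta) by exact: measurable_fun_ler.
have := measurable_abs k (k + m) measurable_dn mA.
move=> /(_ measurableT _ (measurable_itv `]eta, +oo[)); rewrite setTI.
by congr measurable; apply/seteqP; split => w /=; rewrite in_itv/= andbT.
Qed.

Lemma measurable_nonneg k m : measurable (nonneg_event r l ell e eta xi k m).
Proof.
have mA : measurable_fun [set: R] (fun z : R => z < 0) by exact: measurable_fun_ltr.
have := measurable_abs k (k + m) (measurable_up_drift r l ell e eta) mA.
move=> /(_ measurableT _ (measurable_itv `[0, +oo[)); rewrite setTI.
by congr measurable; apply/seteqP; split => w /=; rewrite in_itv/= andbT.
Qed.

Lemma above_ge k m :
  ((Edn (posp q r) k - kap q r * eta)%:E <= P (above_event r l ell e eta xi k m))%E.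
Proof.
have mA : measurable_fun [set: R] (fun z : R => z <= eta) by exact: measurable_fun_ler.
have mB : measurable_fun [set: R] (fun z : R => eta < z) by exact: measurable_fun_ltr.
have gle := drift_ok_le dn_ok.
rewrite -[X in (_ <= P X)%E]setIT -integral_indic//; last exact: measurable_above.
have := abs_EFin q0 r0 e0 gle measurable_dn xiP mA k (k + m) (mgrow_ind mB).
set I := (\int[P]_w _)%E => EI.
rewrite (_ : (\int[P]_w _)%E = I); last first.
  apply: eq_integral => w _; rewrite indicE; congr ((nat_of_bool _)%:R%:E).
  by apply/idP/idP; rewrite inE.
rewrite EI lee_fin.
exact: (stay_above q0 r0 e0 gle measurable_dn xiP k m (ltW eta0)).
Qed.

Lemma nonneg_le k m :
  (P (nonneg_event r l ell e eta xi k m) <=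
   (Eup (posp q r) k + kap q r * eta
       + m%:R * (48 * expR ((kap q r + 1) ^+ 2 / 2) * (q * e) ^+ 2 / eta ^+ 4)
       + expR (- (kap q r * r / 4) * (m%:R * e)))%:E)%E.
Proof.
have mA : measurable_fun [set: R] (fun z : R => z < 0) by exact: measurable_fun_ltr.
have mB : measurable_fun [set: R] (fun z : R => 0 <= z) by exact: measurable_fun_ler.
have gle := drift_ok_le up_ok.
have mg := measurable_up_drift r l ell e eta.
rewrite -[X in (P X <= _)%E]setIT -integral_indic//; last exact: measurable_nonneg.
have := abs_EFin q0 r0 e0 gle mg xiP mA k (k + m) (mgrow_ind mB).
set I := (\int[P]_w _)%E => EI.
rewrite (_ : (\int[P]_w _)%E = I); last first.
  apply: eq_integral => w _; rewrite indicE; congr ((nat_of_bool _)%:R%:E).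
  by apply/idP/idP; rewrite inE.
rewrite EI lee_fin; have [_ qe1 _ _ _] := mesh.
exact: (stay_nonneg q0 r0 e0 gle mg xiP k m qe1 eta0).
Qed.

Let walk_dn_up k w : walk (fun _ _ => false) (fun=> dn_drift r l ell e eta) xi k w <=
  walk (fun _ _ => false) (fun=> up_drift r l ell e eta) xi k w.
Proof.
apply: walk_mono => z z' zz'.
by apply: le_trans (up_dn_le z r0 l0 rell lell e0 eta0) _; exact: up_drift_mono.
Qed.

Let v0 : 0 < q * e. Proof. exact: mulr_gt0. Qed.
Let ma (i : nat) : measurable_fun [set: R] (fun _ : R => false).
Proof. exact: measurable_cst. Qed.

Lemma wmean_dn_up f k : mgrow f -> (forall z z', z <= z' -> f z <= f z') ->
  Edn f k <= Eup f k.
Proof.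
move=> mf fmono; apply: le_Rintegral => //.
- exact: (integrable_walk v0 xiP ma (fun=> measurable_dn) (fun=> drift_ok_le dn_ok)).
- exact: (integrable_walk v0 xiP ma (fun=> measurable_up_drift r l ell e eta)
    (fun=> drift_ok_le up_ok)).
by move=> w _; apply: fmono; exact: walk_dn_up.
Qed.

Lemma wmean_up_dn f k : mgrow f -> (forall z z', z <= z' -> f z' <= f z) ->
  Eup f k <= Edn f k.
Proof.
move=> mf fmono; apply: le_Rintegral => //.
- exact: (integrable_walk v0 xiP ma (fun=> measurable_up_drift r l ell e eta)
    (fun=> drift_ok_le up_ok)).
- exact: (integrable_walk v0 xiP ma (fun=> measurable_dn) (fun=> drift_ok_le dn_ok)).
by move=> w _; apply: fmono; exact: walk_dn_up.
Qed.

Lemma above_event_start k m w : above_event r l ell e eta xi k m w ->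
  eta < walk (fun _ _ => false) (fun=> dn_drift r l ell e eta) xi k w.
Proof.
rewrite /above_event/= ltNge => Sw.
have [_ /(_ 0%N (leq0n m))] := abs_walk_after (A := fun z : R => z <= eta) Sw.
by rewrite addn0 abs_walk_before// -ltNge.
Qed.

End one_side.
Section two_sides.
Variables (q r l ell e eta : R) (xi : nat -> T -> R).
Hypotheses (q0 : 0 < q) (r0 : 0 < r) (l0 : 0 < l) (rell : r <= ell) (lell : l <= ell).
Hypothesis mesh : fine_mesh q ell e eta.
Hypothesis xiP : iid_gauss P (q * e) xi.

Notation Eup := (wmean P xi (fun _ _ => false) (fun=> up_drift r l ell e eta)).
Notation Edn := (wmean P xi (fun _ _ => false) (fun=> dn_drift r l ell e eta)).
Notation xiN := (fun i w => - xi i w).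

Let e0 : 0 < e. Proof. by case: mesh => -[]. Qed.
Let eta0 : 0 < eta. Proof. by case: mesh => _ _ []. Qed.
Let v0 : 0 < q * e. Proof. exact: mulr_gt0. Qed.

(* A zero of [b - x] in [[k e, (k + m) e]] forces [maybe_zero k m], and [surely_zero k m] forces one.
   Both events are measurable, being defined from the noise alone. *)
Definition maybe_zero k m : set T :=
  ~` (above_event r l ell e eta xi k m `|` above_event l r ell e eta xiN k m).

Definition surely_zero k m : set T :=
  ~` (nonneg_event r l ell e eta xi k m `|` nonneg_event l r ell e eta xiN k m).

Let xiNP : iid_gauss P (q * e) xiN. Proof. exact: iid_gaussN. Qed.

Lemma measurable_maybe_zero k m : measurable (maybe_zero k m).
Proof.
apply: measurableC; apply: measurableU; first exact: measurable_above xiP k m.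
exact: measurable_above xiNP k m.
Qed.

Lemma measurable_surely_zero k m : measurable (surely_zero k m).
Proof.
apply: measurableC; apply: measurableU; first exact: measurable_nonneg xiP k m.
exact: measurable_nonneg xiNP k m.
Qed.

Let EdnN f k : wmean P xiN (fun _ _ => false) (fun=> dn_drift l r ell e eta) f k =
  Eup (fun z => f (- z)) k.
Proof. exact: wmeanN. Qed.

Let EupN f k : wmean P xiN (fun _ _ => false) (fun=> up_drift l r ell e eta) f k =
  Edn (fun z => f (- z)) k.
Proof.
have -> : up_drift l r ell e eta = fun z => - dn_drift r l ell e eta (- z).
  by apply/funext => z; rewrite /dn_drift !opprK.
exact: wmeanN.
Qed.

Let ma (i : nat) : measurable_fun [set: R] (fun _ : R => false).
Proof. exact: measurable_cst. Qed.

Let gup := drift_ok_le (up_ok r0 l0 rell lell mesh).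
Let gdn := drift_ok_le (dn_ok r0 l0 rell lell mesh).
Let mup := measurable_up_drift r l ell e eta.
Let mdn := measurable_dn r l ell e eta.

Let mpr : mgrow (posp q r). Proof. exact: mgrow_posp. Qed.
Let mpl : mgrow (fun z => posp q l (- z)). Proof. by apply: mgrow_opp; exact: mgrow_posp. Qed.
Let ms : mgrow (scale q r l). Proof. exact: mgrow_scale. Qed.

Let Eup_lin f h c c' k : mgrow f -> mgrow h ->
  Eup (fun z => c * f z + c' * h z) k = c * Eup f k + c' * Eup h k.
Proof.
move=> mf mh.
rewrite (wmeanD v0 xiP ma (fun=> mup) (fun=> gup) k (mgrowZ c mf) (mgrowZ c' mh)).
by rewrite !(wmeanZ v0 xiP ma (fun=> mup) (fun=> gup)).
Qed.

Let Edn_lin f h c c' k : mgrow f -> mgrow h ->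
  Edn (fun z => c * f z + c' * h z) k = c * Edn f k + c' * Edn h k.
Proof.
move=> mf mh.
rewrite (wmeanD v0 xiP ma (fun=> mdn) (fun=> gdn) k (mgrowZ c mf) (mgrowZ c' mh)).
by rewrite !(wmeanZ v0 xiP ma (fun=> mdn) (fun=> gdn)).
Qed.

Let compl_arith (x y : R) : 1 * (1 - x) + -1 * y = 1 - x - y.
Proof. by ring. Qed.

Let gap_arith (c c' u u' v v' : R) : 0 <= c' -> v <= v' ->
  c * u + c' * v - (c * u' + c' * v') <= c * (u - u').
Proof. by move=> c0 /(ler_wpM2l c0); lra. Qed.

Let gap_arithN (c c' u u' v v' : R) : 0 <= c' -> v' <= v ->
  - c * u' + c' * v' - (- c * u + c' * v) <= c * (u - u').
Proof. by move=> c0 /(ler_wpM2l c0); lra. Qed.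

Let Eup_hitp k : Eup (hitp q r l) k =
  1 - Eup (posp q r) k - Eup (fun z => posp q l (- z)) k.
Proof.
rewrite (_ : hitp q r l = fun z => 1 * (1 - posp q r z) + -1 * posp q l (- z)).
  rewrite Eup_lin//; last by apply: mgrowB => //; exact: mgrow_cst.
  rewrite (wmeanB v0 xiP ma (fun=> mup) (fun=> gup) k (mgrow_cst 1) mpr) wmean_cst.
  exact: compl_arith.
by apply/funext => z; rewrite hitpE//; ring.
Qed.

Let gap_posr k : Eup (posp q r) k - Edn (posp q r) k <=
  kap q r * (Eup (scale q r l) k - Edn (scale q r l) k).
Proof.
have kr0 := kap_gt0 q0 r0; have kl0 := kap_gt0 q0 l0.
have E1 : posp q r = fun z => kap q r * scale q r l z + kap q r / kap q l * posp q l (- z).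
  by apply/funext => z; exact: posp_scale.
rewrite E1 Eup_lin// Edn_lin//.
apply: gap_arith; first by apply: divr_ge0; exact: ltW.
apply: (wmean_up_dn q0 r0 l0 rell lell mesh xiP) => // z z' zz'.
by apply: posp_mono => //; rewrite lerN2.
Qed.

Let gap_posl k : Edn (fun z => posp q l (- z)) k - Eup (fun z => posp q l (- z)) k <=
  kap q l * (Eup (scale q r l) k - Edn (scale q r l) k).
Proof.
have kr0 := kap_gt0 q0 r0; have kl0 := kap_gt0 q0 l0.
have E1 : (fun z => posp q l (- z)) =
    fun z => - kap q l * scale q r l z + kap q l / kap q r * posp q r z.
  by apply/funext => z; exact: posp_scaleN.
rewrite E1 Eup_lin// Edn_lin//.
apply: gap_arithN; first by apply: divr_ge0; exact: ltW.
exact: (wmean_dn_up q0 r0 l0 rell lell mesh xiP k mpr (posp_mono q0 r0)).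
Qed.

Let maybe_arith (h a b b' g p p' c c' eta' : R) : h = 1 - a - b -> a - b' <= g ->
  b' - c * eta' <= p -> b - c' * eta' <= p' -> 1 - (p + p') <= h + g + (c + c') * eta'.
Proof. by move=> -> ; lra. Qed.

(** The two events are disjoint: one starts with the lower chain above [eta], the other with the
    upper chain below [- eta]. So their probabilities add up; [gap_posr] moves the right one from
    [Edn] to [Eup], where [hitpE] applies. *)
Lemma maybe_zero_le k m :
  (P (maybe_zero k m) <= (Eup (hitp q r l) k
     + kap q r * (Eup (scale q r l) k - Edn (scale q r l) k)
     + (kap q r + kap q l) * eta)%:E)%E.
Proof.
have mA := measurable_above r l ell eta xiP k m.
have mA' := measurable_above l r ell eta xiNP k m.
have h1 := above_ge q0 r0 l0 rell lell mesh xiP k m.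
have h2 := above_ge q0 l0 r0 lell rell mesh xiNP k m.
rewrite EdnN in h2.
rewrite probability_setC; last exact: measurableU.
rewrite measureU//; last first.
  apply/seteqP; split => // w [/above_event_start w1 /above_event_start].
  rewrite walkN => w2.
  have := @walk_mono d T R (dn_drift r l ell e eta) (up_drift r l ell e eta) xi k w.
  have H z z' : z <= z' -> dn_drift r l ell e eta z <= up_drift r l ell e eta z'.
    move=> zz'; apply: le_trans (up_dn_le z r0 l0 rell lell e0 eta0) _.
    exact: up_drift_mono.
  by move=> /(_ H); have := eta0; lra.
have f1 : P (above_event r l ell e eta xi k m) \is a fin_num.
  by rewrite fin_num_measure.
have f2 : P (above_event l r ell e eta xiN k m) \is a fin_num.
  by rewrite fin_num_measure.
rewrite [X in (_ - X)%E](_ : _ = (fine (P (above_event r l ell e eta xi k m)) +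
    fine (P (above_event l r ell e eta xiN k m)))%:E); last first.
  by rewrite EFinD !fineK.
rewrite -EFinB lee_fin.
rewrite -(fineK f1) lee_fin in h1; rewrite -(fineK f2) lee_fin in h2.
exact: (maybe_arith (Eup_hitp k) (gap_posr k) h1 h2).
Qed.

Let surely_arith (h a b b' g p p' pU c c' eta' m x x' y y' z z' : R) :
  h = 1 - a - b -> b' - b <= g ->
  p <= a + c * eta' + m * (48 * x * y / z) + x' ->
  p' <= b' + c' * eta' + m * (48 * y' * y / z) + z' -> pU <= p + p' ->
  h - g - (c + c') * eta' - m * (48 * (x + y') * y / z) - x' - z' <= 1 - pU.
Proof.
move=> -> h1 h2 h3 h4.
have -> : m * (48 * (x + y') * y / z) = m * (48 * x * y / z) + m * (48 * y' * y / z) by ring.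
lra.
Qed.

(** The union bound, with the error terms of [stay_nonneg] for each sign; [gap_posl] moves the left
    mean from [Edn] to [Eup]. *)
Lemma surely_zero_ge k m :
  ((Eup (hitp q r l) k
     - kap q l * (Eup (scale q r l) k - Edn (scale q r l) k)
     - (kap q r + kap q l) * eta
     - m%:R * (48 * (expR ((kap q r + 1) ^+ 2 / 2) + expR ((kap q l + 1) ^+ 2 / 2))
        * (q * e) ^+ 2 / eta ^+ 4)
     - expR (- (kap q r * r / 4) * (m%:R * e))
     - expR (- (kap q l * l / 4) * (m%:R * e)))%:E <= P (surely_zero k m))%E.
Proof.
have mA := measurable_nonneg r l ell eta xiP k m.
have mA' := measurable_nonneg l r ell eta xiNP k m.
have h1 := nonneg_le q0 r0 l0 rell lell mesh xiP k m.
have h2 := nonneg_le q0 l0 r0 lell rell mesh xiNP k m.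
rewrite EupN in h2.
rewrite probability_setC; last exact: measurableU.
have fU : P (nonneg_event r l ell e eta xi k m `|` nonneg_event l r ell e eta xiN k m)
    \is a fin_num by rewrite fin_num_measure//; exact: measurableU.
have f1 : P (nonneg_event r l ell e eta xi k m) \is a fin_num.
  by rewrite fin_num_measure.
have f2 : P (nonneg_event l r ell e eta xiN k m) \is a fin_num.
  by rewrite fin_num_measure.
have -> : P (nonneg_event r l ell e eta xi k m `|` nonneg_event l r ell e eta xiN k m)
    = (fine (P (nonneg_event r l ell e eta xi k m `|`
                nonneg_event l r ell e eta xiN k m)))%:E by rewrite fineK.
rewrite -EFinB lee_fin.
have h3 : fine (P (nonneg_event r l ell e eta xi k m `|`
      nonneg_event l r ell e eta xiN k m))
    <= fine (P (nonneg_event r l ell e eta xi k m))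
       + fine (P (nonneg_event l r ell e eta xiN k m)).
  by rewrite -lee_fin EFinD !fineK//; exact: measureU2.
rewrite -(fineK f1) lee_fin in h1; rewrite -(fineK f2) lee_fin in h2.
exact: (surely_arith (Eup_hitp k) (gap_posl k) h1 h2 h3).
Qed.

End two_sides.
End events.

(** * Riemann sums of the bracketing events *)

(** For [p] and [h] the means of [pot] and [hitp]: Dynkin's formula makes [p] decreasing up to
    [2 * D], so [p n] is bounded by an average of [eps + M * h k] over [k < n], and [p n >= 0]
    bounds the sum of the [h k]. *)
Lemma decreasing_tail (R : realType) (p h : nat -> R) (A D M e eps : R) (n : nat) :
  (0 < n)%N -> 0 < e -> 0 <= M -> (forall k, 0 <= h k) -> (forall k, 0 <= p k) ->
  (forall k, p k <= eps + M * h k) ->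
  (forall k, (k <= n)%N -> `|p k - A + e * \sum_(i < k) h i| <= D) ->
  p n <= eps + 2 * D + M * (A + D) / (n%:R * e).
Proof.
move=> n0 e0 M0 h0 p0 ph H.
have n0' : 0 < n%:R :> R by rewrite ltr0n.
have step (k : 'I_n) : p n <= eps + 2 * D + M * h k.
  have := H k (ltnW (ltn_ord k)); have := H n (leqnn n).
  rewrite !ler_norml => /andP[_ h1] /andP[h2 _].
  have : e * \sum_(i < k) h i <= e * \sum_(i < n) h i.
    rewrite ler_pM2l// -!(big_mkord xpredT h) [leRHS](@big_cat_nat _ _ _ k)//=;
      last by apply: ltnW; exact: ltn_ord.
    by rewrite lerDl sumr_ge0.
  by have := ph k; lra.
have sum_le : n%:R * p n <= n%:R * (eps + 2 * D) + M * \sum_(i < n) h i.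
  have := ler_sum (index_enum _) (P := xpredT) (fun k _ => step k).
  by rewrite big_split/= !sumr_const card_ord -mulr_sumr !mulr_natl.
have hs : e * \sum_(i < n) h i <= A + D.
  have := H n (leqnn n); rewrite ler_norml => /andP[_]; have := p0 n; lra.
rewrite -(ler_pM2l n0') mulrDr (le_trans sum_le)// lerD2l.
rewrite (_ : n%:R * (M * (A + D) / (n%:R * e)) = M * ((A + D) / e)); last first.
  by field; rewrite !lt0r_neq0.
by rewrite ler_wpM2l// ler_pdivlMr// mulrC.
Qed.

Lemma sum_shift_le (R : realType) (n : nat) (f g : nat -> R) (e c : R) : 0 <= e ->
  (forall k, (k < n)%N -> f k <= g k + c) ->
  e * \sum_(k < n) f k <= e * \sum_(k < n) g k + n%:R * e * c.
Proof.
move=> e0 fg; have -> : n%:R * e * c = e * \sum_(k < n) c.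
  by rewrite sumr_const card_ord -[c *+ n]mulr_natl; ring.
rewrite -mulrDr ler_wpM2l// -big_split/=.
by apply: ler_sum => k _; exact: fg.
Qed.

Section world.
Context {R : realType}.
Variables (q r l ell : R).
Hypotheses (q0 : 0 < q) (r0 : 0 < r) (l0 : 0 < l) (rell : r <= ell) (lell : l <= ell).

Notation err e eta := (e / (2 * eta) ^+ 2 + 2 * eta).

Let ar_diff (a b D : R) : `|a| <= D -> `|b| <= D -> a - b <= 2 * D.
Proof. by rewrite !ler_norml => /andP[_ ?] /andP[? _]; lra. Qed.

Let ar_double (a D : R) : 0 <= D -> a <= D -> a <= 2 * D.
Proof. lra. Qed.

Let ar_maybe (C h a b c g g' : R) : 0 <= a -> 0 <= c -> g <= C * g' -> b <= g' ->
  h + a * g + c * b <= h + (a * C + c) * g'.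
Proof.
move=> a0 c0 /(ler_wpM2l a0) h2 /(ler_wpM2l c0) h3.
by rewrite mulrDl -[a * C * _]mulrA; lra.
Qed.

Let ar_surely (C h a b c g g' p p' y y' z : R) : 0 <= a -> 0 <= c ->
  g <= C * g' -> b <= g' -> p <= p' -> y <= z -> y' <= z ->
  h - ((a * C + c) * g' + p' + 2 * z) <= h - a * g - c * b - p - y' - y.
Proof.
move=> a0 c0 /(ler_wpM2l a0) h2 /(ler_wpM2l c0) h3.
by rewrite mulrDl -[a * C * _]mulrA; lra.
Qed.

Let ar_maybe_sum (p A S S' C t u K er : R) : p - A + S' <= C * er -> 0 <= p ->
  S <= S' + u * (K * er) -> u <= t -> 0 <= K * er -> S <= A + (C + t * K) * er.
Proof.
move=> h1 h2 h3 h4 h5; have := ler_wpM2r h5 h4.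
by rewrite mulrDl -mulrA; lra.
Qed.

Let ar_surely_sum (p A S S' C t u K1 K2 er eps M x y w : R) :
  0 <= C -> 0 <= K1 -> 0 <= K2 -> 0 <= er -> 0 <= y -> 0 <= x -> 0 <= t -> 0 <= M -> 0 < w ->
  - (C * er) <= p - A + S' -> p <= eps + 2 * (C * er) + M * (A + C * er) / w ->
  S' <= S + u * (K1 * er + t * K2 * y + 2 * x) -> u <= t ->
  let C' := C + 2 * C + t * K1 + t * t * K2 in
  A - eps - M * (A + C' * er) / w - C' * er - C' * y - 2 * t * x <= S.
Proof.
move=> C0 K10 K20 er0 y0 x0 t0 M0 w0 h1 h2 h3 ut /=.
set C' := _ + t * t * K2.
have k1 : 0 <= t * K1 by exact: mulr_ge0.
have k2 : 0 <= t * t * K2 by apply: mulr_ge0 => //; exact: mulr_ge0.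
have CC' : C * er <= C' * er by rewrite ler_wpM2r// /C'; lra.
have Mle : M * (A + C * er) / w <= M * (A + C' * er) / w.
  apply: ler_wpM2r; first by rewrite invr_ge0 ltW.
  by rewrite ler_wpM2l// lerD2l.
have Q0 : 0 <= K1 * er + t * K2 * y + 2 * x.
  by rewrite !addr_ge0// !mulr_ge0.
have := ler_wpM2r Q0 ut.
have c1 := mulr_ge0 k2 er0; have c2 := mulr_ge0 k1 y0; have c3 := mulr_ge0 C0 er0.
have c4 := mulr_ge0 C0 y0.
move: Mle h1 h2 h3; move: (M * _ / _) (M * _ / _) => u1 u2.
have -> : t * (K1 * er + t * K2 * y + 2 * x) = t * K1 * er + t * t * K2 * y + 2 * t * x.
  by ring.
have -> : C' * er = 3 * (C * er) + t * K1 * er + t * t * K2 * er by rewrite /C'; ring.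
have -> : C' * y = 3 * (C * y) + t * K1 * y + t * t * K2 * y by rewrite /C'; ring.
have -> : 2 * t * x = 2 * (t * x) by ring.
move: (t * K1 * er) (t * t * K2 * y) (t * K1 * y) c2
  (t * t * K2 * er) c1 (u * _) (t * x) (C * er) c3 (C * y) c4 => *.
lra.
Qed.

Let two_chains t : 0 <= t -> exists2 C : R, 0 <= C &
  forall (d : measure_display) (T : measurableType d) (P : probability T R)
    (e eta : R) (xi : nat -> T -> R) (k : nat),
  fine_mesh q ell e eta -> iid_gauss P (q * e) xi -> k%:R * e <= t ->
  let Eup := wmean P xi (fun _ _ => false) (fun=> up_drift r l ell e eta) in
  let Edn := wmean P xi (fun _ _ => false) (fun=> dn_drift r l ell e eta) in
  Eup (scale q r l) k - Edn (scale q r l) k <= C * err e eta /\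
  `|Eup (pot q r l) k - pot0 q r l + e * \sum_(i < k) Eup (hitp q r l) i|
     <= C * err e eta.
Proof.
move=> t0; have ell0 : 0 <= ell by apply: le_trans rell; exact: ltW.
have [C C0 H] := chain_estimates q0 r0 l0 ell0 t0.
exists (2 * C); first by rewrite mulr_ge0.
move=> d T P e eta xi k mesh xiP ket.
have [[e0 e1] qe1 [eta0 eta1] mm _] := mesh.
have b0 : 0 < 2 * eta by rewrite mulr_gt0.
have [h1 h2] := H d T P e (2 * eta) _ xi k e0 e1 qe1 b0 eta1 mm
  (up_ok r0 l0 rell lell mesh) (measurable_up_drift r l ell e eta) xiP ket.
have [h3 _] := H d T P e (2 * eta) _ xi k e0 e1 qe1 b0 eta1 mm
  (dn_ok r0 l0 rell lell mesh) (measurable_dn r l ell e eta) xiP ket.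
have D0 : 0 <= C * err e eta.
  apply: mulr_ge0 => //; apply: addr_ge0; last exact: ltW.
  by apply: divr_ge0; [exact: ltW|exact: sqr_ge0].
by rewrite -mulrA; split; [exact: ar_diff h1 h3|exact: ar_double D0 h2].
Qed.

(** Dynkin's formula for [pot], dropping the nonnegative potential left at time [n]. *)
Lemma maybe_zero_sum t : 0 <= t -> exists2 C : R, 0 <= C &
  forall (d : measure_display) (T : measurableType d) (P : probability T R)
    (e eta : R) (xi : nat -> T -> R) (n : nat) (m : nat -> nat),
  fine_mesh q ell e eta -> iid_gauss P (q * e) xi -> n%:R * e <= t ->
  e * \sum_(k < n) fine (P (maybe_zero r l ell e eta xi k (m k)))
    <= pot0 q r l + C * err e eta.
Proof.
move=> t0; have [C C0 H] := two_chains t0.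
have kr0 := kap_gt0 q0 r0; have kl0 := kap_gt0 q0 l0.
pose C' := C + t * (kap q r * C + (kap q r + kap q l)).
exists C'.
  apply: addr_ge0 => //; apply: mulr_ge0 => //.
  by apply: addr_ge0; [apply: mulr_ge0 => //; exact: ltW|apply: addr_ge0; exact: ltW].
move=> d T P e eta xi n m mesh xiP net.
have [[e0 e1] _ [eta0 _] _ _] := mesh.
have kt k : (k < n)%N -> k%:R * e <= t.
  by move=> kn; apply: le_trans net; rewrite ler_pM2r// ler_nat ltnW.
pose E := wmean P xi (fun _ _ => false) (fun=> up_drift r l ell e eta).
have eta_err : eta <= err e eta.
  have : 0 <= e / (2 * eta) ^+ 2 by apply: divr_ge0; [exact: ltW|exact: sqr_ge0].
  by have := eta0; lra.
have err0 : 0 <= err e eta by exact: le_trans (ltW eta0) eta_err.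
set er := err e eta in eta_err err0 *.
have step k : (k < n)%N -> fine (P (maybe_zero r l ell e eta xi k (m k))) <=
    E (hitp q r l) k + (kap q r * C + (kap q r + kap q l)) * er.
  move=> kn; have mm := measurable_maybe_zero r l q0 mesh xiP k (m k).
  rewrite -lee_fin fineK; last by rewrite fin_num_measure.
  apply: le_trans (maybe_zero_le q0 r0 l0 rell lell mesh xiP k (m k)) _.
  have [h1 _] := H d T P e eta xi k mesh xiP (kt k kn).
  by rewrite lee_fin; apply: ar_maybe => //; [exact: ltW|apply: addr_ge0; exact: ltW].
have [_] := H d T P e eta xi n mesh xiP net.
rewrite -/er -/E ler_norml => /andP[_ h1].
have p0 : 0 <= E (pot q r l) n.
  by apply: Rintegral_ge0 => w _; exact: pot_ge0.
have := sum_shift_le (ltW e0) step.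
move=> h2; apply: (ar_maybe_sum h1 p0 h2 net); apply: mulr_ge0 => //.
apply: addr_ge0; first by apply: mulr_ge0 => //; exact: ltW.
by apply: addr_ge0; exact: ltW.
Qed.

(** Here the potential left at time [n] must be small, by [decreasing_tail]. All windows end at
    [n'], so they have length at least [n' - n], whence the exponential; [e / eta ^+ 4] collects the
    overshoot costs. *)
Lemma surely_zero_sum (eps M alpha t : R) : 0 <= M -> 0 <= t ->
  (forall z, pot q r l z <= eps + M * hitp q r l z) ->
  0 <= alpha -> alpha <= kap q r * r / 4 -> alpha <= kap q l * l / 4 ->
  exists2 C : R, 0 <= C &
  forall (d : measure_display) (T : measurableType d) (P : probability T R)
    (e eta : R) (xi : nat -> T -> R) (n n' : nat),
  fine_mesh q ell e eta -> iid_gauss P (q * e) xi ->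
  (0 < n)%N -> (n <= n')%N -> n'%:R * e <= t ->
  pot0 q r l - eps - M * (pot0 q r l + C * err e eta) / (n%:R * e)
    - C * err e eta - C * (e / eta ^+ 4)
    - 2 * t * expR (- alpha * ((n' - n)%:R * e))
  <= e * \sum_(k < n) fine (P (surely_zero r l ell e eta xi k (n' - k))).
Proof.
move=> M0 t0 potM al0 al1 al2; have [C C0 H] := two_chains t0.
have kr0 := kap_gt0 q0 r0; have kl0 := kap_gt0 q0 l0.
pose K1 := kap q l * C + (kap q r + kap q l).
pose K2 := 48 * (expR ((kap q r + 1) ^+ 2 / 2) + expR ((kap q l + 1) ^+ 2 / 2)) * q ^+ 2.
have K10 : 0 <= K1.
  by apply: addr_ge0; [apply: mulr_ge0 => //; exact: ltW|apply: addr_ge0; exact: ltW].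
have K20 : 0 <= K2.
  by rewrite /K2 pmulr_lge0 ?exprn_gt0// mulr_ge0// addr_ge0// expR_ge0.
pose C' := C + 2 * C + t * K1 + t * t * K2.
have C'0 : 0 <= C'.
  rewrite /C'; apply: addr_ge0; last by apply: mulr_ge0 => //; exact: mulr_ge0.
  by apply: addr_ge0; [rewrite addr_ge0// mulr_ge0|exact: mulr_ge0].
exists C' => // d T P e eta xi n n' mesh xiP n0 nn' net'.
have [[e0 e1] _ [eta0 _] _ _] := mesh.
have n0' : 0 < n%:R :> R by rewrite ltr0n.
have net : n%:R * e <= t by apply: le_trans net'; rewrite ler_pM2r// ler_nat.
have kt k : (k <= n)%N -> k%:R * e <= t.
  by move=> kn; apply: le_trans net; rewrite ler_pM2r// ler_nat.
pose E := wmean P xi (fun _ _ => false) (fun=> up_drift r l ell e eta).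
have eta_err : eta <= err e eta.
  have : 0 <= e / (2 * eta) ^+ 2 by apply: divr_ge0; [exact: ltW|exact: sqr_ge0].
  by have := eta0; lra.
have err0 : 0 <= err e eta by exact: le_trans (ltW eta0) eta_err.
pose er := err e eta; rewrite -/er in eta_err err0 *.
set x := expR (- alpha * ((n' - n)%:R * e)).
have step k : (k < n)%N -> E (hitp q r l) k <=
    fine (P (surely_zero r l ell e eta xi k (n' - k)))
    + (K1 * er + t * K2 * (e / eta ^+ 4) + 2 * x).
  move=> kn; have kn' := leq_trans (ltnW kn) nn'.
  have mm := measurable_surely_zero r l q0 mesh xiP k (n' - k).
  rewrite -lerBlDr -lee_fin fineK; last by rewrite fin_num_measure.
  apply: le_trans (surely_zero_ge q0 r0 l0 rell lell mesh xiP k (n' - k)).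
  have [h1 _] := H d T P e eta xi k mesh xiP (kt _ (ltnW kn)).
  have mt : (n' - k)%:R * e <= t.
    by apply: le_trans net'; rewrite ler_pM2r// ler_nat leq_subr.
  have xx (a : R) : alpha <= a -> expR (- a * ((n' - k)%:R * e)) <= x.
    move=> ala; rewrite ler_expR !mulNr lerN2.
    apply: (@le_trans _ _ (a * ((n' - n)%:R * e))).
      by rewrite ler_wpM2r// mulr_ge0// ltW.
    apply: ler_wpM2l; first exact: le_trans al0 ala.
    by rewrite ler_pM2r// ler_nat leq_sub2l// ltnW.
  have := xx _ al1; have := xx _ al2.
  have : (n' - k)%:R * (48 * (expR ((kap q r + 1) ^+ 2 / 2) + expR ((kap q l + 1) ^+ 2 / 2))
        * (q * e) ^+ 2 / eta ^+ 4) <= t * K2 * (e / eta ^+ 4).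
    rewrite (_ : _ * _ = (n' - k)%:R * e * (K2 * (e / eta ^+ 4))); last first.
      by rewrite /K2; field; rewrite lt0r_neq0.
    rewrite -[X in _ <= X]mulrA ler_wpM2r//; apply: mulr_ge0 => //.
    by apply: divr_ge0; [exact: ltW|rewrite exprn_ge0// ltW].
  rewrite lee_fin -/E.
  move=> h2 h3 h4; apply: ar_surely => //; first exact: ltW.
  by apply: addr_ge0; exact: ltW.
have pE0 k : 0 <= E (pot q r l) k by apply: Rintegral_ge0 => w _; exact: pot_ge0.
have hE0 k : 0 <= E (hitp q r l) k by apply: Rintegral_ge0 => w _; exact: hitp_ge0.
have v0 : 0 < q * e by exact: mulr_gt0.
have ma (i : nat) : measurable_fun [set: R] (fun _ : R => false) by exact: measurable_cst.
have gle := drift_ok_le (up_ok r0 l0 rell lell mesh).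
have pM k : E (pot q r l) k <= eps + M * E (hitp q r l) k.
  have mh := mgrow_hitp q r l; have mp := mgrow_pot q r l.
  have mg := measurable_up_drift r l ell e eta.
  apply: (@le_trans _ _ (E (fun z => eps + M * hitp q r l z) k)).
    apply: (wmean_le v0 xiP ma (fun=> mg) (fun=> gle)) => //.
    by apply: mgrowD; [exact: mgrow_cst|exact: mgrowZ].
  rewrite /E (wmeanD v0 xiP ma (fun=> mg) (fun=> gle) k (mgrow_cst eps) (mgrowZ M mh)).
  by rewrite (wmeanZ v0 xiP ma (fun=> mg) (fun=> gle) M k mh) wmean_cst.
have HC k : (k <= n)%N -> `|E (pot q r l) k - pot0 q r l
    + e * \sum_(i < k) E (hitp q r l) i| <= C * er.
  by move=> kn; have [] := H d T P e eta xi k mesh xiP (kt _ kn).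
have pn := decreasing_tail n0 e0 M0 hE0 pE0 pM HC.
have := HC n (leqnn n); rewrite ler_norml => /andP[h1 _].
have h2 := sum_shift_le (ltW e0) step.
have w0 : 0 < n%:R * e by exact: mulr_gt0.
apply: (ar_surely_sum C0 K10 K20 err0 _ _ t0 M0 w0 h1 pn h2 net); last exact: expR_ge0.
by apply: divr_ge0; [exact: ltW|rewrite exprn_ge0// ltW].
Qed.

End world.

Lemma near0_mul_le (R : realType) (c d : R) : 0 < d -> \forall e \near (0 : R)^'+, c * e <= d.
Proof.
move=> d0; have c0 : 0 < `|c| + 1 by rewrite ltr_wpDl.
near=> e; have e0 : 0 < e by near: e; exact: nbhs_right_gt.
apply: (@le_trans _ _ ((`|c| + 1) * e)).
  by rewrite ler_pM2r// (le_trans (ler_norm c))// lerDl.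
rewrite -ler_pdivlMl// mulrC; near: e; apply: nbhs_right_le.
by rewrite divr_gt0.
Unshelve. all: by end_near. Qed.

Lemma near0_fine_mesh (R : realType) (q ell eta : R) : 0 < eta -> 2 * eta <= 1 ->
  \forall e \near (0 : R)^'+, fine_mesh q ell e eta.
Proof.
move=> eta0 eta1; near=> e; split.
- by split; near: e; [exact: nbhs_right_gt|exact: nbhs_right_le].
- by near: e; exact: near0_mul_le.
- by [].
- rewrite mulrAC; near: e; apply: near0_mul_le.
  by rewrite divr_gt0// exprn_gt0// mulr_gt0.
- by near: e; apply: near0_mul_le; rewrite divr_gt0.
Unshelve. all: by end_near. Qed.

Lemma small_param (R : realType) (C eps : R) : 0 <= C -> 0 < eps ->
  exists eta : R, [/\ 0 < eta, 2 * eta <= 1 & C * (2 * eta) <= eps].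
Proof.
move=> C0 eps0; exists (Num.min 1 (eps / (C + 1)) / 2).
have h : 2 * (Num.min 1 (eps / (C + 1)) / 2) = Num.min 1 (eps / (C + 1)) by field.
have C1 : 0 < C + 1 by rewrite ltr_wpDl.
rewrite h; split.
- by rewrite divr_gt0// lt_min ltr01 divr_gt0.
- by rewrite ge_min lexx.
- apply: (@le_trans _ _ ((C + 1) * (eps / (C + 1)))).
    apply: ler_pM => //; first by rewrite le_min ler01 divr_ge0// ltW.
      by rewrite lerDl.
    by rewrite ge_min lexx orbT.
  by rewrite mulrC divfK// lt0r_neq0.
Qed.

Lemma truncn_grid (R : realType) (t e : R) : 0 <= t -> 0 < e ->
  (Num.truncn (t / e))%:R * e <= t < (Num.truncn (t / e)).+1%:R * e.
Proof.
move=> t0 e0; have te : 0 <= t / e by rewrite divr_ge0// ltW.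
by rewrite -ler_pdivlMr// -ltr_pdivrMr//; exact: truncn_itv.
Qed.

Section world_limits.
Context {R : realType}.
Variables (q r l : R).
Hypotheses (q0 : 0 < q) (r0 : 0 < r) (l0 : 0 < l).

Lemma maybe_zero_limit (ell t eps : R) : r <= ell -> l <= ell -> 0 <= t -> 0 < eps ->
  exists2 eta : R, 0 < eta & \forall e \near (0 : R)^'+, fine_mesh q ell e eta /\
  forall (d : measure_display) (T : measurableType d) (P : probability T R)
    (xi : nat -> T -> R) (n : nat) (m : nat -> nat),
  iid_gauss P (q * e) xi -> n%:R * e <= t ->
  e * \sum_(k < n) fine (P (maybe_zero r l ell e eta xi k (m k))) <= pot0 q r l + eps.
Proof.
move=> rell lell t0 eps0; have [C C0 H] := maybe_zero_sum q0 r0 l0 rell lell t0.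
have eps2 : 0 < eps / 2 by exact: divr_gt0.
have [eta [eta0 eta1 Ceta]] := small_param C0 eps2.
exists eta => //; near=> e.
have mesh : fine_mesh q ell e eta by near: e; exact: near0_fine_mesh.
split=> // d T P xi n m xiP net.
apply: le_trans (H d T P e eta xi n m mesh xiP net) _; rewrite lerD2l mulrDr.
have : C / (2 * eta) ^+ 2 * e <= eps / 2 by near: e; exact: near0_mul_le.
by rewrite mulrAC -[X in X <= _]mulrA; lra.
Unshelve. all: by end_near. Qed.

(** The horizon comes before [ell] because [M] and [alpha] depend only on [q], [r], [l] and [eps];
    only [eta] and [e] see [ell]. *)
Lemma surely_zero_limit (eps : R) : 0 < eps -> exists2 t : R, 0 < t &
  forall ell, r <= ell -> l <= ell ->
  exists2 eta : R, 0 < eta & \forall e \near (0 : R)^'+, fine_mesh q ell e eta /\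
  exists n n' : nat, [/\ (n < n')%N, n'%:R * e <= t &
  forall (d : measure_display) (T : measurableType d) (P : probability T R)
    (xi : nat -> T -> R), iid_gauss P (q * e) xi ->
  pot0 q r l - eps <= e * \sum_(k < n) fine (P (surely_zero r l ell e eta xi k (n' - k)))].
Proof.
move=> eps0; have eps5 : 0 < eps / 5 by exact: divr_gt0.
have [M M0 potM] := pot_le_hitp q0 r0 l0 eps5.
have kr0 : 0 < kap q r * r / 4 by rewrite divr_gt0// mulr_gt0// kap_gt0.
have kl0 : 0 < kap q l * l / 4 by rewrite divr_gt0// mulr_gt0// kap_gt0.
pose alpha := Num.min (kap q r * r / 4) (kap q l * l / 4).
have al0 : 0 < alpha by rewrite lt_min kr0 kl0.
have al1 : alpha <= kap q r * r / 4 by rewrite ge_min lexx.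
have al2 : alpha <= kap q l * l / 4 by rewrite ge_min lexx orbT.
have A0 := pot0_gt0 q0 r0 l0.
(* Brings two of the five errors below [eps / 5]: the one divided by [n * e >= t / 2], and [4 * t *
   expR (- alpha * t / 2) <= 64 / (alpha ^+ 2 * t)], from [y <= expR y] at [y = alpha * t / 4],
   squared. The horizon is [2 * t] since [n'] is [n + n]. *)
pose t := 1 + (2 * M * (pot0 q r l + 1) + 64 / alpha ^+ 2) * (5 / eps).
have tpos : 0 <= (2 * M * (pot0 q r l + 1) + 64 / alpha ^+ 2) * (5 / eps).
  rewrite mulr_ge0//; last by rewrite divr_ge0// ltW.
  apply: addr_ge0; last by rewrite divr_ge0// sqr_ge0.
  by apply: mulr_ge0; [exact: mulr_ge0|rewrite addr_ge0// ltW].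
have t0 : 0 < t by rewrite /t; lra.
exists (2 * t); first exact: mulr_gt0.
move=> ell rell lell; have tt0 : 0 <= 2 * t by rewrite mulr_ge0// ltW.
have [C C0 H] := surely_zero_sum q0 r0 l0 rell lell M0 tt0 potM (ltW al0) al1 al2.
have epsm : 0 < Num.min (1 / 2) (eps / 10) by rewrite lt_min !divr_gt0.
have [eta [eta0 eta1 Ceta]] := small_param C0 epsm.
exists eta => //; near=> e.
have e0 : 0 < e by near: e; exact: nbhs_right_gt.
have mesh : fine_mesh q ell e eta by near: e; exact: near0_fine_mesh.
split=> //; have /andP[nt tn] := truncn_grid (ltW t0) e0.
set n := Num.truncn _ in nt tn.
have et : e <= t / 2 by near: e; apply: nbhs_right_le; exact: divr_gt0.
have nt2 : t / 2 <= n%:R * e.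
  by move: tn; rewrite -natr1 mulrDl mul1r; lra.
have n0 : (0 < n)%N.
  by rewrite -(ltr0n R) -(pmulr_lgt0 _ e0) (lt_le_trans _ nt2)// divr_gt0.
have n't : (n + n)%:R * e <= 2 * t by rewrite natrD mulrDl; clear - nt; lra.
exists n, (n + n)%N; split.
- by rewrite -[ltnLHS]addn0 ltn_add2l.
- exact: n't.
move=> d T P xi xiP.
apply: le_trans (H d T P e eta xi n (n + n)%N mesh xiP n0 (leq_addr _ _) n't).
rewrite addnK.
set er := e / (2 * eta) ^+ 2 + 2 * eta.
have e1 : C * er <= 1 /\ C * er <= eps / 5.
  have : C / (2 * eta) ^+ 2 * e <= Num.min (1 / 2) (eps / 10) by near: e; exact: near0_mul_le.
  move: Ceta; rewrite !le_min => /andP[a1 a2] /andP[b1 b2].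
  have -> : C * er = C / (2 * eta) ^+ 2 * e + C * (2 * eta).
    by rewrite /er mulrDr mulrAC mulrA.
  by split; lra.
have [e1a e1b] := e1.
have e2 : C * (e / eta ^+ 4) <= eps / 5.
  by rewrite mulrA mulrAC; near: e; exact: near0_mul_le.
have w0 : 0 < n%:R * e by apply: lt_le_trans nt2; exact: divr_gt0.
have e3 : M * (pot0 q r l + C * er) / (n%:R * e) <= eps / 5.
  rewrite ler_pdivrMr//; apply: (@le_trans _ _ (eps / 5 * (t / 2))).
    apply: (@le_trans _ _ (M * (pot0 q r l + 1))); first by rewrite ler_wpM2l// lerD2l.
    have -> : eps / 5 * (t / 2) = eps / 10 + M * (pot0 q r l + 1)
        + 32 / alpha ^+ 2.
      by rewrite /t; field; rewrite !lt0r_neq0.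
    have : 0 <= 32 / alpha ^+ 2 by rewrite divr_ge0// sqr_ge0.
    by have := eps5; lra.
  by rewrite ler_wpM2l// ltW.
have e4 : 2 * (2 * t) * expR (- alpha * (n%:R * e)) <= eps / 5.
  have x0 : 0 < alpha * t / 4 by rewrite divr_gt0// mulr_gt0.
  apply: (@le_trans _ _ (2 * (2 * t) * (4 / (alpha * t)) ^+ 2)).
    rewrite ler_wpM2l//; first by rewrite mulr_ge0// ltW.
    apply: (@le_trans _ _ (expR (- (alpha * t / 4)) ^+ 2)).
      rewrite expr2 -expRD ler_expR.
      have := ler_wpM2l (ltW al0) nt2; rewrite mulNr; lra.
    rewrite ler_sqr ?nnegrE ?expR_ge0//; last first.
      by rewrite divr_ge0// mulr_ge0// ltW.
    rewrite expRN -[leRHS]invf_div lef_pV2 ?posrE ?expR_gt0//.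
    exact: ler_id_expR.
  have -> : 2 * (2 * t) * (4 / (alpha * t)) ^+ 2 = 64 / alpha ^+ 2 / t.
    by field; rewrite !lt0r_neq0.
  rewrite ler_pdivrMr//.
  have -> : eps / 5 * t = eps / 5 + 2 * M * (pot0 q r l + 1) + 64 / alpha ^+ 2.
    by rewrite /t; field; rewrite !lt0r_neq0.
  have : 0 <= 2 * M * (pot0 q r l + 1) by rewrite mulr_ge0 ?mulr_ge0// addr_ge0// ltW.
  by have := eps5; lra.
move: e1b e2 e3 e4; move: (C * er) (C * (e / _)) (_ / (n%:R * e)) (2 * (2 * t) * _) => *.
lra.
Unshelve. all: by end_near. Qed.

End world_limits.

Definition increments (R : realType) (T : Type) (B : R -> T -> R) (e : R) (i : nat) (w : T) : R :=
  B (i.+1%:R * e) w - B (i%:R * e) w.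

Lemma incrementsN (R : realType) (T : Type) (B : R -> T -> R) e :
  increments (fun t w => - B t w) e = (fun i w => - increments B e i w).
Proof. by apply/funext => i; apply/funext => w; rewrite /increments opprD. Qed.

(** * The bracketing events read on a single path *)

Section one_side.
Context {d : measure_display} {T : measurableType d} {R : realType}.
Variables (q r l ell e eta : R) (B : R -> T -> R) (w : T) (x : R -> R) (n : nat).
Hypotheses (r0 : 0 < r) (l0 : 0 < l) (rell : r <= ell) (lell : l <= ell).
Hypothesis mesh : fine_mesh q ell e eta.
Hypothesis ok : path_ok r l ell (fun t => B t w) x.
Hypothesis osc : small_osc (fun t => B t w) e (eta / 4) n.

Let e0 : 0 < e. Proof. by case: mesh => -[]. Qed.
Let eta0 : 0 < eta. Proof. by case: mesh => _ _ []. Qed.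
Let e_eta : ell * e <= eta / 4. Proof. by case: mesh. Qed.

Let xi := increments B e.

Let V_le_up i : (i <= n)%N -> B (i%:R * e) w - x (i%:R * e) <=
  walk (fun _ _ => false) (fun=> up_drift r l ell e eta) xi i w.
Proof.
move=> ni; apply: (path_le_up r0 l0 rell lell e0 eta0 e_eta ok osc
  (z := fun i => walk (fun _ _ => false) (fun=> up_drift r l ell e eta) xi i w)) ni => //.
Qed.

Let V_ge_dn i : (i <= n)%N ->
  walk (fun _ _ => false) (fun=> dn_drift r l ell e eta) xi i w <=
  B (i%:R * e) w - x (i%:R * e).
Proof.
move=> ni; rewrite -lerN2 -walkN.
have -> : (fun z => - dn_drift r l ell e eta (- z)) = up_drift l r ell e eta.
  by apply/funext => z; rewrite /dn_drift !opprK.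
rewrite opprB addrC -[x _]opprK.
apply: (path_le_up l0 r0 lell rell e0 eta0 e_eta (path_okN ok) (small_oscN osc)
  (z := fun i => walk (fun _ _ => false) (fun=> up_drift l r ell e eta)
                  (fun i w => - xi i w) i w)) ni => //.
by move=> j /=; rewrite /xi /increments opprB opprK [- _ + _]addrC.
Qed.

Lemma above_event_positive k m : (k + m <= n)%N -> above_event r l ell e eta xi k m w ->
  forall s, k%:R * e <= s <= (k + m)%:R * e -> x s < B s w.
Proof.
rewrite /above_event/= ltNge => kmn Sw s ks; rewrite -subr_gt0.
have [_ H] := abs_walk_after (A := fun z : R => z <= eta) Sw.
apply: (stay_positive r0 rell e0 eta0 e_eta ok osc kmn (V_ge_dn _) _ ks).
  by apply: leq_trans kmn; exact: leq_addr.
move=> j jm; have nA := H j jm.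
have [E _] := abs_walk_after (A := fun z : R => z <= eta) nA.
by move: nA; rewrite E -ltNge.
Qed.

Lemma positive_nonneg_event k m : (0 < m)%N -> (k + m <= n)%N ->
  (forall s, k%:R * e < s <= (k + m)%:R * e -> x s < B s w) ->
  nonneg_event r l ell e eta xi k m w.
Proof.
move=> m0 kmn pos; rewrite /nonneg_event/= leNgt.
apply: (abs_walk_stay (A := fun z : R => z < 0)) => i im; rewrite -leNgt.
apply: (no_zero_positive e0 ok m0 _ _ im) => [|s ks]; last by rewrite subr_gt0 pos.
by apply: V_le_up; apply: leq_trans kmn; exact: leq_addr.
Qed.

End one_side.

Section two_sides.
Context {d : measure_display} {T : measurableType d} {R : realType}.
Variables (q r l ell e eta : R) (B : R -> T -> R) (w : T) (x : R -> R) (n : nat).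
Hypotheses (r0 : 0 < r) (l0 : 0 < l) (rell : r <= ell) (lell : l <= ell).
Hypothesis mesh : fine_mesh q ell e eta.
Hypothesis ok : path_ok r l ell (fun t => B t w) x.
Hypothesis osc : small_osc (fun t => B t w) e (eta / 4) n.

Let okN := path_okN ok.
Let oscN := small_oscN osc.

Lemma zero_maybe_zero k m tau : (k + m <= n)%N -> k%:R * e <= tau <= (k + m)%:R * e ->
  x tau = B tau w -> maybe_zero r l ell e eta (increments B e) k m w.
Proof.
move=> kmn tk xtau [|].
  by move=> /(above_event_positive r0 l0 rell lell mesh ok osc kmn)/(_ _ tk); rewrite xtau ltxx.
rewrite -incrementsN.
move=> /(@above_event_positive _ _ _ _ _ _ _ _ _ (fun t w => - B t w) w _ _
  l0 r0 lell rell mesh okN oscN _ _ kmn).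
by move=> /(_ _ tk); rewrite xtau ltxx.
Qed.

Lemma surely_zero_zero k m : (0 < m)%N -> (k + m <= n)%N ->
  surely_zero r l ell e eta (increments B e) k m w ->
  exists2 tau, k%:R * e < tau <= (k + m)%:R * e & x tau = B tau w.
Proof.
move=> m0 kmn Sw; apply: contrapT => nz; have e0 : 0 < e by case: mesh => -[].
have [cb _ _ lip _] := ok; have cx := lipschitz_le_continuous lip.
have cv : continuous (fun s => B s w - x s).
  by move=> s; apply: cvgB; [exact: cb|exact: cx].
have km : k%:R * e < (k + m)%:R * e.
  by rewrite ltr_pM2r// ltr_nat -[X in (X < _)%N]addn0 ltn_add2l.
have v0 s : k%:R * e < s <= (k + m)%:R * e -> B s w - x s != 0.
  by move=> ks; apply/eqP => /subr0_eq E; apply: nz; exists s.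
apply: Sw; have [pos|neg] := constant_sign km cv v0.
  left; apply: (positive_nonneg_event r0 l0 rell lell mesh ok osc m0 kmn) => s ks.
  by rewrite -subr_gt0 pos.
right; rewrite -incrementsN.
apply: (@positive_nonneg_event _ _ _ _ _ _ _ _ _ (fun t w => - B t w) w _ _
  l0 r0 lell rell mesh okN oscN _ _ m0 kmn) => s ks.
by rewrite ltrN2 -subr_lt0 neg.
Qed.

End two_sides.

(** * Brownian paths *)

Lemma brownian_increments (R : realType) (d : measure_display) (T : measurableType d)
    (P : probability T R) (sigma : R) (B : R -> {RV P >-> R}) (e : R) :
  0 < e -> brownian_motion sigma B ->
  iid_gauss P (sigma ^+ 2 * e) (increments (fun t w => B t w) e).
Proof.
move=> e0 [_ _ gaussB indB].
have lt_t i : i%:R * e < i.+1%:R * e by rewrite ltr_pM2r// ltr_nat.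
split.
- by move=> i; exact: measurable_funB.
- move=> i A mA; have := gaussB _ _ (lt_t i) A mA.
  have -> : i.+1%:R * e - i%:R * e = e by rewrite -natr1 mulrDl mul1r addrC addKr.
  exact.
- by move=> n; exact: (indB n (fun i => i%:R * e) lt_t).
Qed.

Lemma near0_inv (R : realType) (Q : R -> Prop) :
  (\forall e \near (0 : R)^'+, Q e) -> \forall m \near \oo, Q (m.+1%:R^-1).
Proof.
case=> e0 /= e00 H.
have /cvgrPdist_lt/(_ _ e00) := @cvg_harmonic R.
apply: filterS => m; rewrite /= sub0r normrN => me0.
apply: H => /=; first by rewrite sub0r normrN.
by rewrite invr_gt0.
Qed.

(** The limit superior of the [A m] lies in the exceptional null set; by continuity from above the
    tail unions have probability tending to 0. *)
Lemma prob_eventually (R : realType) (d : measure_display) (T : measurableType d)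
    (P : probability T R) (A : nat -> set T) (eps : R) : 0 < eps ->
  (forall m, measurable (A m)) ->
  {ae P, forall w, \forall m \near \oo, ~ A m w} ->
  \forall m \near \oo, (P (A m) <= eps%:E)%E.
Proof.
move=> eps0 mA [N [mN PN0 NA]].
pose U k := \bigcup_(m in [set m | (k <= m)%N]) A m.
have mU k : measurable (U k) by apply: bigcup_measurable.
have mI : measurable (\bigcap_k U k) by exact: bigcapT_measurable.
have I0 : P (\bigcap_k U k) = 0%E.
  apply/eqP; rewrite eq_le measure_ge0 andbT -PN0 le_measure ?inE//.
  move=> w Uw; apply: NA => -[k _ Hk].
  by have [m /= km Am] := Uw k I; exact: (Hk m km).
have dU : {homo U : n m / (n <= m)%N >-> (m <= n)%O}.
  move=> k k' kk'; apply/subsetPset => w [m /= km Am].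
  by exists m => //=; exact: leq_trans kk' km.
have U0 : (P (U 0%N) < +oo)%E by rewrite ltey_eq fin_num_measure.
have : (P (U k) @[k --> \oo] --> 0)%E by rewrite -I0; exact: (nonincreasing_cvg_mu U0 mU mI dU).
move=> /fine_cvgP[_ /cvgrPdist_le/(_ _ eps0)].
apply: filterS => m /=; rewrite sub0r normrN => h.
apply: (@le_trans _ _ (P (U m))).
  by apply: le_measure; rewrite ?inE//; apply: bigcup_sup => /=.
rewrite -[P (U m)]fineK ?fin_num_measure// lee_fin.
exact: le_trans (ler_norm _) h.
Qed.

Section oscillation.
Context {R : realType}.

Lemma small_increments (b : R -> R) (t delta : R) : continuous b -> 0 < delta ->
  \forall e \near (0 : R)^'+, forall s, 0 <= s <= t -> forall s', `|s - s'| <= e ->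
    `|b s - b s'| <= delta.
Proof.
move=> cb delta0.
have /compact_near_coveringP := @segment_compact R 0 t.
move=> /(_ _ (0 : R)^'+ (fun e s => forall s', `|s - s'| <= e -> `|b s - b s'| <= delta)).
move=> H; have {H} : \forall e \near (0 : R)^'+, `[0, t] `<=`
    (fun s => forall s', `|s - s'| <= e -> `|b s - b s'| <= delta).
  apply: H => s _.
  have d2 : 0 < delta / 2 by exact: divr_gt0.
  have /cvgrPdist_le/(_ _ d2)/nbhs_ballP[rho /= rho0 Hrho] := cb s.
  have r2 : 0 < rho / 2 by exact: divr_gt0.
  exists (ball s (rho / 2), [set e | e < rho / 2]) => /=.
    split; first exact: nbhsx_ballx.
    exact: nbhs_right_lt.
  case=> u e /= [su er] s' us'.
  have h1 := Hrho u; have h2 := Hrho s'.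
  have {}h1 : `|b s - b u| <= delta / 2.
    by apply: h1; apply: lt_trans su _; rewrite ltr_pdivrMr// ltr_pMr// ltr1n.
  have {}h2 : `|b s - b s'| <= delta / 2.
    apply: h2; rewrite /ball/= -(subrKA u) (le_lt_trans (ler_normD _ _))//.
    by rewrite [ltRHS](splitr rho) ltrD//; exact: le_lt_trans us' er.
  rewrite -(subrKA (b s)) (le_trans (ler_normD _ _))// [leRHS](splitr delta).
  by rewrite lerD// distrC.
by apply: filterS => e He s st; apply: He; rewrite /= in_itv.
Qed.

Variables (d : measure_display) (T : measurableType d).
Variables (B : R -> T -> R).

(** Rational positions within a cell keep the event measurable; on a continuous path they detect the
    same oscillations as real ones. *)
Definition oscillates (e delta : R) (n : nat) : set T :=
  \bigcup_(i in `I_n) \bigcup_(q : rat)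
    [set w | 0 <= (ratr q : R) <= 1 /\ delta < `|B ((i%:R + ratr q) * e) w - B (i%:R * e) w|].

Lemma measurable_oscillates e delta n : (forall t, measurable_fun [set: T] (B t)) ->
  measurable (oscillates e delta n).
Proof.
move=> mB; apply: bigcup_measurable => i _; apply: bigcupT_measurable_rat => q.
have [q01|q01] := boolP (0 <= (ratr q : R) <= 1); last first.
  by rewrite (_ : [set _ | _] = set0)//; apply/seteqP; split => w //= [].
rewrite (_ : [set _ | _] = [set w | delta < `|B ((i%:R + ratr q) * e) w - B (i%:R * e) w|]).
  have mf : measurable_fun [set: T] (fun w => `|B ((i%:R + ratr q) * e) w - B (i%:R * e) w|).
    by apply: measurableT_comp => //; exact: measurable_funB.
  have := mf measurableT _ (measurable_itv `]delta, +oo[); rewrite setTI.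
  by congr measurable; apply/seteqP; split => w /=; rewrite in_itv/= andbT.
by apply/seteqP; split => w //= -[].
Qed.

Lemma small_osc_of_not_oscillates e delta n w : 0 < e -> continuous (fun t => B t w) ->
  ~ oscillates e delta n w -> small_osc (fun t => B t w) e delta n.
Proof.
move=> e0 cB nosc i s ni /andP[s1 s2]; rewrite leNgt; apply/negP => ds.
pose g := `|B s w - B (i%:R * e) w| - delta.
have g0 : 0 < g by rewrite /g subr_gt0.
have /cvgrPdist_lt/(_ _ g0)/nbhs_ballP[rho /= rho0 Hrho] := cB s.
pose u := s / e - i%:R.
have se : s = (i%:R + u) * e by rewrite /u addrC subrK divfK// lt0r_neq0.
have u0 : 0 <= u by rewrite subr_ge0 ler_pdivlMr.
have u1 : u <= 1 by rewrite lerBlDl ler_pdivrMr// natr1.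
have re0 : 0 < rho / e by exact: divr_gt0.
have : Num.max 0 (u - rho / e) < Num.min 1 (u + rho / e).
  by rewrite gt_max !lt_min ltr01/=; apply/and3P; split; lra.
move=> /rat_in_itvoo[q]; rewrite in_itv/= gt_max lt_min => /andP[/andP[q0 q1] /andP[q2 q3]].
apply: nosc; exists i => //=; exists q => //=; split; first by rewrite !ltW.
have /Hrho : ball s rho ((i%:R + ratr q) * e).
  rewrite /ball/= {1}se -mulrBl opprD addrACA subrr add0r normrM (gtr0_norm e0).
  rewrite -ltr_pdivlMr// ltr_norml; apply/andP; split; lra.
rewrite /= /g => h.
have : `|B s w - B (i%:R * e) w| <= `|B s w - B ((i%:R + ratr q) * e) w|
    + `|B ((i%:R + ratr q) * e) w - B (i%:R * e) w|.
  by rewrite -[in leLHS](subrKA (B ((i%:R + ratr q) * e) w)) ler_normD.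
move: h; move: `|_| `|_| `|_| => a1 a2 a3; lra.
Qed.

Lemma not_oscillates_near t delta w : 0 < delta -> continuous (fun t => B t w) ->
  \forall e \near (0 : R)^'+, forall n, n%:R * e <= t -> ~ oscillates e delta n w.
Proof.
move=> delta0 cB; near=> e; have e0 : 0 < e by near: e; exact: nbhs_right_gt.
move=> n net [i /= ni [q _ [/andP[q0 q1]]]]; rewrite ltNge => /negP; apply.
have H : forall s, 0 <= s <= t -> forall s', `|s - s'| <= e -> `|B s w - B s' w| <= delta.
  by near: e; exact: small_increments.
rewrite distrC; apply: H.
  apply/andP; split; first by apply: mulr_ge0 => //; exact: ltW.
  by apply: le_trans net; rewrite ler_pM2r// ler_nat ltnW.
rewrite -mulrBl opprD addrA subrr sub0r normrM normrN (gtr0_norm e0).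
by apply: ler_piMl; [exact: ltW|rewrite ger0_norm].
Unshelve. all: by end_near. Qed.

End oscillation.

Lemma oscillates_prob (R : realType) (d : measure_display) (T : measurableType d)
    (P : probability T R) (B : R -> T -> R) (delta t eps : R) (n : nat -> nat) :
  0 < eps -> 0 < delta -> (forall t, measurable_fun [set: T] (B t)) ->
  {ae P, forall w, continuous (fun t => B t w)} ->
  (forall m, (n m)%:R * m.+1%:R^-1 <= t) ->
  \forall m \near \oo, (P (oscillates B m.+1%:R^-1 delta (n m)) <= eps%:E)%E.
Proof.
move=> eps0 delta0 mB cB nt; apply: prob_eventually => //.
  by move=> m; exact: measurable_oscillates.
apply: filterS cB => w cw.
have := near0_inv (not_oscillates_near t delta0 cw).
by apply: filterS => m; apply; exact: nt.
Qed.

(** * Measurable bounds for the last zero *)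

Lemma integral_indic_sum (R : realType) (d : measure_display) (T : measurableType d)
    (P : probability T R) (n : nat) (c c' : R) (A : nat -> set T) (A' : set T) :
  0 <= c -> 0 <= c' -> (forall k, measurable (A k)) -> measurable A' ->
  (\int[P]_w (c * \sum_(k < n) \1_(A k) w + c' * \1_A' w)%:E =
   (c * \sum_(k < n) fine (P (A k)) + c' * fine (P A'))%:E)%E.
Proof.
move=> c0 c'0 mA mA'.
have mS : measurable_fun [set: T] (fun w => \sum_(k < n) (\1_(A k) w : R)).
  by apply: measurable_sum => k; exact: measurable_indic.
rewrite (eq_integral (fun w => (c%:E * (\sum_(k < n) \1_(A k) w)%:E + c'%:E * (\1_A' w)%:E)%E))//.
have s0 w : 0 <= \sum_(k < n) (\1_(A k) w : R) by apply: sumr_ge0 => k _.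
rewrite ge0_integralD//=; first last.
- by apply: measurable_funeM; apply/measurable_EFinP; exact: measurable_indic.
- by move=> w _; rewrite mule_ge0// lee_fin.
- by apply: measurable_funeM; exact/measurable_EFinP.
- by move=> w _; rewrite mule_ge0// lee_fin.
have mSE : measurable_fun [set: T] (fun w => (\sum_(k < n) (\1_(A k) w : R))%:E).
  exact/measurable_EFinP.
have mIE : measurable_fun [set: T] (fun w => (\1_A' w : R)%:E).
  by apply/measurable_EFinP; exact: measurable_indic.
rewrite (ge0_integralZl_EFin P measurableT _ mSE c0); last by move=> w _; rewrite lee_fin.
rewrite (ge0_integralZl_EFin P measurableT _ mIE c'0); last by move=> w _; rewrite lee_fin.
rewrite integral_indic// setIT EFinD !EFinM fineK ?fin_num_measure//; congr (_ * _ + _)%E.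
under eq_integral do rewrite -sumEFin.
rewrite ge0_integral_sum//; last first.
  by move=> k; apply/measurable_EFinP; exact: measurable_indic.
rewrite -sumEFin; apply: eq_bigr => k _.
by rewrite integral_indic// setIT fineK// fin_num_measure.
Qed.

(** Turns the last zero into a Riemann sum: a zero at [tau] forces [maybe_zero] at every grid time
    up to [tau]. *)
Lemma count_ge (R : realType) (e tau : R) (n : nat) : 0 < e -> tau <= n%:R * e ->
  tau <= e * \sum_(k < n) (k%:R * e <= tau)%R%:R.
Proof.
move=> e0; elim: n => [|n IH] tn; first by rewrite big_ord0 mulr0 -[leRHS](mul0r e).
have [/IH {}IH|nt] := leP tau (n%:R * e).
  by rewrite big_ord_recr/= mulrDr ler_wpDr// mulr_ge0// ltW.
apply: le_trans tn _; rewrite mulrC ler_pM2l// (eq_bigr (fun=> 1)).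
  by rewrite sumr_const card_ord.
move=> k _; rewrite (_ : (_ <= _) = true)//; apply: le_trans (ltW nt).
by rewrite ler_pM2r// ler_nat -ltnS.
Qed.

Lemma count_le (R : realType) (e M : R) (n : nat) : 0 < e -> 0 <= M ->
  e * \sum_(k < n) (k%:R * e < M)%R%:R <= M + e.
Proof.
move=> e0 M0; elim: n => [|n IH]; first by rewrite big_ord0 mulr0 addr_ge0// ltW.
have [nM|Mn] := ltP (n%:R * e) M; last by rewrite big_ord_recr/= ltNge Mn addr0.
apply: (@le_trans _ _ (e * \sum_(k < n.+1) 1)).
  by rewrite ler_pM2l//; apply: ler_sum => k _; case: (_ < _).
by rewrite sumr_const card_ord mulrC -natr1 mulrDl mul1r lerD2r ltW.
Qed.

Section approximations.
Context {d : measure_display} {T : measurableType d} {R : realType}.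
Variables (P : probability T R) (sigma r l : R) (B : R -> {RV P >-> R}).
Hypotheses (q0 : 0 < sigma ^+ 2) (r0 : 0 < r) (l0 : 0 < l).
Hypothesis brownian : brownian_motion sigma B.

Let q := sigma ^+ 2.
Let path t w := B t w.

Let mB t : measurable_fun [set: T] (path t).
Proof. by []. Qed.

Let cB : {ae P, forall w, continuous (fun t => path t w)}.
Proof. by case: brownian. Qed.

(** [F] is [e] times the number of [maybe_zero] events, with windows up to the end of the grid. On
    paths oscillating too much for the comparison, the extra [N] covers every [tau <= N]. *)
Lemma upper_approx (N : nat) : r <= N%:R -> l <= N%:R -> exists F : T -> R,
  [/\ measurable_fun [set: T] F, forall w, 0 <= F w,
      (\int[P]_w (F w)%:E <= (pot0 q r l + N.+1%:R^-1)%:E)%E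
    & forall w x, path_ok r l N%:R (fun t => B t w) x ->
        forall tau, 0 <= tau <= N%:R -> x tau = B tau w -> tau <= F w].
Proof.
move=> rN lN; have t0 : 0 <= N.+1%:R :> R by [].
have N0 : 0 < N.+1%:R^-1 / 2 :> R by rewrite divr_gt0// invr_gt0.
(* Such a probability of oscillation, multiplied by [N], costs at most half of [1 / (N + 1)]. *)
have N20 : 0 < N.+1%:R^-1 ^+ 2 / 2 :> R by rewrite divr_gt0// exprn_gt0// invr_gt0.
have [eta eta0 /near0_inv H] := maybe_zero_limit q0 r0 l0 rN lN t0 N0.
pose n m := Num.truncn (N.+1%:R / m.+1%:R^-1 : R).
have mesh0 m : 0 < m.+1%:R^-1 :> R by rewrite invr_gt0.
have ngrid m := truncn_grid t0 (mesh0 m).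
have nt m : (n m)%:R * m.+1%:R^-1 <= N.+1%:R :> R.
  by have /andP[] := ngrid m.
have eta4 : 0 < eta / 4 by exact: divr_gt0.
have Hosc := oscillates_prob N20 eta4 mB cB nt.
have [m [[mesh Hm] Pbad]] := filter_ex (filterI H Hosc).
move: (nt m) (ngrid m); set e := m.+1%:R^-1 in mesh Hm Pbad *.
rewrite -/(n m); move: (n m) Pbad => {nt ngrid H Hosc}n Pbad net ngrid.
have [[e0 e1] _ _ _ _] := mesh.
have {ngrid} /andP[_ tn] := ngrid.
have xiP := brownian_increments e0 brownian.
pose A k := maybe_zero r l N%:R e eta (increments path e) k (n - k).
pose bad := oscillates path e (eta / 4) n.
have mA k : measurable (A k) by exact: (measurable_maybe_zero _ _ q0 mesh xiP).
have mbad : measurable bad by exact: measurable_oscillates.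
exists (fun w => e * \sum_(k < n) \1_(A k) w + N%:R * \1_bad w); split.
- apply: measurable_funD; apply: measurable_funM => //.
  by apply: measurable_sum => k; exact: measurable_indic.
- by move=> w; rewrite addr_ge0// mulr_ge0// ?sumr_ge0// ltW.
- rewrite integral_indic_sum//; last exact: ltW.
  have h1 := Hm d T P (increments path e) n (fun k => n - k)%N xiP net.
  rewrite lee_fin [X in _ <= _ + X]splitr addrA; apply: lerD; first exact: h1.
  apply: (@le_trans _ _ (N.+1%:R * (N.+1%:R^-1 ^+ 2 / 2))).
    apply: ler_pM => //; first by rewrite fine_ge0.
      by rewrite ler_nat.
    by rewrite -lee_fin fineK// fin_num_measure.
  by rewrite expr2 !mulrA mulfV// mul1r.
move=> w x ok tau /andP[tau0 tauN] xtau.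
have S0 : 0 <= e * \sum_(k < n) (\1_(A k) w : R).
  by rewrite mulr_ge0 ?sumr_ge0// ltW.
have [bw|nbw] := pselect (bad w).
  by rewrite indicE mem_set// mulr1 -[leLHS]add0r lerD.
have [cb _ _ _ _] := ok.
have osc := small_osc_of_not_oscillates e0 cb nbw.
rewrite indicE memNset// mulr0 addr0.
(* The grid aims at [N + 1]: rounded down by less than [e <= 1], it still covers [N]. *)
have taun : tau <= n%:R * e.
  apply: le_trans tauN _; move: tn; rewrite -[n.+1%:R]natr1 -[N.+1%:R]natr1 mulrDl.
  by move: e1; lra.
apply: le_trans (count_ge e0 taun) _.
rewrite ler_pM2l//; apply: ler_sum => k _; have [ktau|_] := leP (k%:R * e) tau;
  last by rewrite indicE ler0n.
rewrite indicE mem_set//; have kn := ltnW (ltn_ord k).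
apply: (zero_maybe_zero (n := n) r0 l0 rN lN mesh ok osc _ _ xtau); rewrite subnKC//.
by rewrite ktau.
Qed.

(** [G] counts [surely_zero] outside the oscillation event. Each [k] counted has a zero strictly
    after [k * e], so [k * e < M], and [count_le] bounds their number up to one cell. *)
Lemma lower_approx (eps : R) : 0 < eps -> exists2 t : R, 0 < t &
  forall N : nat, r <= N%:R -> l <= N%:R -> exists G : T -> R,
  [/\ measurable_fun [set: T] G, forall w, 0 <= G w <= t,
      ((pot0 q r l - eps)%:E <= \int[P]_w (G w)%:E)%E
    & forall w x, path_ok r l N%:R (fun t => B t w) x -> forall M, 0 <= M ->
        (forall tau, x tau = B tau w -> tau <= M) -> G w <= M + N.+1%:R^-1].
Proof.
move=> eps0; have eps2 : 0 < eps / 2 by exact: divr_gt0.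
have [t t0 H] := surely_zero_limit q0 r0 l0 eps2.
exists t => // N rN lN; have [eta eta0 /near0_inv{}H] := H _ rN lN.
pose n m := Num.truncn (t / m.+1%:R^-1 : R).
have mesh0 m : 0 < m.+1%:R^-1 :> R by rewrite invr_gt0.
have ngrid m := truncn_grid (ltW t0) (mesh0 m).
have nt m : (n m)%:R * m.+1%:R^-1 <= t.
  by have /andP[] := ngrid m.
have eta4 : 0 < eta / 4 by exact: divr_gt0.
have epst : 0 < eps / 2 / t by exact: divr_gt0.
have Hosc := oscillates_prob epst eta4 mB cB nt.
(* Makes the extra cell of [count_le] at most [1 / (N + 1)]. *)
have HN : \forall m \near \oo, (N <= m)%N by exact: nbhs_infty_ge.
have [m [[[mesh [n1 [n' [n1n' n't Hm]]]] Pbad] Nm]] := filter_ex (filterI (filterI H Hosc) HN).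
have eN : m.+1%:R^-1 <= N.+1%:R^-1 :> R by rewrite lef_pV2 ?posrE// ler_nat.
move: (nt m) (ngrid m); set e := m.+1%:R^-1 in mesh Hm Pbad eN n't *.
rewrite -/(n m); move: (n m) Pbad => {nt ngrid H Hosc}n Pbad net ngrid.
have [[e0 e1] _ _ _ _] := mesh.
have {ngrid} /andP[_ tn] := ngrid.
have n'n : (n' <= n)%N.
  by rewrite -ltnS -(ltr_nat R) -(ltr_pM2r e0) (le_lt_trans n't).
have n1t : n1%:R * e <= t.
  by apply: le_trans n't; rewrite ler_pM2r// ler_nat ltnW.
have xiP := brownian_increments e0 brownian.
pose A k := surely_zero r l N%:R e eta (increments path e) k (n' - k).
pose bad := oscillates path e (eta / 4) n.
have mA k : measurable (A k) by exact: (measurable_surely_zero _ _ q0 mesh xiP).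
have mbad : measurable bad by exact: measurable_oscillates.
pose Ab k := A k `\` bad.
have mAb k : measurable (Ab k) by exact: measurableD.
have S0 w : 0 <= e * \sum_(k < n1) (\1_(Ab k) w : R).
  by rewrite mulr_ge0 ?sumr_ge0// ltW.
exists (fun w => e * \sum_(k < n1) \1_(Ab k) w + 0 * \1_bad w); split.
- apply: measurable_funD; apply: measurable_funM => //.
  by apply: measurable_sum => k; exact: measurable_indic.
- move=> w; rewrite mul0r addr0 S0/=; apply: le_trans n1t; rewrite mulrC ler_pM2r//.
  rewrite -[n1 in leRHS]card_ord -sumr_const; apply: ler_sum => k _.
  by rewrite indicE; case: (_ \in _).
- rewrite integral_indic_sum//; last exact: ltW.
  rewrite mul0r addr0 lee_fin.
  have h1 := Hm d T P (increments path e) xiP.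
  have h2 k : (k < n1)%N -> fine (P (A k)) <= fine (P (Ab k)) + eps / 2 / t.
    move=> _; apply: (@le_trans _ _ (fine (P (Ab k)) + fine (P bad))).
      rewrite -lee_fin EFinD !fineK ?fin_num_measure//.
      apply: (@le_trans _ _ (P (Ab k `|` bad))).
        apply: le_measure; rewrite ?inE//; first exact: measurableU.
        by move=> w Aw; have [?|?] := pselect (bad w); [right|left].
      exact: measureU2.
    by rewrite lerD2l -lee_fin fineK// fin_num_measure.
  have h3 := sum_shift_le (ltW e0) h2.
  have h4 : n1%:R * e * (eps / 2 / t) <= eps / 2.
    apply: (@le_trans _ _ (t * (eps / 2 / t))); first by rewrite ler_wpM2r// ltW.
    by rewrite mulrC divfK// lt0r_neq0.
  rewrite /A in h3; move: h1 h3 h4; move: (_ * \sum_(k < n1) _) (_ * \sum_(k < n1) _) (n1%:R * e * _).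
  by move=> *; lra.
move=> w x ok M M0 HM; rewrite mul0r addr0.
apply: le_trans (_ : M + e <= _); last by rewrite lerD2l.
apply: le_trans (count_le n1 e0 M0); rewrite ler_pM2l//; apply: ler_sum => k _.
rewrite indicE; have [|//] := boolP (_ \in _); rewrite inE => -[Aw nbw].
have [cb _ _ _ _] := ok.
have osc := small_osc_of_not_oscillates e0 cb nbw.
have kn' : (k < n')%N by apply: ltn_trans n1n'.
have := surely_zero_zero r0 l0 rN lN mesh ok osc (k := k) (m := n' - k).
rewrite subn_gt0 subnKC ?(ltnW kn')// => /(_ kn' n'n Aw)[tau /andP[ktau _]] /HM tauM.
by rewrite (lt_le_trans ktau).
Qed.

End approximations.

(** * Limits inferior, and integrals of functions that may fail to be measurable *)

Section limits.
Local Open Scope ereal_scope.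
Context {R : realType}.

Lemma limn_einf_ge (a : \bar R) (u : (\bar R)^nat) : (\forall n \near \oo, a <= u n) ->
  a <= limn_einf u.
Proof.
move=> [N _ H]; rewrite limn_einf_lim; apply: lime_ge; first exact: is_cvg_einfs.
exists N => // n /= Nn; apply: le_ereal_inf_tmp => _ [k /= nk <-].
by apply: H => /=; exact: leq_trans nk.
Qed.

Lemma limn_einf_le (a : \bar R) (u : (\bar R)^nat) : (\forall n \near \oo, u n <= a) ->
  limn_einf u <= a.
Proof.
move=> H; rewrite limn_einf_lim; apply: lime_le; first exact: is_cvg_einfs.
apply: filterS H => n; apply: le_trans; apply: ereal_inf_lbound.
by exists n => /=.
Qed.

Lemma measurable_limn_einf (d : measure_display) (T : measurableType d)
    (f : (T -> \bar R)^nat) : (forall n, measurable_fun [set: T] (f n)) ->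
  measurable_fun [set: T] (fun w => limn_einf (f ^~ w)).
Proof.
move=> mf; apply: (measurableT_comp (f := -%E)) => //.
apply: (measurable_fun_limn_esup (f := fun n w => - f n w)) => n.
exact: measurableT_comp.
Qed.

End limits.

(* [f] need not be measurable: nothing is known about the measurability of [bifurcation_time]. *)
Section nonmeasurable_integral.
Import HBNNSimple.
Local Open Scope ereal_scope.
Context {d : measure_display} {T : measurableType d} {R : realType}.
Variables (mu : {measure set T -> \bar R}) (f g : T -> \bar R).
Hypotheses (mg : measurable_fun [set: T] g) (g0 : forall w, 0 <= g w).

(** The integral of the positive part is a supremum over simple functions below it, each of them
    below [g] almost everywhere; the negative part only lowers the left side. *)
Lemma integral_le_ae : {ae mu, forall w, f w <= g w} -> \int[mu]_w f w <= \int[mu]_w g w.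
Proof.
move=> fg; rewrite integralE.
apply: (@le_trans _ _ (\int[mu]_w f^\+ w)).
  by rewrite geeDl// oppe_le0; apply: integral_ge0.
rewrite ge0_integralTE//; apply: ge_ereal_sup => _ [h /= hf <-].
rewrite -integralT_nnsfun; apply: ae_ge0_le_integral => //.
- by move=> w _; rewrite lee_fin fun_ge0.
- exact/measurable_EFinP.
apply: filterS fg => w fgw _; apply: le_trans (hf w) _.
by rewrite funeposE ge_max fgw g0.
Qed.

End nonmeasurable_integral.

(** Setting [g] to 0 on a null set keeps its integral and makes the inequality with the positive
    part of [f] hold everywhere, hence for simple functions. The negative part of [f] is null almost
    everywhere, so [integral_le_ae] applies to it. *)
Lemma integral_ge_ae (d : measure_display) (T : measurableType d) (R : realType)
    (mu : {measure set T -> \bar R}) (f g : T -> \bar R) :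
  measurable_fun [set: T] g -> (forall w, 0 <= g w)%E -> {ae mu, forall w, (g w <= f w)%E} ->
  (\int[mu]_w g w <= \int[mu]_w f w)%E.
Proof.
move=> mg g0 gf; rewrite [leRHS]integralE.
have -> : (\int[mu]_w f^\- w = 0)%E.
  apply/eqP; rewrite eq_le integral_ge0// andbT -(integral0 mu [set: T]).
  apply: integral_le_ae => //; apply: filterS gf => w gfw.
  by rewrite funenegE ge_max lexx andbT oppe_le0 (le_trans (g0 w)).
rewrite sube0; have [N [mN N0 NP]] := gf.
have mg' : measurable_fun [set: T] (g \_ (~` N)).
  by apply/(measurable_restrictT _ (measurableC mN)); exact: measurable_funS mg.
have g'0 w : (0 <= (g \_ (~` N)) w)%E by rewrite patchE; case: ifP.
rewrite (ge0_ae_eq_integral measurableT mg mg')//; last first.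
  exists N; split => // w /= gw; apply: contrapT => Nw; apply: gw => _.
  by rewrite patchE mem_set.
rewrite !ge0_integralTE//.
apply: ereal_sup_le => _ [h /= hg <-]; exists h => //= w.
apply: le_trans (hg w) _; rewrite patchE; case: ifPn; rewrite ?inE => Nw.
  rewrite funeposE le_max; apply/orP; left; apply: contrapT => gfw.
  by apply: Nw; exact: NP.
exact: funepos_ge0.
Qed.

(** [lipschitz] states the bound for all constants near infinity, hence for all large integers, from
    a rank that depends on the path. *)
Lemma solution_path_ok (R : realType) (beta1 beta2 : R) (b x : R -> R) :
  continuous b -> b 0 = 0 -> lipschitz_solution beta1 beta2 b x ->
  \forall N \near \oo, path_ok (- beta1) beta2 N%:R b x.
Proof.
move=> cb b0 [lip x0 d1 d2]; have [M [_ HM]] := lip.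
apply: filterS (nbhs_infty_gtr M) => N MN; split => //.
- by move=> s t; exact: (HM N%:R MN (s, t)).
- by split => // t; rewrite opprK; exact: d1.
Qed.

(** * Expectation of the bifurcation time *)

Section bifurcation.
Context {d : measure_display} {T : measurableType d} {R : realType}.
Variables (P : probability T R) (sigma beta1 beta2 : R) (B X : R -> {RV P >-> R}).
Hypotheses (sigma2_gt0 : 0 < sigma ^+ 2) (beta1_lt0 : beta1 < 0) (beta2_gt0 : 0 < beta2).
Hypothesis B_brownian : brownian_motion sigma B.
Hypothesis X_solution : {ae P, forall w,
  lipschitz_solution beta1 beta2 (fun t => B t w) (fun t => X t w)}.

Let r := - beta1.
Let r0 : 0 < r. Proof. by rewrite oppr_gt0. Qed.
Let bif w := bifurcation_time (fun t => B t w) (fun t => X t w).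
Let N0 := (Num.truncn (r + beta2)).+1.

Let rN k : r <= (N0 + k)%:R.
Proof.
apply: (@le_trans _ _ (r + beta2)); first by rewrite lerDl ltW.
by rewrite (le_trans (ltW (truncnS_gt _)))// ler_nat leq_addr.
Qed.

Let lN k : beta2 <= (N0 + k)%:R.
Proof.
apply: (@le_trans _ _ (r + beta2)); first by rewrite lerDr ltW// r0.
by rewrite (le_trans (ltW (truncnS_gt _)))// ler_nat leq_addr.
Qed.

Let good : {ae P, forall w, \forall k \near \oo,
  path_ok r beta2 (N0 + k)%:R (fun t => B t w) (fun t => X t w)}.
Proof.
case: B_brownian => B0 cB _ _.
apply: filterS3 B0 cB X_solution => w B0w cw solw.
have [M _ HM] := solution_path_ok cw B0w solw.
by exists M => // k /= Mk; apply: HM => /=; apply: leq_trans Mk _; exact: leq_addl.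
Qed.

Let near_inv (e : R) : 0 < e -> \forall k \near \oo, (N0 + k).+1%:R^-1 <= e.
Proof.
move=> e0; have := near0_inv (nbhs_right_le e0) => -[M _ HM].
exists M => // k /= Mk; apply: (HM (N0 + k)%N) => /=.
by apply: leq_trans Mk _; exact: leq_addl.
Qed.

(** For large [k] the integer [N0 + k] bounds both the Lipschitz constant of the path and a given
    zero, so each zero is at most the limit inferior of [F k]; negative zeros are covered by
    [F k >= 0]. *)
Lemma bifurcation_upper : (\int[P]_w bif w <= (pot0 (sigma ^+ 2) r beta2)%:E)%E.
Proof.
have [F HF] := choice (fun k => upper_approx sigma2_gt0 r0 beta2_gt0 B_brownian (rN k) (lN k)).
have mF k : measurable_fun [set: T] (fun w => (F k w)%:E).
  by apply/measurable_EFinP; have [] := HF k.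
have F0 k w : (0 <= (F k w)%:E)%E by rewrite lee_fin; have [_ ->] := HF k.
apply: (@le_trans _ _ (\int[P]_w limn_einf (fun k => (F k w)%:E))%E).
  apply: integral_le_ae.
  - exact: measurable_limn_einf.
  - by move=> w; apply: limn_einf_ge; exact: nearW.
  apply: filterS good => w gw; apply: ge_ereal_sup => _ [tau /= Xtau <-].
  apply: limn_einf_ge; have [tau0|tau0] := leP 0 tau; last first.
    by apply: nearW => k; apply: le_trans (F0 k w); rewrite lee_fin ltW.
  have near_tau : \forall k \near \oo, tau <= (N0 + k)%:R.
    have [M _ HM] := nbhs_infty_ger tau.
    by exists M => // k /= Mk; apply: HM => /=; apply: leq_trans Mk _; exact: leq_addl.
  apply: filterS2 gw near_tau => k ok tauk; rewrite lee_fin.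
  have [_ _ _ H] := HF k; apply: (H w _ ok tau) => //.
  by rewrite tau0.
apply: le_trans (fatou P measurableT mF (fun k w _ => F0 k w)) _.
apply/lee_addgt0Pr => e e0; apply: limn_einf_le.
apply: filterS (near_inv e0) => k ke; have [_ _ IF _] := HF k.
by apply: le_trans IF _; rewrite lee_fin lerD2l.
Qed.

(** The limit superior of [G k] is what lies below the last zero, so Fatou's lemma is applied to
    [t - G k >= 0]; this works because [t] is common to all [k]. *)
Lemma bifurcation_lower (eps : R) : 0 < eps ->
  ((pot0 (sigma ^+ 2) r beta2 - eps)%:E <= \int[P]_w bif w)%E.
Proof.
move=> eps0.
have [t t0 Ht] := lower_approx sigma2_gt0 r0 beta2_gt0 B_brownian eps0.
have [G HG] := choice (fun k => Ht _ (rN k) (lN k)).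
have mG k : measurable_fun [set: T] (G k) by have [] := HG k.
have G0t k w : 0 <= G k w <= t by have [_ ->] := HG k.
pose H k w := (t - G k w)%:E.
have mH k : measurable_fun [set: T] (H k).
  by apply/measurable_EFinP; exact: measurable_funB.
have H0 k w : (0 <= H k w)%E.
  by rewrite lee_fin subr_ge0; have /andP[] := G0t k w.
have Ht' k w : (H k w <= t%:E)%E.
  by rewrite lee_fin gerBl; have /andP[] := G0t k w.
pose h w := limn_einf (fun k => H k w).
have mh : measurable_fun [set: T] h by exact: measurable_limn_einf.
have h0 w : (0 <= h w)%E by apply: limn_einf_ge; exact: nearW.
have ht w : (h w <= t%:E)%E by apply: limn_einf_le; exact: nearW.
have hfin w : h w \is a fin_num.
  by rewrite ge0_fin_numE// (le_lt_trans (ht w))// ltry.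
have Pt : (\int[P]_w t%:E = t%:E)%E.
  by rewrite integral_cst// [X in (_ * X)%E]probability_setT mule1.
have icst : P.-integrable [set: T] (EFin \o cst t).
  exact: finite_measure_integrable_cst.
have IH k : (\int[P]_w H k w = t%:E - \int[P]_w (G k w)%:E)%E.
  have iG : P.-integrable [set: T] (EFin \o G k).
    apply: (le_integrable measurableT _ _ icst) => //.
      exact/measurable_EFinP.
    move=> w _ /=; rewrite lee_fin; have /andP[? ?] := G0t k w.
    by rewrite !ger0_norm// ltW.
  rewrite /H; under eq_integral do rewrite EFinB.
  by rewrite (integralB_EFin measurableT icst iG) Pt.
have Ih : (\int[P]_w h w <= (t - (pot0 (sigma ^+ 2) r beta2 - eps))%:E)%E.
  apply: le_trans (fatou P measurableT mH (fun k w _ => H0 k w)) _.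
  apply: limn_einf_le; apply: nearW => k; rewrite IH EFinB leeB//.
  by have [] := HG k.
apply: (@le_trans _ _ (\int[P]_w (t%:E - h w))%E).
  have ih : P.-integrable [set: T] h.
    apply: (le_integrable measurableT _ _ icst) => //.
    by move=> w _ /=; rewrite gee0_abs// (le_trans (ht w))// lee_fin ler_norm.
  rewrite (integralB measurableT icst ih) Pt; apply: le_trans (leeB (lexx t%:E) Ih).
  by rewrite -EFinB lee_fin; lra.
apply: integral_ge_ae.
- by apply: emeasurable_funB => //; exact: measurable_cst.
- by move=> w; rewrite sube_ge0// ?hfin ?orbT// ht.
apply: filterS good => w gw.
have [k0 okk0] := filter_ex gw; have [_ B0w X0w _ _] := okk0.
(* Time 0 is itself a zero, so the supremum is over a nonempty set. *)
have bif0 : (0 <= bif w)%E.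
  by apply: ereal_sup_ubound; exists 0 => //=; rewrite B0w.
rewrite leeBlDr ?hfin//.
have [bfin|] := boolP (bif w \is a fin_num); last first.
  rewrite ge0_fin_numE// ltey negbK => /eqP ->.
  by rewrite addye ?leey// -ltNye (lt_le_trans _ (h0 w)).
rewrite -leeBlDl//.
apply/lee_addgt0Pr => e e0; rewrite -leeBlDr//.
apply: limn_einf_ge; apply: filterS2 gw (near_inv e0) => k ok ke.
have [_ _ _ /(_ w _ ok (fine (bif w)))] := HG k.
have M0 : 0 <= fine (bif w) by exact: fine_ge0.
have HM tau : X tau w = B tau w -> tau <= fine (bif w).
  by move=> E; rewrite -lee_fin fineK//; apply: ereal_sup_ubound; exists tau.
move=> /(_ M0 HM) GM.
have {}GM : G k w <= fine (bif w) + e by apply: le_trans GM _; rewrite lerD2l.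
rewrite -(fineK bfin) -!EFinB lee_fin.
by rewrite -addrA lerD2l -opprD lerN2.
Qed.

End bifurcation.

Theorem theorem4p4 (R : realType) (d : measure_display)
    (T : measurableType d) (P : probability T R)
    (sigma beta1 beta2 : R) (B X : R -> {RV P >-> R})
    (sigma2_gt0 : 0 < sigma ^+ 2)
    (beta1_lt0 : beta1 < 0) (beta2_gt0 : 0 < beta2)
    (B_brownian : brownian_motion sigma B)
    (X_solution : {ae P, forall w,
       lipschitz_solution beta1 beta2 (fun t => B t w) (fun t => X t w)}) :
  (\int[P]_w bifurcation_time (fun t => B t w) (fun t => X t w)
     = (sigma ^+ 2 / `|2 * beta1 * beta2|)%:E)%E.
Proof.
have -> : `|2 * beta1 * beta2| = 2 * (- beta1) * beta2.
  by rewrite !normrM (gtr0_norm beta2_gt0) (ltr0_norm beta1_lt0) ger0_norm.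
apply/eqP; rewrite eq_le; apply/andP; split.
  exact: (bifurcation_upper sigma2_gt0 beta1_lt0 beta2_gt0 B_brownian X_solution).
apply/lee_addgt0Pr => eps eps0; rewrite -leeBlDr// -EFinB.
exact: (bifurcation_lower sigma2_gt0 beta1_lt0 beta2_gt0 B_brownian X_solution eps0).
Qed.
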